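(* Let $M$ be a $7$-manifold and let $(\varphi,X,\lambda)$ be a Laplacian soliton on $M$, i.e. $\varphi$ is a closed $G_2$ structure on $M$, $X$ is a vector field on $M$, $\lambda\in\mathbb{R}$, and $\Delta_\varphi\varphi=\lambda\varphi+\mathcal{L}_X\varphi$. Then the metric $g$ associated to $\varphi$ satisfies, in local coordinates, $$-R_{ij}-\frac13|T|^2g_{ij}-2T_i^{\ k}T_{kj}=\frac13\lambda g_{ij}+\frac12(\mathcal{L}_Xg)_{ij},$$ and the vector field $X$ satisfies $d^*(X\lrcorner\varphi)=0$.
   Context: A $G_2$ structure on a $7$-manifold $M$ is a $3$-form $\varphi$ such that for each $x\in M$ there is a linear isomorphism $u:T_xM\to\mathbb{R}^7$ with $u^*\phi=\varphi_x$, where $\phi=e^{123}+e^{145}+e^{167}+e^{246}-e^{257}-e^{347}-e^{356}$. It determines a unique metric $g$ and orientation by $g(u,v)\,vol_g=\frac16(u\lrcorner\varphi)\wedge(v\lrcorner\varphi)\wedge\varphi$, hence a Hodge star $*_\varphi$ and the Hodge Laplacian $\Delta_\varphi=dd^*+d^*d$; put $\psi=*_\varphi\varphi$ and let $\nabla$ be the Levi-Civita connection of $g$. The $G_2$ structure is closed if $d\varphi=0$. Its torsion tensor is the $2$-tensor $T$ with $\nabla_i\varphi_{jkl}=T_i^{\ m}\psi_{mjkl}$, i.e. $T_i^{\ j}=\frac1{24}\nabla_i\varphi_{lmn}\psi^{jlmn}$; it is skew-symmetric when $\varphi$ is closed. Here $T_i^{\ k}=T_{il}g^{kl}$, $|T|^2=T_{ik}T_{jl}g^{ij}g^{kl}$,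 and $R_{ij}$ is the Ricci tensor of $g$ (with the sign convention that it is positive on round spheres). *)

(* Defs.v *)
From HB Require Import structures.
From mathcomp Require Import all_boot all_order all_algebra fingroup perm.
From mathcomp Require Import all_classical all_reals all_analysis.

Set Implicit Arguments.
Unset Strict Implicit.
Unset Printing Implicit Defensive.

Import Order.TTheory GRing.Theory Num.Theory.
Import numFieldNormedType.Exports.

Local Open Scope classical_set_scope.
Local Open Scope ring_scope.

Section Calculus.
Variable R : realType.
Local Notation E := 'rV[R]_7.

Definition pd (i : 'I_7) (f : E -> R) : E -> R :=
  fun x => 'D_(delta_mx 0 i) f x.

Definition iter_pd (s : seq 'I_7) (f : E -> R) : E -> R := foldr pd f s.

(* C^oo on the open set U: all iterated partial derivatives exist and are
   continuous at the points of U. *)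
Definition smooth_on (U : set E) (f : E -> R) : Prop :=
  forall (s : seq 'I_7) (x : E), U x ->
    {for x, continuous (iter_pd s f)} /\
    forall i : 'I_7, derivable (iter_pd s f) x (delta_mx 0 i).

End Calculus.

Section Manifold.
Variable R : realType.
Local Notation E := 'rV[R]_7.

Record chart (M : topologicalType) := Chart {
  cdom : set M ;
  cimg : set E ;
  cmap : M -> E ;
  cinv : E -> M ;
  cdom_open : open cdom ;
  cimg_open : open cimg ;
  cmap_img : forall p, cdom p -> cimg (cmap p) ;
  cinv_dom : forall x, cimg x -> cdom (cinv x) ;
  cmapK : forall p, cdom p -> cinv (cmap p) = p ;
  cinvK : forall x, cimg x -> cmap (cinv x) = x ;
  cmap_continuous : {within cdom, continuous cmap} ;
  cinv_continuous : {within cimg, continuous cinv} }.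

(* The part of the image of [a] that lies over the domain of [b]. *)
Definition overlap (M : topologicalType) (a b : chart M) : set E :=
  [set x | cimg a x /\ cdom b (cinv a x)].

Definition transition (M : topologicalType) (a b : chart M) : E -> E :=
  fun x => cmap b (cinv a x).

Record manifold7 := Manifold7 {
  mspace :> topologicalType ;
  mindex : Type ;
  mchart : mindex -> chart mspace ;
  mspace_hausdorff : hausdorff_space mspace ;
  mspace_second_countable : @second_countable mspace ;
  mchart_cover : forall p : mspace, exists a : mindex, cdom (mchart a) p ;
  mchart_smooth : forall (a b : mindex) (j : 'I_7),
    smooth_on (overlap (mchart a) (mchart b))
      (fun x => transition (mchart a) (mchart b) x 0 j) }.

End Manifold.

Section PointwiseTensors.
Variable R : realType.
Local Notation E := 'rV[R]_7.

(* The array of components of a k-covariant tensor in a basis of the tangent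
   space.  A k-form is an alternating array w, standing for
   (1/k!) \sum_I w I dx^{i_1} /\ ... /\ dx^{i_k}. *)
Definition cotensor (k : nat) : Type := k.-tuple 'I_7 -> R.

Definition tcons (k : nat) (i : 'I_7) (I : k.-tuple 'I_7) : k.+1.-tuple 'I_7 :=
  [tuple of i :: I].

Definition tsubst (k : nat) (I : k.-tuple 'I_7) (l : 'I_k) (m : 'I_7) :
    k.-tuple 'I_7 :=
  [tuple if r == l then m else tnth I r | r < k].

Definition tperm_idx (k : nat) (s : 'S_k) (I : k.-tuple 'I_7) : k.-tuple 'I_7 :=
  [tuple tnth I (s r) | r < k].

Definition alternating (k : nat) (w : cotensor k) : Prop :=
  forall (s : 'S_k) (I : k.-tuple 'I_7), w (tperm_idx s I) = (-1) ^+ s * w I.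

(* Pull-back by the linear map sending the i-th basis vector to
   \sum_j A i j e_j. *)
Definition pullback (k : nat) (A : 'M[R]_7) (w : cotensor k) : cotensor k :=
  fun I => \sum_(J : k.-tuple 'I_7) w J * \prod_(l < k) A (tnth I l) (tnth J l).

Definition iprod (k : nat) (v : E) (w : cotensor k.+1) : cotensor k :=
  fun I => \sum_(m < 7) v 0 m * w (tcons m I).

Definition wedge (k m : nat) (w : cotensor k) (z : cotensor m) :
    cotensor (k + m) :=
  fun I => ((k`! * m`!)%N%:R)^-1 *
    \sum_(s : 'S_(k + m)) (-1) ^+ s *
      w [tuple tnth I (s (lshift m r)) | r < k] *
      z [tuple tnth I (s (rshift k r)) | r < m].

(* e^{abc}, with a, b, c between 1 and 7 *)
Definition e3 (a b c : nat) : cotensor 3 :=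
  fun I => \det (\matrix_(r < 3, q < 3)
    ((tnth I r).+1 == nth 0%N [:: a; b; c] q)%:R).

Definition phi0 : cotensor 3 := fun I =>
  e3 1 2 3 I + e3 1 4 5 I + e3 1 6 7 I + e3 2 4 6 I
  - e3 2 5 7 I - e3 3 4 7 I - e3 3 5 6 I.

(* The Levi-Civita symbol of a sequence of seven indices. *)
Definition levi_civita (s : seq 'I_7) : R :=
  \det (\matrix_(r < 7, q < 7) (nth ord0 s r == q)%:R).

(* [metric_volume phi (g, nu)]: g is the matrix of an inner product with
   volume form nu dx^1 /\ ... /\ dx^7 (so nu = +- sqrt (det g), the sign giving
   the orientation) and g(u,v) vol = (1/6) (u _| phi) /\ (v _| phi) /\ phi,
   both sides being evaluated on the coordinate basis. *)
Definition metric_volume (phi : cotensor 3) (gn : 'M[R]_7 * R) : Prop :=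
  [/\ gn.1^T = gn.1,
      forall v : E, v != 0 -> 0 < (v *m gn.1 *m v^T) 0 0,
      gn.2 ^+ 2 = \det gn.1
    & forall u v : E,
        (u *m gn.1 *m v^T) 0 0 * gn.2 =
        6%:R^-1 *
        wedge (wedge (iprod u phi) (iprod v phi)) phi (ord_tuple 7)].

Definition g2_metric_volume (phi : cotensor 3) : 'M[R]_7 * R :=
  xget (1%:M, 1) [set gn | metric_volume phi gn].

Definition g2_metric (phi : cotensor 3) : 'M[R]_7 := (g2_metric_volume phi).1.
Definition g2_volume (phi : cotensor 3) : R := (g2_metric_volume phi).2.

Definition raise (k : nat) (g : 'M[R]_7) (w : cotensor k) : cotensor k :=
  pullback (invmx g) w.

(* Hodge star from k-forms to m-forms, meaningful when k + m = 7; its sign is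
   such that a /\ * b = <a, b> vol. *)
Definition star (k m : nat) (g : 'M[R]_7) (nu : R) (w : cotensor k) :
    cotensor m :=
  fun J => (k`!%:R)^-1 *
    \sum_(I : k.-tuple 'I_7) raise g w I * (nu * levi_civita (I ++ J)).

End PointwiseTensors.

Arguments star {R k} m g nu w.

Section LocalCalculus.
Variable R : realType.
Local Notation E := 'rV[R]_7.

Definition ext_d (k : nat) (w : E -> cotensor R k) : E -> cotensor R k.+1 :=
  fun x I => \sum_(r < k.+1) (-1) ^+ r *
    pd (tnth I r) (fun y => w y [tuple tnth I (lift r l) | l < k]) x.

(* d^* = (-1)^p * d * on p-forms in dimension 7, here with p = k.+1 <= 7. *)
Definition codiff (k : nat) (g : E -> 'M[R]_7) (nu : E -> R)
    (w : E -> cotensor R k.+1) : E -> cotensor R k :=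
  fun x I => (-1) ^+ k.+1 *
    star k (g x) (nu x)
      (ext_d (fun y => star (6 - k) (g y) (nu y) (w y)) x) I.

Definition hodge_laplacian (k : nat) (g : E -> 'M[R]_7) (nu : E -> R)
    (w : E -> cotensor R k.+1) : E -> cotensor R k.+1 :=
  fun x I => ext_d (codiff g nu w) x I + codiff g nu (ext_d w) x I.

Definition lie_derivative (k : nat) (X : E -> E) (w : E -> cotensor R k) :
    E -> cotensor R k :=
  fun x I => \sum_(m < 7) X x 0 m * pd m (fun y => w y I) x
    + \sum_(l < k) \sum_(m < 7)
        pd (tnth I l) (fun y => X y 0 m) x * w x (tsubst I l m).

Definition metric_tensor (g : E -> 'M[R]_7) : E -> cotensor R 2 :=
  fun x I => g x (tnth I ord0) (tnth I ord_max).

(* [christoffel g i j k x] is Gamma^k_{ij}. *)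
Definition christoffel (g : E -> 'M[R]_7) (i j k : 'I_7) : E -> R :=
  fun x => 2%:R^-1 * \sum_(l < 7) invmx (g x) k l *
    (pd i (fun y => g y j l) x + pd j (fun y => g y i l) x
     - pd l (fun y => g y i j) x).

Definition nabla (k : nat) (g : E -> 'M[R]_7) (w : E -> cotensor R k)
    (i : 'I_7) : E -> cotensor R k :=
  fun x I => pd i (fun y => w y I) x
    - \sum_(l < k) \sum_(m < 7)
        christoffel g i (tnth I l) m x * w x (tsubst I l m).

(* R_{ij}, positive on round spheres. *)
Definition ricci (g : E -> 'M[R]_7) (i j : 'I_7) : E -> R :=
  fun x => \sum_(k < 7)
    (pd k (christoffel g i j k) x - pd j (christoffel g i k k) x
     + \sum_(l < 7) (christoffel g k l k x * christoffel g i j l x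
                     - christoffel g j l k x * christoffel g i k l x)).

Variable phi : E -> cotensor R 3.

Definition gmet : E -> 'M[R]_7 := fun x => g2_metric (phi x).
Definition gvol : E -> R := fun x => g2_volume (phi x).

Definition psi : E -> cotensor R 4 := fun x => star 4 (gmet x) (gvol x) (phi x).

(* T_i^j = (1/24) nabla_i phi_{lmn} psi^{jlmn} *)
Definition torsion_mixed (i j : 'I_7) : E -> R :=
  fun x => 24%:R^-1 * \sum_(I : 3.-tuple 'I_7)
    nabla gmet phi i x I * raise (gmet x) (psi x) (tcons j I).

(* T_{ij} = T_i^k g_{kj} *)
Definition torsion (i j : 'I_7) : E -> R :=
  fun x => \sum_(k < 7) torsion_mixed i k x * gmet x k j.

(* |T|^2 = T_{ik} T_{jl} g^{ij} g^{kl} *)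
Definition torsion_norm2 : E -> R :=
  fun x => \sum_(i < 7) \sum_(j < 7) \sum_(k < 7) \sum_(l < 7)
    torsion i k x * torsion j l x * invmx (gmet x) i j * invmx (gmet x) k l.

Definition laplacian_phi : E -> cotensor R 3 := hodge_laplacian gmet gvol phi.

End LocalCalculus.

Section Fields.
Variables (R : realType) (M : manifold7 R).
Local Notation E := 'rV[R]_7.

(* Tensor fields are given by their components in all the charts of the atlas,
   as functions on the coordinate domains (values outside [cimg] are
   irrelevant), related by the usual change-of-coordinates rule.  In the
   library's row-vector convention, 'J f x i j is the derivative of the j-th
   component of f in the i-th direction. *)
Definition cotensor_field (k : nat) : Type := mindex M -> E -> cotensor R k.

Definition vector_family : Type := mindex M -> E -> E.

Definition is_form (k : nat) (w : cotensor_field k) : Prop :=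
  [/\ forall a (I : k.-tuple 'I_7),
        smooth_on (cimg (mchart a)) (fun x => w a x I),
      forall a x, cimg (mchart a) x -> alternating (w a x)
    & forall a b x, overlap (mchart a) (mchart b) x ->
        w a x = pullback ('J (transition (mchart a) (mchart b)) x)
                  (w b (transition (mchart a) (mchart b) x))].

Definition is_vector_field (X : vector_family) : Prop :=
  (forall a (j : 'I_7), smooth_on (cimg (mchart a)) (fun x => X a x 0 j)) /\
  (forall a b x, overlap (mchart a) (mchart b) x ->
     X b (transition (mchart a) (mchart b) x) =
     X a x *m 'J (transition (mchart a) (mchart b)) x).

(* The matrix u is that of a linear isomorphism T_x M -> R^7 in the
   coordinate basis. *)
Definition is_G2_structure (phi : cotensor_field 3) : Prop :=
  is_form phi /\
  forall a x, cimg (mchart a) x ->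
    exists2 u : 'M[R]_7, u \in unitmx & phi a x = pullback u (@phi0 R).

Definition is_closed (k : nat) (w : cotensor_field k) : Prop :=
  forall a x, cimg (mchart a) x -> forall I, ext_d (w a) x I = 0.

Definition is_laplacian_soliton (phi : cotensor_field 3) (X : vector_family)
    (lambda : R) : Prop :=
  [/\ is_G2_structure phi, is_closed phi, is_vector_field X
    & forall a x, cimg (mchart a) x -> forall I : 3.-tuple 'I_7,
        laplacian_phi (phi a) x I =
        lambda * phi a x I + lie_derivative (X a) (phi a) x I].

End Fields.

(* Main.v *)
Require Import Defs.
From HB Require Import structures.
From mathcomp Require Import all_boot all_order all_algebra fingroup perm.
From mathcomp Require Import all_classical all_reals all_analysis.
From mathcomp Require Import ring lra zify.
Import Defs.
Set Implicit Arguments.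
Unset Strict Implicit.
Unset Printing Implicit Defensive.
Import Order.TTheory GRing.Theory Num.Theory.
Import numFieldNormedType.Exports.
Local Open Scope ring_scope.

(** The claim is local, so it is proved in one chart.  The smooth functions on the
chart domain U form a commutative ring A with commuting derivations d_p, and
Christoffel symbols, covariant derivatives and curvature are 7 x 7 matrices over
A; their identities (Bianchi, Ricci commutation, d(det g)) are ring identities.
Pointwise, phi_x is the pull-back of phi0 by some u, which gives g = u u^T and
vol = det u.  Writing (C_j)_kl = phi_jkl, the derivative of tr (C_j C_k) = -6 g_jk
shows that nabla phi has no Lambda^3_1 and Lambda^3_27 parts, hence nabla phi =
T.psi; d phi = 0 puts T in Lambda^2_14, and d^* phi = -2 T, so that Delta phi =
d d^* phi = -2 (cyclic sum of nabla T).
Ricci commutation on phi expresses Ric through nabla T, and then contracting the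
soliton equation with phi in two indices gives the metric equation (symmetric
part) and the vanishing of d^*(X _| phi) (contraction of the skew part). *)

(** The adapted maps [u] are chosen point by point and need not vary continuously, and the metric
    comes from a choice operator. Hence no frame is ever differentiated: derivatives are taken in
    coordinates, in the ring of smooth functions, and frames only prove algebraic identities after
    evaluation at a point. An identity valid at every point of U is an equality in the ring and may
    then be differentiated; this is how nabla phi = T.psi, a pointwise result, enters the Ricci
    identity. Smoothness of the metric is recovered separately, from a ninth root of a polynomial in
    phi. Applied to phi, the curvature 2-form shows only its Lambda^2_7 part, since Lambda^2_14 is
    the Lie algebra of the stabiliser of phi. This part suffices for Ric: contracted with phi once
    more it gives Ric plus a psi-term, which the first Bianchi identity kills. The contracted
    soliton equation still contains div X. Its trace, with scal = - |T|^2, eliminates div X and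
    produces both coefficients 1/3. *)

(** * The structure constants of phi0 *)

(* Aliases of the integer operations: the tables below are checked by evaluation
   and these are then made opaque, so that no tactic unfolds a table. *)
Definition addi (a b : int) : int := intZmod.addz a b.
Definition oppi (a : int) : int := intZmod.oppz a.
Definition muli (a b : int) : int := intRing.mulz a b.

Definition sumi7 (f : nat -> int) : int :=
  foldr (fun i s => addi (f i) s) 0 (iota 0 7).
Definition all7 (P : nat -> bool) : bool := all P (iota 0 7).

Definition deltai (i j : nat) : int := if i == j then 1 else 0.

Definition e3i (a b c i j k : nat) : int :=
  let d x y := deltai x.+1 y in
  addi (addi (muli (d i a) (addi (muli (d j b) (d k c)) (oppi (muli (d j c) (d k b)))))
       (oppi (muli (d i b) (addi (muli (d j a) (d k c)) (oppi (muli (d j c) (d k a)))))))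
       (muli (d i c) (addi (muli (d j a) (d k b)) (oppi (muli (d j b) (d k a))))).

Definition phi_entry (i j k : nat) : int :=
  addi (addi (addi (addi (addi (addi (e3i 1 2 3 i j k) (e3i 1 4 5 i j k))
   (e3i 1 6 7 i j k)) (e3i 2 4 6 i j k)) (oppi (e3i 2 5 7 i j k)))
   (oppi (e3i 3 4 7 i j k))) (oppi (e3i 3 5 6 i j k)).

(** Evaluated once and for all: the checks below run over up to 7^6 index tuples and only look
    entries up. *)
Definition phi_table : seq (seq (seq int)) :=
  Eval vm_compute in
  [seq [seq [seq phi_entry i j k | k <- iota 0 7] | j <- iota 0 7] | i <- iota 0 7].

Definition phii (i j k : nat) : int := nth 0 (nth [::] (nth [::] phi_table i) j) k.

(* phi_ijm phi_klm = d_ik d_jl - d_il d_jk + psi_ijkl, read as a definition of psi;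
   it is * phi0 by [star_phi0]. *)
Definition psi_entry (i j k l : nat) : int :=
  addi (sumi7 (fun m => muli (phii i j m) (phii k l m)))
   (addi (oppi (muli (deltai i k) (deltai j l))) (muli (deltai i l) (deltai j k))).

Definition psi_table : seq (seq (seq (seq int))) :=
  Eval vm_compute in
  [seq [seq [seq [seq psi_entry i j k l | l <- iota 0 7] | k <- iota 0 7]
     | j <- iota 0 7] | i <- iota 0 7].

Definition psii (i j k l : nat) : int :=
  nth 0 (nth [::] (nth [::] (nth [::] psi_table i) j) k) l.

Definition all7_2 P := all7 (fun i => all7 (P i)).
Definition all7_3 P := all7 (fun i => all7_2 (P i)).
Definition all7_4 P := all7 (fun i => all7_3 (P i)).

Lemma all7P (P : nat -> bool) : all7 P -> forall i : 'I_7, P i.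
Proof. by move=> /allP h i; apply: h; rewrite mem_iota ltn_ord. Qed.
Lemma all7_2P P : all7_2 P -> forall i j : 'I_7, P i j.
Proof. by move=> /all7P h i; apply: all7P. Qed.
Lemma all7_3P P : all7_3 P -> forall i j k : 'I_7, P i j k.
Proof. by move=> /all7P h i; apply: all7_2P. Qed.
Lemma all7_4P P : all7_4 P -> forall i j k l : 'I_7, P i j k l.
Proof. by move=> /all7P h i; apply: all7_3P. Qed.

Lemma phiiC : all7_3 (fun i j k => (phii j i k == oppi (phii i j k)) && (phii j k i == phii i j k)).
Proof. by vm_compute. Qed.
Lemma psiiC : all7_4 (fun i j k l => [&& psii j i k l == oppi (psii i j k l),
  psii i k j l == oppi (psii i j k l) & psii i j l k == oppi (psii i j k l)]).
Proof. by vm_compute. Qed.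
Lemma phii_phii : all7_2 (fun i l => sumi7 (fun j => sumi7 (fun k => muli (phii i j k) (phii l j k)))
   == muli 6 (deltai i l)).
Proof. by vm_compute. Qed.
Lemma psii_def : all7_4 (fun i j k l => addi (sumi7 (fun m => muli (phii i j m) (phii k l m)))
   (addi (oppi (muli (deltai i k) (deltai j l))) (muli (deltai i l) (deltai j k))) == psii i j k l).
Proof. by vm_compute. Qed.
Lemma phii_psii : all7_3 (fun q m j => sumi7 (fun k => sumi7 (fun l => muli (phii q k l) (psii m j k l)))
   == muli 4 (phii q m j)).
Proof. by vm_compute. Qed.
Lemma psii_psii : all7_2 (fun m n => sumi7 (fun j => sumi7 (fun k => sumi7 (fun l => muli (psii m j k l) (psii n j k l))))
   == muli 24 (deltai m n)).
Proof. by vm_compute. Qed.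
(** The inner sum over [q] is the variation of psi when phi varies by the contraction of psi with
    e_m; it is the derivative of psi along a torsion component, paired here with psi. *)
Lemma dpsii_psii : all7_3 (fun m n p => sumi7 (fun j => sumi7 (fun k => sumi7 (fun l =>
     muli (sumi7 (fun q => addi (muli (psii m n j q) (phii q k l)) (muli (phii n j q) (psii m q k l))))
   (psii p j k l))))
   == muli 12 (phii n p m)).
Proof. by vm_compute. Qed.

Lemma psii_psii2 : all7_4 (fun m i n j => sumi7 (fun k => sumi7 (fun l => muli (psii m i k l) (psii n j k l)))
   == addi (muli 4 (addi (muli (deltai m n) (deltai i j)) (oppi (muli (deltai m j) (deltai i n)))))
    (muli 2 (psii m i n j))).
Proof. by vm_compute. Qed.

(** The generalised Kronecker delta, that is 6 times the projector onto alternating 3-tensors. *)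
Definition alti (a b c j k l : nat) : int :=
  addi (addi (muli (deltai a j) (addi (muli (deltai b k) (deltai c l)) (oppi (muli (deltai b l) (deltai c k)))))
       (muli (deltai a k) (addi (muli (deltai b l) (deltai c j)) (oppi (muli (deltai b j) (deltai c l))))))
       (muli (deltai a l) (addi (muli (deltai b j) (deltai c k)) (oppi (muli (deltai b k) (deltai c j))))).

Definition cyc_sum (f : nat -> nat -> nat -> int) (a b c : nat) : int :=
  addi (f a b c) (addi (f b c a) (f c a b)).

(* Resolution of the identity of Lambda^3: the first term spans Lambda^3_7, the
   other two Lambda^3_1 + Lambda^3_27. *)
Lemma three_form_decomposition : all7_3 (fun a b c => all7_3 (fun j k l =>
   addi (sumi7 (fun m => muli (psii m a b c) (psii m j k l)))
    (addi (cyc_sum (fun a b c => cyc_sum (fun j k l =>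
      addi (muli (deltai j a) (addi (psii b c k l) (addi (muli (deltai b k) (deltai c l)) (oppi (muli (deltai b l) (deltai c k))))))
       (muli (phii j b c) (phii a k l))) j k l) a b c)
    (muli (-2) (muli (phii a b c) (phii j k l))))
  == muli 4 (alti a b c j k l))).
Proof. by vm_compute. Qed.

Section StructureConstants.
Variable R : comPzRingType.
Definition ir (z : int) : R := z%:~R.
Lemma irD a b : ir (addi a b) = ir a + ir b. Proof. exact: rmorphD. Qed.
Lemma irM a b : ir (muli a b) = ir a * ir b. Proof. exact: rmorphM. Qed.
Lemma irN a : ir (oppi a) = - ir a. Proof. exact: rmorphN. Qed.
Lemma ir_sum f : ir (sumi7 f) = \sum_(i < 7) ir (f i).
Proof.
rewrite -(big_mkord xpredT (fun i => ir (f i))) /index_iota subn0 unlock /sumi7.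
by elim: (iota 0 7) => //= a s ih; rewrite irD ih.
Qed.

Definition dl (i j : 'I_7) : R := (i == j)%:R.
Definition ph (i j k : 'I_7) : R := ir (phii i j k).
Definition ps (i j k l : 'I_7) : R := ir (psii i j k l).
Lemma irdl (i j : 'I_7) : ir (deltai i j) = dl i j.
Proof. by rewrite /ir /dl -val_eqE; rewrite /deltai; case: eqP. Qed.

Ltac chk := rewrite /ph /ps -?irdl -?irM -?irN -?irD; congr ir.
Opaque addi oppi muli sumi7 phii psii deltai.
Lemma phC (i j k : 'I_7) : ph j i k = - ph i j k.
Proof. by chk; have /andP[/eqP] := all7_3P phiiC i j k. Qed.
Lemma phCyc (i j k : 'I_7) : ph j k i = ph i j k.
Proof. by chk; have /andP[_ /eqP] := all7_3P phiiC i j k. Qed.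
Lemma phC' (i j k : 'I_7) : ph i k j = - ph i j k.
Proof. by rewrite -phCyc phC phCyc. Qed.
Lemma psC (i j k l : 'I_7) : ps j i k l = - ps i j k l.
Proof. by chk; have /and3P[/eqP] := all7_4P psiiC i j k l. Qed.
Lemma psC' (i j k l : 'I_7) : ps i k j l = - ps i j k l.
Proof. by chk; have /and3P[_ /eqP] := all7_4P psiiC i j k l. Qed.
Lemma psC'' (i j k l : 'I_7) : ps i j l k = - ps i j k l.
Proof. by chk; have /and3P[_ _ /eqP] := all7_4P psiiC i j k l. Qed.
Lemma dlC i j : dl i j = dl j i. Proof. by rewrite /dl eq_sym. Qed.

Lemma sum_dl (F : 'I_7 -> R) k : \sum_i F i * dl i k = F k.
Proof.
rewrite (bigD1 k) //= /dl eqxx mulr1 big1 ?addr0 // => i /negbTE ->.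
by rewrite mulr0.
Qed.
Lemma sum_dl' (F : 'I_7 -> R) k : \sum_i F i * dl k i = F k.
Proof. by under eq_bigr do rewrite dlC; exact: sum_dl. Qed.

Lemma ph_ph i j k l : \sum_m ph i j m * ph k l m = dl i k * dl j l - dl i l * dl j k + ps i j k l.
Proof.
rewrite /ps -(eqP (all7_4P psii_def i j k l)) irD ir_sum irD irN !irM !irdl.
under eq_bigr do rewrite -irM.
by ring.
Qed.

Lemma ir_sum2 (f : nat -> nat -> int) :
  \sum_(i < 7) \sum_(j < 7) ir (f i j) = ir (sumi7 (fun i => sumi7 (f i))).
Proof. by rewrite ir_sum; apply: eq_bigr => i _; rewrite ir_sum. Qed.
Lemma ir_sum3 (f : nat -> nat -> nat -> int) :
  \sum_(i < 7) \sum_(j < 7) \sum_(k < 7) ir (f i j k) =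
  ir (sumi7 (fun i => sumi7 (fun j => sumi7 (f i j)))).
Proof. by rewrite ir_sum; apply: eq_bigr => i _; rewrite ir_sum2. Qed.

Lemma ph_ph2 i l : \sum_j \sum_k ph i j k * ph l j k = 6%:R * dl i l.
Proof.
under eq_bigr do under eq_bigr do rewrite -irM.
rewrite (ir_sum2 (fun j k => muli (phii i j k) (phii l j k))).
by rewrite (eqP (all7_2P phii_phii i l)) irM irdl.
Qed.
Lemma ph_ps q m j : \sum_k \sum_l ph q k l * ps m j k l = 4%:R * ph q m j.
Proof.
under eq_bigr do under eq_bigr do rewrite -irM.
rewrite (ir_sum2 (fun k l => muli (phii q k l) (psii m j k l))).
by rewrite (eqP (all7_3P phii_psii q m j)) irM.
Qed.
Lemma ps_ps m n : \sum_j \sum_k \sum_l ps m j k l * ps n j k l = 24%:R * dl m n.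
Proof.
under eq_bigr do under eq_bigr do under eq_bigr do rewrite -irM.
rewrite (ir_sum3 (fun j k l => muli (psii m j k l) (psii n j k l))).
by rewrite (eqP (all7_2P psii_psii m n)) irM irdl.
Qed.
Lemma ps_ps2 m i n j : \sum_k \sum_l ps m i k l * ps n j k l =
  4%:R * (dl m n * dl i j - dl m j * dl i n) + 2%:R * ps m i n j.
Proof.
under eq_bigr do under eq_bigr do rewrite -irM.
rewrite (ir_sum2 (fun k l => muli (psii m i k l) (psii n j k l))).
by rewrite (eqP (all7_4P psii_psii2 m i n j)) irD !irM irD irN !irM !irdl.
Qed.
Lemma dps_ps m n p : \sum_j \sum_k \sum_l
   (\sum_q (ps m n j q * ph q k l + ph n j q * ps m q k l)) * ps p j k l = 12%:R * ph n p m.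
Proof.
transitivity (ir (muli 12 (phii n p m))); last exact: irM.
rewrite -(eqP (all7_3P dpsii_psii m n p)) ir_sum.
apply: eq_bigr => j _; rewrite ir_sum; apply: eq_bigr => k _.
rewrite ir_sum; apply: eq_bigr => l _; rewrite irM ir_sum; congr (_ * _).
by apply: eq_bigr => q _; rewrite irD !irM.
Qed.
End StructureConstants.

(** * Torsion of a closed G2 structure: Lambda^2_14 *)

Section ClosedTorsion.
Variable R : realFieldType.
Local Notation ph := (@ph R).
Local Notation ps := (@ps R).
Local Notation dl := (@dl R).

Lemma sum_rot (F : 'I_7 -> 'I_7 -> 'I_7 -> R) :
  \sum_j \sum_k \sum_l F j k l = \sum_l \sum_j \sum_k F j k l.
Proof.
transitivity (\sum_j \sum_l \sum_k F j k l).
  by apply: eq_bigr => j _; rewrite exchange_big.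
by rewrite exchange_big.
Qed.

Lemma trace_dl (t : 'I_7 -> 'I_7 -> R) : \sum_i \sum_j t i j * dl i j = \sum_i t i i.
Proof. by apply: eq_bigr => i _; rewrite sum_dl'. Qed.

(** The hypothesis is d phi = 0 written with nabla phi = t.psi. Contracted with psi_njkl, its first
    term gives 24 t and the other three give the same expression [hB], so that 24 t - 3 hB = 0; the
    conclusion is one sixth of this. *)
Lemma closed_contraction (t : 'I_7 -> 'I_7 -> R) :
  (forall i j k l, \sum_m t i m * ps m j k l - \sum_m t j m * ps m i k l
     + \sum_m t k m * ps m i j l - \sum_m t l m * ps m i j k = 0) ->
  forall i n, 2%:R * t i n + 2%:R * (\sum_j t j j) * dl i n
    + \sum_j \sum_m t j m * ps j m i n = 0.
Proof.
move=> hc i n.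
have hB : \sum_j \sum_k \sum_l (\sum_m t j m * ps m i k l) * ps n j k l =
   4%:R * t i n - 4%:R * (\sum_j t j j) * dl i n - 2%:R * \sum_j \sum_m t j m * ps j m i n.
  transitivity (\sum_j \sum_m (t j m * (4%:R * (dl m n * dl i j - dl m j * dl i n)
     + 2%:R * ps m i n j))).
    apply: eq_bigr => j _; under [RHS]eq_bigr do rewrite -ps_ps2 mulr_sumr.
    rewrite [RHS]exchange_big /=; apply: eq_bigr => k _.
    under [RHS]eq_bigr do rewrite mulr_sumr.
    rewrite [RHS]exchange_big /=; apply: eq_bigr => l _; rewrite mulr_suml.
    by apply: eq_bigr => m _; rewrite mulrA.
  have E j m : t j m * (4%:R * (dl m n * dl i j - dl m j * dl i n) + 2%:R * ps m i n j) =
    4%:R * (t j m * dl m n * dl i j) - 4%:R * dl i n * (t j m * dl j m) - 2%:R * (t j m * ps j m i n).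
    rewrite (dlC _ m j).
    have -> : ps m i n j = - ps j m i n.
      by rewrite psC'' psC' psC opprK.
    ring.
  under eq_bigr do (under eq_bigr do rewrite E; rewrite !sumrB -!mulr_sumr).
  rewrite !sumrB -!mulr_sumr trace_dl; congr (_ - _ - _); last by ring.
    congr (_ * _); under eq_bigr do rewrite -mulr_suml sum_dl.
    by rewrite sum_dl'.
have h0 : \sum_j \sum_k \sum_l (\sum_m t i m * ps m j k l - \sum_m t j m * ps m i k l
     + \sum_m t k m * ps m i j l - \sum_m t l m * ps m i j k) * ps n j k l = 0.
  by do 3! (rewrite big1 // => ? _); rewrite hc mul0r.
(* The factors [ps n k j l] and [ps n l j k] turn the last two terms into the second one with its
   summation indices renamed, so [hB] applies to all three. *)
have E j k l : (\sum_m t i m * ps m j k l - \sum_m t j m * ps m i k l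
     + \sum_m t k m * ps m i j l - \sum_m t l m * ps m i j k) * ps n j k l =
   (\sum_m t i m * ps m j k l) * ps n j k l - (\sum_m t j m * ps m i k l) * ps n j k l
   - (\sum_m t k m * ps m i j l) * ps n k j l - (\sum_m t l m * ps m i j k) * ps n l j k.
  rewrite (psC' _ n j k l).
  have -> : ps n l j k = ps n j k l by rewrite psC' psC'' opprK.
  ring.
move: h0.
under eq_bigr do (under eq_bigr do (under eq_bigr do rewrite E; rewrite !sumrB); rewrite !sumrB).
rewrite !sumrB hB.
have -> : \sum_j \sum_k \sum_l (\sum_m t k m * ps m i j l) * ps n k j l =
   4%:R * t i n - 4%:R * (\sum_j t j j) * dl i n - 2%:R * \sum_j \sum_m t j m * ps j m i n.
  by rewrite exchange_big /= -hB.
have -> : \sum_j \sum_k \sum_l (\sum_m t l m * ps m i j k) * ps n l j k =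
   4%:R * t i n - 4%:R * (\sum_j t j j) * dl i n - 2%:R * \sum_j \sum_m t j m * ps j m i n.
  by rewrite sum_rot -hB.
have -> : \sum_j \sum_k \sum_l (\sum_m t i m * ps m j k l) * ps n j k l = 24%:R * t i n.
  transitivity (\sum_m (t i m * (24%:R * dl m n))).
    under [RHS]eq_bigr do rewrite -ps_ps mulr_sumr.
    rewrite [RHS]exchange_big /=; apply: eq_bigr => j _.
    under [RHS]eq_bigr do rewrite mulr_sumr.
    rewrite [RHS]exchange_big /=; apply: eq_bigr => k _.
    under [RHS]eq_bigr do rewrite mulr_sumr.
    rewrite [RHS]exchange_big /=; apply: eq_bigr => l _; rewrite mulr_suml.
    by apply: eq_bigr => m _; rewrite mulrA.
  by under eq_bigr do rewrite mulrA; rewrite sum_dl mulrC.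
lra.
Qed.

(** Setting i = n and summing gives 16 tr t = 0. Then 2 t is minus the contraction of t with psi,
    hence skew. Contracting once more with phi, on which psi acts as 4, the vector v = t.phi
    satisfies 2 v = - 4 v. *)
Lemma closed_torsion (t : 'I_7 -> 'I_7 -> R) :
  (forall i j k l, \sum_m t i m * ps m j k l - \sum_m t j m * ps m i k l
     + \sum_m t k m * ps m i j l - \sum_m t l m * ps m i j k = 0) ->
  (forall i j, t j i = - t i j) /\ (forall k, \sum_i \sum_j t i j * ph i j k = 0).
Proof.
move=> /closed_contraction hK.
have tr0 : \sum_j t j j = 0.
  have : \sum_i (2%:R * t i i + 2%:R * (\sum_j t j j) * dl i i
    + \sum_j \sum_m t j m * ps j m i i) = 0 by rewrite big1.
  rewrite !big_split /= -!mulr_sumr.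
  have -> : \sum_i dl i i = 7%:R.
    by under eq_bigr do rewrite /dl eqxx; rewrite sumr_const card_ord.
  rewrite [X in _ + X]big1 => [|i _]; first by lra.
  rewrite big1 // => a _; rewrite big1 // => b _.
  suff -> : ps a b i i = 0 by rewrite mulr0.
  by have := psC'' R a b i i; lra.
have hK' i n : 2%:R * t i n = - \sum_j \sum_m t j m * ps j m i n.
  by have := hK i n; rewrite tr0; lra.
have sk i j : t j i = - t i j.
  have : 2%:R * t j i = - (2%:R * t i j); last by lra.
  rewrite !hK' -!sumrN; apply: eq_bigr => a _; rewrite -!sumrN.
  by apply: eq_bigr => b _; rewrite psC''; ring.
split=> // k.
have : 2%:R * (\sum_i \sum_j t i j * ph i j k) = - 4%:R * (\sum_i \sum_j t i j * ph i j k); last by lra.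
rewrite mulr_sumr; under eq_bigr do rewrite mulr_sumr.
under eq_bigr do under eq_bigr do rewrite mulrA hK' mulNr mulr_suml.
under eq_bigr do rewrite sumrN exchange_big /=.
rewrite sumrN exchange_big /= mulNr; congr (- _); rewrite mulr_sumr; apply: eq_bigr => a _.
under eq_bigr do (under eq_bigr do rewrite mulr_suml; rewrite exchange_big /=).
rewrite exchange_big mulr_sumr /=; apply: eq_bigr => b _.
transitivity (t a b * (4%:R * ph k a b)); last by rewrite -phCyc; ring.
rewrite -ph_ps mulr_sumr; apply: eq_bigr => i _; rewrite mulr_sumr.
by apply: eq_bigr => j _; rewrite -(phCyc _ k); ring.
Qed.

(** Lambda^2_14 is an eigenspace of contraction with psi: multiply the vanishing contraction t.phi
    by phi and expand the product with [ph_ph]. *)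
Lemma torsion14_ps (t : 'I_7 -> 'I_7 -> R) :
  (forall i j, t j i = - t i j) -> (forall k, \sum_i \sum_j t i j * ph i j k = 0) ->
  forall k l, \sum_i \sum_j t i j * ps i j k l = - 2%:R * t k l.
Proof.
move=> sk t0 k l.
have : \sum_m (\sum_i \sum_j t i j * ph i j m) * ph k l m = 0.
  by rewrite big1 // => m _; rewrite t0 mul0r.
under eq_bigr do rewrite mulr_suml.
rewrite exchange_big /=.
have E i j : \sum_m t i j * ph i j m * ph k l m =
   t i j * dl i k * dl j l - t i j * dl j k * dl i l + t i j * ps i j k l.
  by under eq_bigr do rewrite -mulrA; rewrite -mulr_sumr ph_ph; ring.
under eq_bigr do (under eq_bigr do rewrite mulr_suml; rewrite exchange_big /=;
   under eq_bigr do rewrite E; rewrite !big_split /= sumrN sum_dl -mulr_suml sum_dl).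
rewrite !big_split /= sumrN !sum_dl.
rewrite (sk k l); lra.
Qed.

End ClosedTorsion.

(** * Three-forms with only a Lambda^3_7 component *)

Section Decomposition.
Variable R : realFieldType.
Local Notation ph := (@ph R).
Local Notation ps := (@ps R).
Local Notation dl := (@dl R).
Variable e : 'I_7 -> 'I_7 -> 'I_7 -> R.
Hypothesis eC : forall i j k, e j i k = - e i j k.
Hypothesis eCyc : forall i j k, e j k i = e i j k.

Definition pair (f : 'I_7 -> 'I_7 -> 'I_7 -> R) := \sum_a \sum_b \sum_c e a b c * f a b c.

Let pair_ext f f' : (forall a b c, f a b c = f' a b c) -> pair f = pair f'.
Proof. by move=> h; do 3! apply: eq_bigr => ? _; rewrite h. Qed.
Let pairD f f' : pair (fun a b c => f a b c + f' a b c) = pair f + pair f'.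
Proof.
rewrite /pair -big_split; apply: eq_bigr => a _; rewrite -big_split.
by apply: eq_bigr => b _; rewrite -big_split; apply: eq_bigr => c _; rewrite /= mulrDr.
Qed.
Let pairZ f k : pair (fun a b c => k * f a b c) = k * pair f.
Proof.
rewrite /pair mulr_sumr; apply: eq_bigr => a _; rewrite mulr_sumr.
by apply: eq_bigr => b _; rewrite mulr_sumr; apply: eq_bigr => c _; rewrite mulrCA.
Qed.
Let pair_cyc f : pair (fun a b c => f b c a) = pair f.
Proof. by rewrite /pair [RHS]sum_rot; do 3! apply: eq_bigr => ? _; rewrite -eCyc. Qed.
Let pair_cyc3 f : pair (fun a b c => f a b c + (f b c a + f c a b)) = 3%:R * pair f.
Proof.
rewrite !pairD (pair_cyc (fun a b c => f b c a)) !(pair_cyc f).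
have sum3 (z : R) : z + (z + z) = 3%:R * z by ring.
exact: sum3.
Qed.
Let pair_dl j k l : pair (fun a b c => dl a j * (dl b k * dl c l)) = e j k l.
Proof.
rewrite /pair (bigD1 j) //= [X in _ + X]big1 ?addr0; last first.
  by move=> i /negbTE h; rewrite big1 // => b _; rewrite big1 // => c _; rewrite /dl h !(mulr0n, mul0r, mulr0).
rewrite (bigD1 k) //= [X in _ + X]big1 ?addr0; last first.
  by move=> i /negbTE h; rewrite big1 // => c _; rewrite /dl h !(mulr0n, mul0r, mulr0).
rewrite (bigD1 l) //= [X in _ + X]big1 ?addr0; last first.
  by move=> i /negbTE h; rewrite /dl h !(mulr0n, mul0r, mulr0).
by rewrite /dl !eqxx !mulr1n !mul1r mulr1.
Qed.
Let pair_alt (j k l : 'I_7) : pair (fun a b c => @ir R (alti a b c j k l)) = 6%:R * e j k l.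
Proof.
transitivity (pair (fun a b c => dl a j * (dl b k * dl c l) + - 1 * (dl a j * (dl b l * dl c k))
   + dl a k * (dl b l * dl c j) + - 1 * (dl a k * (dl b j * dl c l))
   + dl a l * (dl b j * dl c k) + - 1 * (dl a l * (dl b k * dl c j)))).
  by apply: pair_ext => a b c; rewrite /alti !(irD, irM, irN, irdl); ring.
rewrite !pairD !pairZ !pair_dl.
have e1 : e k l j = e j k l by rewrite eCyc.
have e2 : e l j k = e j k l by rewrite -eCyc.
have e3 : e j l k = - e j k l by rewrite -eCyc eC eCyc.
rewrite e1 e2 (eC j k l) (eC k l j) e1 e3; ring.
Qed.

(** The symmetric part of this 2-tensor determines the Lambda^3_1 + Lambda^3_27 component of [e],
    and its trace the Lambda^3_1 component. *)
Definition trace2 (i j : 'I_7) := \sum_a \sum_b e i a b * ph j a b.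

Let pair_dlph (j k l : 'I_7) :
  pair (fun a b c => dl j a * (ps b c k l + (dl b k * dl c l - dl b l * dl c k)))
  = \sum_m trace2 j m * ph m k l.
Proof.
rewrite /pair (bigD1 j) //= [X in _ + X]big1 ?addr0; last first.
  move=> i /negbTE h; rewrite big1 // => b _; rewrite big1 // => c _.
  by rewrite /dl eq_sym h !(mulr0n, mul0r, mulr0).
under [RHS]eq_bigr do rewrite /trace2 mulr_suml.
rewrite [RHS]exchange_big; apply: eq_bigr => b _.
under [RHS]eq_bigr do rewrite mulr_suml.
rewrite [RHS]exchange_big; apply: eq_bigr => c _ /=.
rewrite /dl eqxx mul1r.
under [RHS]eq_bigr do rewrite -mulrA -phCyc -(phCyc _ _ k l).
by rewrite -mulr_sumr ph_ph addrC.
Qed.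

Let pair_phph (j k l : 'I_7) :
  pair (fun a b c => ph j b c * ph a k l) = \sum_m trace2 m j * ph m k l.
Proof.
apply: eq_bigr => a _; rewrite /trace2 mulr_suml; apply: eq_bigr => b _.
by rewrite mulr_suml; apply: eq_bigr => c _; rewrite mulrA.
Qed.

(** Pair [e] with both sides of [three_form_decomposition]. The terms spanning Lambda^3_1 +
    Lambda^3_27 only involve the symmetric part of [trace2] and vanish. The constant is 24 = 4 * 6:
    the 4 of that identity, and the 6 from pairing [alti] with an alternating tensor. *)
Lemma three_form_eq_pi7 : (forall i j, trace2 i j + trace2 j i = 0) ->
  forall j k l, e j k l =
    \sum_m (24%:R^-1 * \sum_a \sum_b \sum_c e a b c * ps m a b c) * ps m j k l.
Proof.
move=> s0 j k l.
have tr0 : pair ph = 0.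
  have : pair ph + pair ph = 0; last by lra.
  by rewrite -big_split big1 // => i _; exact: s0.
(* One summand of the double cyclic sum in [three_form_decomposition]: its two terms pair with [e]
   to [trace2 j m] and [trace2 m j], each contracted with phi_mkl. *)
pose f (j k l a b c : 'I_7) := dl j a * (ps b c k l + (dl b k * dl c l - dl b l * dl c k))
      + ph j b c * ph a k l.
have two (j' k' l' : 'I_7) : pair (fun a b c => f j' k' l' a b c) = 0.
  rewrite /f pairD pair_dlph pair_phph -big_split big1 // => m _ /=.
  by rewrite -mulrDl s0 mul0r.
have id : pair (fun a b c => 1 * (\sum_m ps m a b c * ps m j k l)
   + ((f j k l a b c + (f k l j a b c + f l j k a b c))
   + ((f j k l b c a + (f k l j b c a + f l j k b c a))
   + (f j k l c a b + (f k l j c a b + f l j k c a b)))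
   + (- 2%:R * ph j k l) * ph a b c)) = 4%:R * (6%:R * e j k l).
  rewrite -pair_alt -pairZ; apply: pair_ext => a b c.
  transitivity (@ir R (muli 4 (alti a b c j k l))); last by exact: irM.
  rewrite -(eqP (all7_3P (all7_3P three_form_decomposition a b c) j k l)) irD ir_sum mul1r.
  congr (_ + _); first by apply: eq_bigr => m _; rewrite irM.
  by rewrite /cyc_sum /f /ps /ph !(irD, irM, irN, irdl) /ir; ring.
have cyc0 : pair (fun a b c => f j k l a b c + (f k l j a b c + f l j k a b c)
   + ((f j k l b c a + (f k l j b c a + f l j k b c a))
   + (f j k l c a b + (f k l j c a b + f l j k c a b)))) = 0.
  rewrite (pair_cyc3 (fun a b c => f j k l a b c + (f k l j a b c + f l j k a b c))).
  transitivity (3%:R * (pair (f j k l) + (pair (f k l j) + pair (f l j k)))).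
    by rewrite -!pairD.
  by rewrite !(two : forall j k l, pair (f j k l) = 0) !addr0 mulr0.
have {}id : 1 * pair (fun a b c => \sum_m ps m a b c * ps m j k l)
   + (pair (fun a b c => f j k l a b c + (f k l j a b c + f l j k a b c)
   + ((f j k l b c a + (f k l j b c a + f l j k b c a))
   + (f j k l c a b + (f k l j c a b + f l j k c a b))))
   + (- 2%:R * ph j k l) * pair ph) = 4%:R * (6%:R * e j k l).
  rewrite -id [RHS]pairD; congr (_ + _); first by rewrite pairZ.
  by rewrite [RHS]pairD; congr (_ + _); rewrite pairZ.
rewrite cyc0 tr0 in id.
have -> : e j k l = 24%:R^-1 * pair (fun a b c => \sum_m ps m a b c * ps m j k l).
  by move: id; lra.
under [RHS]eq_bigr do rewrite -mulrA; rewrite -mulr_sumr; congr (_ * _).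
under [RHS]eq_bigr do rewrite mulr_suml; rewrite [RHS]exchange_big; apply: eq_bigr => a _ /=.
under [RHS]eq_bigr do rewrite mulr_suml; rewrite [RHS]exchange_big; apply: eq_bigr => b _ /=.
under [RHS]eq_bigr do rewrite mulr_suml; rewrite [RHS]exchange_big; apply: eq_bigr => c _ /=.
by rewrite mulr_sumr; apply: eq_bigr => m _; rewrite mulrA.
Qed.
End Decomposition.

(** * The soliton equation in an orthonormal frame *)

(* Components at one point: t = T, D = nabla T, Z a b = R(e_a, e_b), Y = nabla X;
   [dphi] and [dpsi] are then nabla phi and nabla psi, and [Z_phi] is the Ricci
   identity for phi. *)
Section SolitonAlgebra.
Variable R : realFieldType.
Local Notation ph := (@ph R).
Local Notation ps := (@ps R).
Local Notation dl := (@dl R).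
Variables (t Y : 'I_7 -> 'I_7 -> R) (D : 'I_7 -> 'I_7 -> 'I_7 -> R).
Variables (Z : 'I_7 -> 'I_7 -> 'I_7 -> 'I_7 -> R) (X : 'I_7 -> R) (lam : R).

Definition dphi a j k l := \sum_m t a m * ps m j k l.
Definition dpsi a n j k l := \sum_q (dphi a n j q * ph q k l + ph n j q * dphi a q k l).

Hypothesis t_skew : forall i j, t j i = - t i j.
Hypothesis t_ph : forall k, \sum_i \sum_j t i j * ph i j k = 0.
Hypothesis D_skew : forall a i j, D a j i = - D a i j.
Hypothesis D_ph : forall a k,
  \sum_i \sum_j (D a i j * ph i j k + t i j * dphi a i j k) = 0.
Hypothesis Z_skew1 : forall a b i j, Z b a i j = - Z a b i j.
Hypothesis Z_skew2 : forall a b i j, Z a b j i = - Z a b i j.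
Hypothesis Z_bianchi : forall a b i j, Z a b i j + Z b i a j + Z i a b j = 0.
Hypothesis Z_phi : forall a b j k l,
  - (\sum_m Z a b j m * ph m k l + \sum_m Z a b k m * ph j m l
     + \sum_m Z a b l m * ph j k m)
  = \sum_n (D a b n - D b a n) * ps n j k l
    + \sum_n (t b n * dpsi a n j k l - t a n * dpsi b n j k l).
Hypothesis soliton : forall i j k,
  - 2%:R * (D i j k + D j k i + D k i j) = lam * ph i j k
  + \sum_p X p * dphi p i j k + (\sum_m Y i m * ph m j k
  + \sum_m Y j m * ph i m k + \sum_m Y k m * ph i j m).

Definition cps m (F : 'I_7 -> 'I_7 -> 'I_7 -> R) :=
  \sum_j \sum_k \sum_l F j k l * ps m j k l.

Lemma cps_ext m F G : (forall j k l, F j k l = G j k l) -> cps m F = cps m G.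
Proof. by move=> h; do 3! apply: eq_bigr => ? _; rewrite h. Qed.

Lemma cps_add m F G : cps m (fun j k l => F j k l + G j k l) = cps m F + cps m G.
Proof.
rewrite /cps -big_split; apply: eq_bigr => j _; rewrite -big_split.
by apply: eq_bigr => k _; rewrite -big_split; apply: eq_bigr => l _; rewrite /= mulrDl.
Qed.

Lemma cps_opp m F : cps m (fun j k l => - F j k l) = - cps m F.
Proof.
rewrite /cps -sumrN; apply: eq_bigr => j _; rewrite -sumrN.
by apply: eq_bigr => k _; rewrite -sumrN; apply: eq_bigr => l _; rewrite mulNr.
Qed.

Lemma cps_sum m c (F : 'I_7 -> 'I_7 -> 'I_7 -> 'I_7 -> R) :
  cps m (fun j k l => \sum_n c n * F n j k l) = \sum_n c n * cps m (F n).
Proof.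
under [RHS]eq_bigr do rewrite mulr_sumr; rewrite [RHS]exchange_big /=.
apply: eq_bigr => j _; under [RHS]eq_bigr do rewrite mulr_sumr.
rewrite [RHS]exchange_big /=; apply: eq_bigr => k _.
under [RHS]eq_bigr do rewrite mulr_sumr; rewrite [RHS]exchange_big /=.
by apply: eq_bigr => l _; rewrite mulr_suml; apply: eq_bigr => n _; rewrite mulrA.
Qed.

Let Ric i j := \sum_k Z k j i k.
Let t2 i j := \sum_k t i k * t k j.
Let t_ps := torsion14_ps t_skew t_ph.

Lemma t2_sym i j : \sum_k t j k * t k i = \sum_k t i k * t k j.
Proof. by apply: eq_bigr => k _; rewrite (t_skew k j) (t_skew i k); ring. Qed.

(** [D_ph] is the derivative of T.phi = 0; it trades nabla T for T.T.psi, and psi acts on T as -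
    2. *)
Lemma D_ph_t2 a k : \sum_i \sum_j D a i j * ph i j k = 2%:R * \sum_m t a m * t m k.
Proof.
have /eqP := D_ph a k.
under eq_bigr do rewrite big_split /=.
rewrite big_split /= addr_eq0 => /eqP ->.
transitivity (- \sum_m t a m * (- 2%:R * t m k)); last first.
  by rewrite -sumrN mulr_sumr; apply: eq_bigr => m _; ring.
congr (- _); under [RHS]eq_bigr do rewrite -t_ps mulr_sumr.
rewrite [RHS]exchange_big; apply: eq_bigr => i _ /=.
under [RHS]eq_bigr do rewrite mulr_sumr.
rewrite [RHS]exchange_big; apply: eq_bigr => j _ /=.
rewrite mulr_sumr; apply: eq_bigr => m _.
have -> : ps m i j k = ps i j m k by rewrite psC psC' opprK.
ring.
Qed.

(** The classical argument: in a combination of the four Bianchi identities on a, b, i, j all other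
    components cancel by skew-symmetry. *)
Lemma Z_pair a b i j : Z a b i j = Z i j a b.
Proof.
have := Z_bianchi a b i j; have := Z_bianchi b i j a.
have := Z_bianchi i j a b; have := Z_bianchi j a b i.
rewrite (Z_skew1 a i b j) (Z_skew2 b i a j) (Z_skew2 i j a b) (Z_skew1 b j i a) (Z_skew2 b j a i).
rewrite (Z_skew1 a j i b) (Z_skew2 a j b i) (Z_skew2 a i b j) (Z_skew1 a j b i) (Z_skew2 a b i j).
by lra.
Qed.

Lemma Ric_sym i j : \sum_k Z k i j k = \sum_k Z k j i k.
Proof.
by apply: eq_bigr => k _; rewrite [LHS]Z_pair (Z_skew1 k j) (Z_skew2 k j k i).
Qed.

Lemma cps_dpsi c n m : cps m (dpsi c n) = 12%:R * \sum_p t c p * ph n m p.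
Proof.
transitivity (cps m (fun j k l => \sum_p t c p *
    \sum_q (ps p n j q * ph q k l + ph n j q * ps p q k l))).
  apply: cps_ext => j k l; rewrite /dpsi /dphi.
  under [RHS]eq_bigr do rewrite mulr_sumr.
  rewrite [RHS]exchange_big; apply: eq_bigr => q _ /=.
  rewrite mulr_suml mulr_sumr -big_split; apply: eq_bigr => p _ /=.
  ring.
rewrite cps_sum mulr_sumr; apply: eq_bigr => p _; rewrite /cps dps_ps; ring.
Qed.

(** Contract the Ricci identity [Z_phi] with psi_mjkl, which isolates the Lambda^2_7 part of R(e_a,
    e_b). The three curvature terms contribute equally, 4 times the left side each; nabla T
    contributes with the factor 24, and the two quadratic terms with 12 each since they are opposite
    ([hQ']). *)
Lemma Z_ph a b m : \sum_j \sum_q Z a b j q * ph j q m =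
  - 2%:R * (D a b m - D b a m) - 2%:R * \sum_n t b n * \sum_p t a p * ph n m p.
Proof.
have hZ : cps m (fun j k l => \sum_q Z a b j q * ph q k l) =
    4%:R * \sum_j \sum_q Z a b j q * ph j q m.
  rewrite mulr_sumr; apply: eq_bigr => j _; rewrite mulr_sumr.
  transitivity (\sum_q Z a b j q * (4%:R * ph q m j)); last first.
    by apply: eq_bigr => q _; rewrite -(phCyc _ j q m); ring.
  under [RHS]eq_bigr do rewrite -ph_ps mulr_sumr.
  rewrite [RHS]exchange_big; apply: eq_bigr => k _ /=.
  under [RHS]eq_bigr do rewrite mulr_sumr.
  rewrite [RHS]exchange_big; apply: eq_bigr => l _ /=.
  by rewrite mulr_suml; apply: eq_bigr => q _; rewrite mulrA.
have hZ2 : cps m (fun j k l => \sum_q Z a b k q * ph j q l) =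
    4%:R * \sum_j \sum_q Z a b j q * ph j q m.
  rewrite -hZ /cps exchange_big; apply: eq_bigr => j _; apply: eq_bigr => k _.
  apply: eq_bigr => l _; rewrite psC' !mulr_suml; apply: eq_bigr => q _.
  by rewrite (phC _ q k); ring.
have hZ3 : cps m (fun j k l => \sum_q Z a b l q * ph j k q) =
    4%:R * \sum_j \sum_q Z a b j q * ph j q m.
  rewrite -hZ /cps sum_rot; apply: eq_bigr => j _; apply: eq_bigr => k _.
  apply: eq_bigr => l _; rewrite !mulr_suml; apply: eq_bigr => q _.
  have -> : ps m k l j = ps m j k l by rewrite psC'' psC' opprK.
  by rewrite -(phCyc _ q k l); ring.
have hQ c d : cps m (fun j k l => \sum_n t d n * dpsi c n j k l) =
    12%:R * \sum_n t d n * \sum_p t c p * ph n m p.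
  by rewrite cps_sum mulr_sumr; apply: eq_bigr => n _; rewrite cps_dpsi; ring.
have hD : cps m (fun j k l => \sum_n (D a b n - D b a n) * ps n j k l) =
    24%:R * (D a b m - D b a m).
  rewrite cps_sum; under eq_bigr do rewrite /cps ps_ps mulrCA.
  by rewrite -mulr_sumr sum_dl.
have hQ' : \sum_n t a n * \sum_p t b p * ph n m p = - \sum_n t b n * \sum_p t a p * ph n m p.
  under eq_bigr do rewrite mulr_sumr; rewrite exchange_big -sumrN; apply: eq_bigr => n _ /=.
  rewrite -mulrN -sumrN mulr_sumr; apply: eq_bigr => p _.
  have -> : ph p m n = - ph n m p by rewrite phC phCyc.
  ring.
have : cps m (fun j k l => - (\sum_m Z a b j m * ph m k l + \sum_m Z a b k m * ph j m l
     + \sum_m Z a b l m * ph j k m)) = cps m (fun j k l =>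
    \sum_n (D a b n - D b a n) * ps n j k l
    + ((\sum_n t b n * dpsi a n j k l) + - (\sum_n t a n * dpsi b n j k l))).
  by apply: cps_ext => j k l; rewrite Z_phi sumrB.
rewrite cps_opp !cps_add cps_opp hZ hZ2 hZ3 hD !hQ hQ'.
by lra.
Qed.

(** As psi is invariant under cyclic permutations of j, q, b, the sum is one third of its cyclic
    symmetrisation, which is zero by the first Bianchi identity. *)
Lemma Z_ps a c : \sum_b \sum_j \sum_q Z a b j q * ps j q b c = 0.
Proof.
set S := LHS.
have S1 : \sum_b \sum_j \sum_q Z a j q b * ps j q b c = S.
  rewrite -sum_rot; apply: eq_bigr => b _; apply: eq_bigr => j _; apply: eq_bigr => q _.
  by congr (_ * _); rewrite psC psC' opprK.
have S2 : \sum_b \sum_j \sum_q Z a q b j * ps j q b c = S.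
  rewrite sum_rot; apply: eq_bigr => b _; apply: eq_bigr => j _; apply: eq_bigr => q _.
  by congr (_ * _); rewrite psC' psC opprK.
have : S + \sum_b \sum_j \sum_q Z a j q b * ps j q b c
   + \sum_b \sum_j \sum_q Z a q b j * ps j q b c = 0; last by rewrite S1 S2; lra.
rewrite /S -!big_split big1 // => b _; rewrite -!big_split big1 // => j _.
rewrite -!big_split big1 // => q _ /=; rewrite -!mulrDl.
rewrite (Z_pair a b) (Z_pair a j) (Z_pair a q).
rewrite (Z_skew2 j q b a) (Z_skew2 q b j a) (Z_skew2 b j q a) -!opprD Z_bianchi.
by rewrite oppr0 mul0r.
Qed.

(** Contract [Z_ph] with phi_mbc. By [ph_ph] and [Z_ps] the curvature side becomes 2 Ric; on the
    other side the term in [D a b m] is known from [D_ph_t2] and the quadratic one is 3 T^2, so the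
    term in [D b a m] is determined. *)
Lemma D_ph_Ric a c : \sum_b \sum_m D b a m * ph m b c = Ric a c + t2 a c.
Proof.
have hL : \sum_b \sum_m (\sum_j \sum_q Z a b j q * ph j q m) * ph m b c = 2%:R * Ric a c.
  transitivity (\sum_b \sum_j \sum_q (Z a b j q * dl j b * dl q c
     - Z a b j q * dl j c * dl q b + Z a b j q * ps j q b c)).
    apply: eq_bigr => b _; under eq_bigr do rewrite mulr_suml.
    rewrite exchange_big; apply: eq_bigr => j _ /=; under eq_bigr do rewrite mulr_suml.
    rewrite exchange_big; apply: eq_bigr => q _ /=.
    under eq_bigr do rewrite -mulrA -(phCyc _ _ b c).
    by rewrite -mulr_sumr ph_ph; ring.
  under eq_bigr do (under eq_bigr do rewrite big_split sumrB; rewrite big_split sumrB).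
  rewrite big_split sumrB Z_ps /= addr0.
  rewrite [X in X - _](_ : _ = Ric a c); last first.
    apply: eq_bigr => b _; under eq_bigr do rewrite sum_dl.
    by rewrite sum_dl -Z_pair.
  rewrite [X in _ - X](_ : _ = - Ric a c); first by ring.
  rewrite -sumrN; apply: eq_bigr => b _.
  under eq_bigr do rewrite sum_dl; rewrite sum_dl.
  by rewrite Z_skew2 -Z_pair.
have hQ : \sum_b \sum_m (\sum_n t b n * \sum_p t a p * ph n m p) * ph m b c = 3%:R * t2 a c.
  transitivity (\sum_b \sum_n \sum_p t b n * t a p * (dl p b * dl n c - dl p c * dl n b + ps p n b c)).
    apply: eq_bigr => b _; under eq_bigr do rewrite mulr_suml.
    rewrite exchange_big; apply: eq_bigr => n _ /=.
    under eq_bigr do rewrite mulr_sumr mulr_suml.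
    rewrite exchange_big; apply: eq_bigr => p _ /=.
    rewrite -ph_ph mulr_sumr; apply: eq_bigr => m _.
    by rewrite -(phCyc _ m b c) -(phCyc _ p n m); ring.
  have E b n p : t b n * t a p * (dl p b * dl n c - dl p c * dl n b + ps p n b c) =
    t b n * t a p * dl p b * dl n c - t b n * t a p * dl p c * dl n b
    - t a p * (t b n * ps b n p c).
    have -> : ps p n b c = - ps b n p c by rewrite psC psC' psC !opprK.
    ring.
  under eq_bigr do (under eq_bigr do (under eq_bigr do rewrite E; rewrite !sumrB);
     rewrite !sumrB).
  rewrite !sumrB.
  rewrite [X in X - _ - _](_ : _ = t2 a c); last first.
    apply: eq_bigr => b _; under eq_bigr do rewrite -mulr_suml sum_dl.
    by rewrite sum_dl mulrC.
  rewrite [X in _ - X - _](_ : _ = 0); last first.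
    rewrite big1 // => b _; under eq_bigr do rewrite -mulr_suml sum_dl.
    have t0 : t b b = 0 by have := t_skew b b; lra.
    by rewrite sum_dl t0 mul0r.
  rewrite [X in _ - X](_ : _ = - 2%:R * t2 a c); first by ring.
  under eq_bigr do rewrite exchange_big; rewrite exchange_big mulr_sumr /=.
  apply: eq_bigr => p _.
  under eq_bigr do rewrite -mulr_sumr; rewrite -mulr_sumr t_ps; ring.
have hD : \sum_b \sum_m D a b m * ph m b c = - 2%:R * t2 a c.
  rewrite mulNr -D_ph_t2 -sumrN; apply: eq_bigr => b _; rewrite -sumrN.
  by apply: eq_bigr => m _; rewrite phC mulrN.
have : \sum_b \sum_m (\sum_j \sum_q Z a b j q * ph j q m) * ph m b c =
  - 2%:R * \sum_b \sum_m D a b m * ph m b c + 2%:R * \sum_b \sum_m D b a m * ph m b c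
  - 2%:R * \sum_b \sum_m (\sum_n t b n * \sum_p t a p * ph n m p) * ph m b c.
  rewrite !mulr_sumr -big_split -sumrB; apply: eq_bigr => b _.
  rewrite !mulr_sumr -big_split -sumrB; apply: eq_bigr => m _.
  by rewrite Z_ph /=; ring.
rewrite hL hD hQ; lra.
Qed.

(** This is scal = - |T|^2, T being skew: the trace of [D_ph_Ric] contains the same contraction of
    nabla T as the trace of [D_ph_t2]. *)
Lemma trace_Ric : \sum_a Ric a a = \sum_a t2 a a.
Proof.
have : \sum_a (Ric a a + t2 a a) = 2%:R * \sum_a t2 a a.
  under eq_bigr do rewrite -D_ph_Ric; rewrite exchange_big mulr_sumr.
  apply: eq_bigr => b _; rewrite -D_ph_t2; apply: eq_bigr => a _ /=.
  by apply: eq_bigr => m _; rewrite phCyc.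
by rewrite big_split /=; lra.
Qed.

Let trY := \sum_j Y j j.

(** The soliton equation contracted with phi_ljk over j and k. The left side, which is the
    contraction of the Laplacian of phi, is symmetric in i and l, and so is the part of the right
    side that yields the metric equation; the skew part of the right side must vanish by itself. *)
Lemma soliton_contraction i l :
  - 4%:R * Ric i l - 8%:R * t2 i l = 6%:R * lam * dl i l
    + 4%:R * \sum_p X p * \sum_m t p m * ph l m i
    + 4%:R * Y i l + 2%:R * trY * dl i l + 2%:R * \sum_j \sum_m Y j m * ps i m l j.
Proof.
pose c3 (F : 'I_7 -> 'I_7 -> R) := \sum_j \sum_k F j k * ph l j k.
have c3D F G : c3 (fun j k => F j k + G j k) = c3 F + c3 G.
  rewrite /c3 -big_split; apply: eq_bigr => j _; rewrite -big_split.
  by apply: eq_bigr => k _; rewrite /= mulrDl.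
have c3Z (F : 'I_7 -> 'I_7 -> R) z : c3 (fun j k => z * F j k) = z * c3 F.
  rewrite /c3 mulr_sumr; apply: eq_bigr => j _; rewrite mulr_sumr.
  by apply: eq_bigr => k _; rewrite mulrA.
have c3S (c : 'I_7 -> R) F : c3 (fun j k => \sum_n c n * F n j k) = \sum_n c n * c3 (F n).
  under [RHS]eq_bigr do rewrite mulr_sumr; rewrite [RHS]exchange_big /=.
  apply: eq_bigr => j _; under [RHS]eq_bigr do rewrite mulr_sumr.
  rewrite [RHS]exchange_big /=; apply: eq_bigr => k _; rewrite mulr_suml.
  by apply: eq_bigr => n _; rewrite mulrA.
have : c3 (fun j k => - 2%:R * (D i j k + D j k i + D k i j)) =
  c3 (fun j k => lam * ph i j k
  + \sum_p X p * dphi p i j k + (\sum_m Y i m * ph m j k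
  + \sum_m Y j m * ph i m k + \sum_m Y k m * ph i j m)).
  by apply: eq_bigr => j _; apply: eq_bigr => k _; rewrite soliton.
rewrite c3Z !c3D c3Z !c3S.
have -> : c3 (fun j k => D i j k) = 2%:R * t2 i l.
  by rewrite -D_ph_t2; apply: eq_bigr => j _; apply: eq_bigr => k _; rewrite (phCyc _ l j k).
have h2 : c3 (fun j k => D j k i) = Ric i l + t2 i l.
  rewrite -D_ph_Ric; apply: eq_bigr => j _; apply: eq_bigr => k _.
  have -> : ph l j k = - ph k j l by rewrite -phCyc phC.
  by rewrite D_skew; ring.
have -> : c3 (fun j k => D k i j) = c3 (fun j k => D j k i).
  rewrite /c3 exchange_big; apply: eq_bigr => j _; apply: eq_bigr => k _.
  by rewrite (D_skew j i k) phC'; ring.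
rewrite h2.
have -> : c3 (ph i) = 6%:R * dl i l by rewrite -ph_ph2.
have -> : \sum_p X p * c3 (dphi p i) = 4%:R * \sum_p X p * \sum_m t p m * ph l m i.
  rewrite mulr_sumr; apply: eq_bigr => p _.
  rewrite c3S -mulrCA; congr (_ * _); rewrite mulr_sumr; apply: eq_bigr => m _.
  rewrite mulrCA -ph_ps; congr (_ * _); apply: eq_bigr => j _; apply: eq_bigr => k _.
  exact: mulrC.
have -> : \sum_m Y i m * c3 (ph m) = 6%:R * Y i l.
  under eq_bigr do rewrite /c3 ph_ph2 mulrCA.
  by rewrite -mulr_sumr sum_dl.
have h5 : c3 (fun j k => \sum_m Y j m * ph i m k) =
   trY * dl i l - Y i l + \sum_j \sum_m Y j m * ps i m l j.
  transitivity (\sum_j \sum_m (dl i l * (Y j m * dl j m)  - Y j m * dl m l * dl i j + Y j m * ps i m l j)).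
    apply: eq_bigr => j _; under eq_bigr do rewrite mulr_suml.
    rewrite exchange_big; apply: eq_bigr => m _ /=.
    under eq_bigr do rewrite -mulrA; rewrite -mulr_sumr ph_ph (dlC _ m j); ring.
  under eq_bigr do rewrite big_split sumrB -mulr_sumr sum_dl' -mulr_suml sum_dl /=.
  by rewrite big_split sumrB -mulr_sumr sum_dl' /= mulrC.
have -> : c3 (fun j k => \sum_m Y k m * ph i j m) = c3 (fun j k => \sum_m Y j m * ph i m k).
  rewrite /c3 exchange_big; apply: eq_bigr => j _; apply: eq_bigr => k _.
  rewrite !mulr_suml; apply: eq_bigr => m _.
  by rewrite phC' (phC' _ l j k); ring.
rewrite h5; lra.
Qed.

Theorem frame_metric_equation i j :
  - Ric i j - 3%:R^-1 * (\sum_k \sum_l t k l * t k l) * dl i j - 2%:R * t2 i j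
  = 3%:R^-1 * lam * dl i j + 2%:R^-1 * (Y i j + Y j i).
Proof.
have e1 (a b : 'I_7) : - 4%:R * Ric a b - 8%:R * t2 a b = 6%:R * lam * dl a b
   + 2%:R * (Y a b + Y b a) + 2%:R * trY * dl a b.
  have := soliton_contraction a b; have := soliton_contraction b a.
  rewrite {1}/Ric Ric_sym {1}/t2 t2_sym (dlC _ b a).
  have -> : \sum_p X p * \sum_m t p m * ph a m b = - \sum_p X p * \sum_m t p m * ph b m a.
    rewrite -sumrN; apply: eq_bigr => p _; rewrite -mulrN -sumrN; congr (_ * _).
    by apply: eq_bigr => m _; rewrite -phCyc phC phC' -phCyc; ring.
  have -> : \sum_j \sum_m Y j m * ps b m a j = - \sum_j \sum_m Y j m * ps a m b j.
    rewrite -sumrN; apply: eq_bigr => p _; rewrite -sumrN.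
    apply: eq_bigr => m _; have -> : ps b m a p = - ps a m b p; last by ring.
    by rewrite psC psC' psC !opprK.
  rewrite -/(Ric a b) -/(t2 a b); lra.
have tr1 : \sum_i dl i i = 7%:R.
  by under eq_bigr do rewrite /dl eqxx; rewrite sumr_const card_ord.
have : \sum_a (- 4%:R * Ric a a - 8%:R * t2 a a) = \sum_a (6%:R * lam * dl a a
   + 2%:R * (Y a a + Y a a) + 2%:R * trY * dl a a) by apply: eq_bigr => a _; rewrite e1.
rewrite sumrB !big_split /= -!mulr_sumr tr1 trace_Ric big_split /= -/trY.
have -> : \sum_k \sum_l t k l * t k l = - \sum_a t2 a a.
  rewrite -sumrN; apply: eq_bigr => k _; rewrite -sumrN; apply: eq_bigr => l _.
  by rewrite (t_skew k l); ring.
have := e1 i j; move: (\sum_a t2 a a) trY => q y e2 e3.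
(* The trace of [e1]: - 12 tr T^2 = 42 lam + 18 div X, with 42 = 6 * 7 and 18 = 4 + 2 * 7. *)
have ey : y = (- 12%:R * q - 42%:R * lam) / 18%:R by lra.
rewrite {}ey in e2; lra.
Qed.

(** The left side is nabla_p (X^m phi_mpk). Contracting [soliton_contraction] with phi_ilk removes
    all symmetric terms and leaves 24 x + 12 y = 0, where x = X.T and y is the contraction of nabla
    X with phi; the left side is - y - 2 x. *)
Theorem frame_divergence k :
  \sum_p \sum_m Y p m * ph m p k + \sum_m X m * \sum_p dphi p m p k = 0.
Proof.
pose c2 (F : 'I_7 -> 'I_7 -> R) := \sum_i \sum_l F i l * ph i l k.
have c2D F G : c2 (fun j k => F j k + G j k) = c2 F + c2 G.
  rewrite /c2 -big_split; apply: eq_bigr => j _; rewrite -big_split.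
  by apply: eq_bigr => l _; rewrite /= mulrDl.
have c2Z (F : 'I_7 -> 'I_7 -> R) z : c2 (fun j k => z * F j k) = z * c2 F.
  rewrite /c2 mulr_sumr; apply: eq_bigr => j _; rewrite mulr_sumr.
  by apply: eq_bigr => l _; rewrite mulrA.
have c2S (c : 'I_7 -> R) F : c2 (fun j k => \sum_n c n * F n j k) = \sum_n c n * c2 (F n).
  under [RHS]eq_bigr do rewrite mulr_sumr; rewrite [RHS]exchange_big /=.
  apply: eq_bigr => j _; under [RHS]eq_bigr do rewrite mulr_sumr.
  rewrite [RHS]exchange_big /=; apply: eq_bigr => l _; rewrite mulr_suml.
  by apply: eq_bigr => n _; rewrite mulrA.
have c2sym (F : 'I_7 -> 'I_7 -> R) : (forall i l, F i l = F l i) -> c2 F = 0.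
  move=> hF; have : c2 F = - c2 F; last by lra.
  rewrite {1}/c2 exchange_big -sumrN; apply: eq_bigr => i _; rewrite -sumrN.
  by apply: eq_bigr => l _; rewrite hF phC; ring.
have : c2 (fun i l => - 4%:R * Ric i l + - 8%:R * t2 i l) = c2 (fun i l => 6%:R * lam * dl i l
    + 4%:R * (\sum_p X p * \sum_m t p m * ph l m i)
    + 4%:R * Y i l + 2%:R * trY * dl i l + 2%:R * \sum_j 1 * \sum_m Y j m * ps i m l j).
  apply: eq_bigr => i _; apply: eq_bigr => l _; rewrite mulNr mulNr -[- (8%:R * _)]mulNr.
  have -> : \sum_j 1 * \sum_m Y j m * ps i m l j = \sum_j \sum_m Y j m * ps i m l j.
    by apply: eq_bigr => ? _; rewrite mul1r.
  by rewrite -soliton_contraction !mulNr.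
rewrite c2sym; last by move=> i l; rewrite {1}/Ric Ric_sym {1}/t2 t2_sym.
rewrite !c2D !c2Z !c2S (c2sym dl (@dlC R)).
have -> : \sum_n X n * c2 (fun j k0 => \sum_m t n m * ph k0 m j) = 6%:R * \sum_p X p * t p k.
  rewrite mulr_sumr; apply: eq_bigr => p _; rewrite c2S.
  rewrite mulrCA; congr (_ * _).
  transitivity (\sum_m t p m * (6%:R * dl m k)); last first.
    by under eq_bigr do rewrite mulrCA; rewrite -mulr_sumr sum_dl.
  apply: eq_bigr => m _; congr (_ * _); rewrite -ph_ph2.
  apply: eq_bigr => i _; apply: eq_bigr => l _.
  by rewrite (phCyc _ k i l) (phCyc _ l m i).
have -> : \sum_n 1 * c2 (fun j k0 => \sum_m Y n m * ps j m k0 n) = 4%:R * c2 Y.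
  under eq_bigr do rewrite mul1r c2S.
  rewrite /c2 mulr_sumr; apply: eq_bigr => j _; rewrite mulr_sumr; apply: eq_bigr => m _.
  rewrite mulrCA; congr (_ * _).
  rewrite (_ : ph j m k = - ph k m j); last by rewrite phC (phCyc _ k m j).
  rewrite mulrN -ph_ps -sumrN /=; apply: eq_bigr => i _; rewrite -sumrN; apply: eq_bigr => l _.
  have -> : ps i m l j = - ps m j i l by rewrite psC psC'' psC' !opprK.
  by rewrite -(phCyc _ k i l); ring.
have -> : \sum_p \sum_m Y p m * ph m p k = - c2 Y.
  rewrite -sumrN; apply: eq_bigr => i _; rewrite -sumrN; apply: eq_bigr => l _.
  by rewrite phC; ring.
have -> : \sum_m X m * \sum_p dphi p m p k = - 2%:R * \sum_p X p * t p k.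
  rewrite mulr_sumr; apply: eq_bigr => m _; rewrite mulrCA; congr (_ * _).
  rewrite -t_ps; apply: eq_bigr => p _; apply: eq_bigr => q _; congr (_ * _).
  by rewrite psC' psC !opprK.
move: (c2 Y) (\sum_p X p * t p k) => y x; lra.
Qed.

End SolitonAlgebra.

(** * Levi-Civita calculus over a ring with commuting derivations *)

Ltac mx_expand :=
  rewrite ?(mulmxDl, mulmxDr, mulmxN, mulNmx) ?mulmxA.
(* (gam p)_jk = Gamma_pj^k.  A 3-form f is encoded by the matrices C_i with
   (C_i g)_jk = f_ijk; then [nab C p i] encodes nabla_p f_i, and [psim C n j] is
   psi_nj if f is a G2 structure. *)
Section Calculus.
Variables (A : comPzRingType) (d : 'I_7 -> A -> A) (half : A).
Hypothesis dD : forall p x y, d p (x + y) = d p x + d p y.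
Hypothesis dM : forall p x y, d p (x * y) = d p x * y + x * d p y.
Hypothesis dC : forall p q x, d p (d q x) = d q (d p x).
Hypothesis halfP : half + half = 1.
Local Notation M7 := 'M[A]_7.

Lemma mxaE (B B' : M7) i j : (B + B') i j = B i j + B' i j. Proof. by rewrite mxE. Qed.
Lemma mxnE (B : M7) i j : (- B) i j = - B i j. Proof. by rewrite mxE. Qed.
Lemma mxzE c (B : M7) i j : (c *: B) i j = c * B i j. Proof. by rewrite mxE. Qed.

Lemma trD (B B' : M7) : (B + B')^T = B^T + B'^T. Proof. exact: linearD. Qed.
Lemma trN (B : M7) : (- B)^T = - B^T. Proof. exact: linearN. Qed.

Lemma d0 p : d p 0 = 0.
Proof. by apply: (addrI (d p 0)); rewrite -dD !addr0. Qed.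
Lemma dN p x : d p (- x) = - d p x.
Proof. by apply: (addrI (d p x)); rewrite -dD !subrr d0. Qed.
Lemma d1 p : d p 1 = 0.
Proof. by apply: (addrI (d p 1)); rewrite addr0 -{3}[1]mul1r dM mulr1 mul1r. Qed.
Lemma d_sum p (I : Type) (r : seq I) (P : pred I) (F : I -> A) :
  d p (\sum_(i <- r | P i) F i) = \sum_(i <- r | P i) d p (F i).
Proof. exact: (big_morph _ (dD p) (d0 p)). Qed.

Definition dm p (B : M7) : M7 := map_mx (d p) B.
Lemma dmD p B B' : dm p (B + B') = dm p B + dm p B'.
Proof. by apply/matrixP => i j; rewrite !mxE dD. Qed.
Lemma dmN p B : dm p (- B) = - dm p B.
Proof. by apply/matrixP => i j; rewrite !mxE dN. Qed.
Lemma dmZ p c B : dm p (c *: B) = d p c *: B + c *: dm p B.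
Proof. by apply/matrixP => i j; rewrite !mxE dM. Qed.
Lemma dmM p B B' : dm p (B *m B') = dm p B *m B' + B *m dm p B'.
Proof.
apply/matrixP => i j; rewrite !mxE d_sum -big_split; apply: eq_bigr => k _.
by rewrite dM !mxE.
Qed.
Lemma dm_sum p (F : 'I_7 -> M7) : dm p (\sum_i F i) = \sum_i dm p (F i).
Proof.
apply: (big_morph _ (dmD p)); apply/matrixP => i j; by rewrite !mxE d0.
Qed.
Lemma dmC p q B : dm p (dm q B) = dm q (dm p B).
Proof. by apply/matrixP => i j; rewrite !mxE dC. Qed.
Lemma dm_tr p B : dm p B^T = (dm p B)^T.
Proof. by apply/matrixP => i j; rewrite !mxE. Qed.
Lemma d_trace p B : d p (\tr B) = \tr (dm p B).
Proof. by rewrite /mxtrace d_sum; apply: eq_bigr => i _; rewrite !mxE. Qed.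

Variables (g h : M7).
Hypothesis g_sym : g^T = g.
Hypothesis h_sym : h^T = h.
Hypothesis hg : h *m g = 1%:M.

Definition gam p : M7 := \matrix_(j, k)
  (half * \sum_l h k l * (d p (g j l) + d j (g p l) - d l (g p j))).

Lemma gE i j : g i j = g j i. Proof. by rewrite -{1}g_sym mxE. Qed.
Lemma hE i j : h i j = h j i. Proof. by rewrite -{1}h_sym mxE. Qed.

Lemma gam_sym p j k : gam p j k = gam j p k.
Proof.
rewrite !mxE; congr (_ * _); apply: eq_bigr => l _; rewrite (gE p j); ring.
Qed.

Lemma metric_compat p : dm p g = gam p *m g + g *m (gam p)^T.
Proof.
have E j m : (gam p *m g) j m = half * (d p (g j m) + d j (g p m) - d m (g p j)).
  rewrite mxE; under eq_bigr do rewrite mxE -mulrA mulr_suml.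
  rewrite -mulr_sumr; congr (_ * _); rewrite exchange_big /=.
  transitivity (\sum_l (l == m)%:R * (d p (g j l) + d j (g p l) - d l (g p j))).
    apply: eq_bigr => l _; under eq_bigr do rewrite mulrAC hE.
    rewrite -mulr_suml; congr (_ * _).
    by have := congr1 (fun B : M7 => B l m) hg; rewrite !mxE.
  rewrite (bigD1 m) //= eqxx mul1r big1 ?addr0 // => l /negbTE ->.
  by rewrite mul0r.
apply/matrixP => i j; rewrite mxE [RHS]mxE E.
have -> : (g *m (gam p)^T) i j = (gam p *m g) j i.
  by rewrite -{1}g_sym -trmx_mul mxE.
rewrite E (gE j i) (gE p j) (gE p i).
transitivity ((half + half) * d p (g i j)); first by rewrite halfP mul1r.
ring.
Qed.

Lemma metric_compat_inv p : dm p h = - (gam p)^T *m h - h *m gam p.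
Proof.
have gh : g *m h = 1%:M by apply: mulmx1C.
have : dm p (h *m g) = 0.
  rewrite hg; apply/matrixP => i j; rewrite !mxE.
  by case: (i == j); rewrite ?d1 ?d0.
rewrite dmM metric_compat => e.
have := congr1 (mulmx^~ h) e; rewrite mul0mx mulmxDr !mulmxDl -!mulmxA gh !mulmx1.
rewrite (mulmxA h g) hg mul1mx => {}e.
transitivity (dm p h + (h *m gam p + (gam p)^T *m h) - (gam p)^T *m h - h *m gam p).
  by apply/matrixP => i j; rewrite !(mxaE, mxnE); ring.
by rewrite e sub0r mulNmx.
Qed.

(** Rows are covariant and columns contravariant, so connection matrices compose from the right:
    hence the signs of the two products. The contraction [curv k j i k] over k is then the Ricci
    tensor, positive on spheres. *)
Definition curv a b : M7 :=
  dm a (gam b) - dm b (gam a) - gam a *m gam b + gam b *m gam a.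

Lemma curv_skew1 a b : curv b a = - curv a b.
Proof. by apply/matrixP => i j; rewrite !(mxaE, mxnE); ring. Qed.

(** Expand the vanishing commutator of two derivations on g by applying [metric_compat] twice. *)
Lemma curv_metric a b : curv a b *m g + g *m (curv a b)^T = 0.
Proof.
have : dm a (dm b g) - dm b (dm a g) = 0 by rewrite dmC subrr.
rewrite (metric_compat a) (metric_compat b) !dmD !dmM !dm_tr.
rewrite (metric_compat a) (metric_compat b) => e; rewrite -[RHS]e /curv !(trD, trN, trmx_mul); mx_expand.
by apply/matrixP => i j; rewrite !(mxaE, mxnE); ring.
Qed.

Lemma curv_bianchi a b i k : curv a b i k + curv b i a k + curv i a b k = 0.
Proof.
pose Q a' b' c' := \sum_l gam a' b' l * gam c' l k.
have Qs a' b' c' : Q a' b' c' = Q b' a' c'.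
  by apply: eq_bigr => l _; rewrite gam_sym.
have E a' b' i' : curv a' b' i' k = d a' (gam b' i' k) - d b' (gam a' i' k)
   - Q a' i' b' + Q b' i' a'.
  rewrite !(mxaE, mxnE); congr (_ - _ - _ + _); by rewrite mxE.
rewrite !E (gam_sym i a) (gam_sym b a) (gam_sym i b) (Qs i a) (Qs b a) (Qs i b).
ring.
Qed.

(* Endomorphism-valued fields (first index covariant, second contravariant). *)
Definition del p (B : M7) : M7 := dm p B - gam p *m B + B *m gam p.

Lemma delD p B B' : del p (B + B') = del p B + del p B'.
Proof.
rewrite /del dmD mulmxDl mulmxDr.
by apply/matrixP => i j; rewrite !(mxaE, mxnE); ring.
Qed.
Lemma delN p B : del p (- B) = - del p B.
Proof.
rewrite /del dmN mulmxN mulNmx.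
by apply/matrixP => i j; rewrite !(mxaE, mxnE); ring.
Qed.
Lemma delZ p c B : del p (c *: B) = d p c *: B + c *: del p B.
Proof.
rewrite /del dmZ -!scalemxAr -!scalemxAl.
by apply/matrixP => i j; rewrite !(mxaE, mxnE, mxzE); ring.
Qed.
Lemma delM p B B' : del p (B *m B') = del p B *m B' + B *m del p B'.
Proof.
rewrite /del dmM; mx_expand.
by apply/matrixP => i j; rewrite !(mxaE, mxnE); ring.
Qed.
Lemma del_sum p (F : 'I_7 -> M7) : del p (\sum_i F i) = \sum_i del p (F i).
Proof.
apply: (big_morph _ (delD p)); rewrite /del mulmx0 mul0mx subr0 addr0.
by apply/matrixP => i j; rewrite !mxE d0.
Qed.
Lemma del_comm a b B : del a (del b B) - del b (del a B) =
  - curv a b *m B + B *m curv a b.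
Proof.
rewrite /del !(dmD, dmN, dmM) (dmC a b) /curv; mx_expand.
by apply/matrixP => i j; rewrite !(mxaE, mxnE); ring.
Qed.
Lemma d_trace_mul p B B' : d p (\tr (B *m B')) = \tr (del p B *m B') + \tr (B *m del p B').
Proof.
have E (B0 : M7) : \tr (del p B0) = d p (\tr B0).
  by rewrite /del !linearD linearN /= (mxtrace_mulC B0) subrK d_trace.
by rewrite -mxtraceD -delM E.
Qed.

Definition nab (C : 'I_7 -> M7) p j : M7 := del p (C j) - \sum_m gam p j m *: C m.

(** In [nab (nab C b) a] the index b is not corrected by a Christoffel symbol. The missing term is
    symmetric in a and b because the connection is torsion-free, so the commutator is still the
    Ricci identity. *)
Lemma nab_comm (C : 'I_7 -> M7) a b j :
  nab (nab C b) a j - nab (nab C a) b j =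
  - (\sum_m curv a b j m *: C m) - curv a b *m C j + C j *m curv a b.
Proof.
have E p q : nab (nab C q) p j = del p (del q (C j)) - \sum_m d p (gam q j m) *: C m
   - \sum_m gam q j m *: del p (C m) - \sum_m gam p j m *: del q (C m)
   + \sum_m (gam p *m gam q) j m *: C m.
  rewrite /nab delD delN del_sum.
  under eq_bigr do rewrite delZ; rewrite big_split /=.
  under [X in _ - X]eq_bigr do rewrite scalerBr; rewrite sumrB.
  have -> : \sum_m gam p j m *: (\sum_n gam q m n *: C n) = \sum_m (gam p *m gam q) j m *: C m.
    under eq_bigr do rewrite scaler_sumr; rewrite exchange_big /=.
    apply: eq_bigr => n _; rewrite mxE scaler_suml; apply: eq_bigr => m _.
    by rewrite scalerA.
  by apply/matrixP => i k; rewrite !(mxaE, mxnE); ring.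
rewrite !E.
have -> : \sum_m curv a b j m *: C m = \sum_m d a (gam b j m) *: C m
   - \sum_m d b (gam a j m) *: C m - \sum_m (gam a *m gam b) j m *: C m
   + \sum_m (gam b *m gam a) j m *: C m.
  rewrite -!sumrB -big_split; apply: eq_bigr => m _ /=.
  by rewrite -!scalerBl -scalerDl !(mxaE, mxnE) ![dm _ _ _ _]mxE.
transitivity (del a (del b (C j)) - del b (del a (C j)) - (\sum_m d a (gam b j m) *: C m
   - \sum_m d b (gam a j m) *: C m - \sum_m (gam a *m gam b) j m *: C m
   + \sum_m (gam b *m gam a) j m *: C m)).
  by apply/matrixP => i k; rewrite !(mxaE, mxnE); ring.
rewrite del_comm mulNmx.
by apply/matrixP => i k; rewrite !(mxaE, mxnE); ring.
Qed.

(** The right side of the hypothesis is parallel, so the product rule on the left side leaves only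
    covariant derivatives of C. *)
Lemma nab_trace (C : 'I_7 -> M7) c : (forall j k, \tr (C j *m C k) = c * g j k) ->
  d ^~ c =1 (fun=> 0) ->
  forall p j k, \tr (nab C p j *m C k) + \tr (C j *m nab C p k) = 0.
Proof.
move=> hC dc p j k.
have E j' k' : \tr ((\sum_m gam p j' m *: C m) *m C k') = c * (gam p *m g) j' k'.
  rewrite mulmx_suml raddf_sum mxE mulr_sumr; apply: eq_bigr => m _ /=.
  by rewrite -scalemxAl mxtraceZ hC mulrCA.
rewrite /nab mulmxBl mulmxBr 2!raddfB /= (mxtrace_mulC (C j)).
have -> : \tr (C j *m (\sum_m gam p k m *: C m)) = c * (gam p *m g) k j.
  by rewrite mxtrace_mulC E.
rewrite E (mxtrace_mulC _ (C j)).
have := d_trace_mul p (C j) (C k); rewrite hC dM dc mul0r add0r.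
have := congr1 (fun B : M7 => B j k) (metric_compat p); rewrite [dm _ _ _ _]mxE => ->.
rewrite mxaE.
have -> : (g *m (gam p)^T) j k = (gam p *m g) k j by rewrite -{1}g_sym -trmx_mul mxE.
rewrite mulrDr => e.
transitivity (\tr (del p (C j) *m C k) + \tr (C j *m del p (C k))
   - (c * (gam p *m g) j k + c * (gam p *m g) k j)); first ring.
by rewrite -e subrr.
Qed.

Definition prodm (C : 'I_7 -> M7) n j : M7 := \sum_q C n j q *: C q.
(** The Kronecker terms of [ph_ph] with the last index raised. They are parallel, so the derivative
    of psi is that of the product phi.phi alone, which is [nab_psim]. *)
Definition gdelta n j : M7 := \matrix_(k, l) (g j k * (n == l)%:R - g n k * (j == l)%:R).
Definition psim C n j : M7 := prodm C n j + gdelta n j.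
Definition nab_psim (C : 'I_7 -> M7) a n j : M7 :=
  \sum_q (nab C a n j q *: C q + C n j q *: nab C a q).

(** [del] corrects only the row and column indices; the two trailing sums correct the outer indices
    n and j. The corrections of the contracted index q cancel each other. *)
Lemma del_prodm C a n j : del a (prodm C n j) = nab_psim C a n j
  + \sum_m gam a n m *: prodm C m j + \sum_m gam a j m *: prodm C n m.
Proof.
have swap (F : 'I_7 -> A) (G : 'I_7 -> 'I_7 -> A) :
   \sum_m F m *: \sum_q G m q *: C q = \sum_q (\sum_m F m * G m q) *: C q.
  under eq_bigr do rewrite scaler_sumr; rewrite exchange_big /=.
  by apply: eq_bigr => q _; rewrite scaler_suml; apply: eq_bigr => m _; rewrite scalerA.
rewrite /prodm !swap del_sum /nab_psim [X in _ = X + _ + _]big_split /=.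
rewrite /nab.
transitivity (\sum_q d a (C n j q) *: C q + \sum_q C n j q *: del a (C q)).
  by under eq_bigr do rewrite delZ; rewrite big_split.
have -> : \sum_q C n j q *: (del a (C q) - \sum_m gam a q m *: C m) =
  \sum_q C n j q *: del a (C q) - \sum_q (C n *m gam a) j q *: C q.
  under eq_bigr do rewrite scalerBr; rewrite sumrB swap; congr (_ - _).
  by apply: eq_bigr => q _; rewrite [X in _ = X *: _]mxE.
have -> : \sum_q (del a (C n) - \sum_m gam a n m *: C m) j q *: C q =
  \sum_q d a (C n j q) *: C q - \sum_q (\sum_m gam a j m * C n m q) *: C q
  + \sum_q (C n *m gam a) j q *: C q - \sum_q (\sum_m gam a n m * C m j q) *: C q.
  rewrite -sumrB -big_split -sumrB; apply: eq_bigr => q _ /=.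
  rewrite -scalerBl -scalerDl -scalerBl; congr (_ *: _).
  rewrite !(mxaE, mxnE) summxE; congr (_ - _ + _ - _); rewrite ?mxE //.
  by apply: eq_bigr => m _; rewrite mxE.
by apply/matrixP => i k; rewrite !(mxaE, mxnE); ring.
Qed.

Lemma sum_delta (F : 'I_7 -> A) l : \sum_m F m * (m == l)%:R = F l.
Proof.
rewrite (bigD1 l) //= eqxx mulr1 big1 ?addr0 // => m /negbTE ->.
by rewrite mulr0.
Qed.

Lemma del_gdelta a n j : del a (gdelta n j) =
  \sum_m gam a n m *: gdelta m j + \sum_m gam a j m *: gdelta n m.
Proof.
have dg i k : d a (g i k) = (gam a *m g) i k + (gam a *m g) k i.
  have := congr1 (fun B : M7 => B i k) (metric_compat a); rewrite [dm _ _ _ _]mxE => ->.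
  by rewrite mxaE; congr (_ + _); rewrite -{1}g_sym -trmx_mul mxE.
apply/matrixP => k l; rewrite !(mxaE, mxnE) !summxE [dm _ _ _ _]mxE ![gdelta _ _ _ _]mxE.
have -> : d a (g j k * (n == l)%:R - g n k * (j == l)%:R) =
  d a (g j k) * (n == l)%:R - d a (g n k) * (j == l)%:R.
  by rewrite dD dN !dM; do 2!case: eqP => _; rewrite ?d0 ?d1; ring.
have -> : (gam a *m gdelta n j) k l =
   (gam a *m g) k j * (n == l)%:R - (gam a *m g) k n * (j == l)%:R.
  rewrite [LHS]mxE [(gam a *m g) k j]mxE [(gam a *m g) k n]mxE !mulr_suml -sumrB.
  apply: eq_bigr => m _; rewrite [gdelta _ _ _ _]mxE.
  by rewrite (gE j m) (gE n m); ring.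
have -> : (gdelta n j *m gam a) k l = g j k * gam a n l - g n k * gam a j l.
  rewrite mxE; under eq_bigr do rewrite [gdelta _ _ _ _]mxE mulrBl.
  rewrite sumrB; congr (_ - _).
    under eq_bigr do rewrite -mulrA [_%:R * _]mulrC eq_sym; rewrite -mulr_sumr.
    by rewrite sum_delta.
  under eq_bigr do rewrite -mulrA [_%:R * _]mulrC eq_sym; rewrite -mulr_sumr.
  by rewrite sum_delta.
have -> : \sum_m (gam a n m *: gdelta m j) k l =
   g j k * gam a n l - (gam a *m g) n k * (j == l)%:R.
  rewrite [(gam a *m g) n k]mxE mulr_suml -[gam a n l]sum_delta mulr_sumr -sumrB.
  by apply: eq_bigr => m _; rewrite mxzE [gdelta _ _ _ _]mxE; ring.
have -> : \sum_m (gam a j m *: gdelta n m) k l =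
   (gam a *m g) j k * (n == l)%:R - g n k * gam a j l.
  rewrite [(gam a *m g) j k]mxE mulr_suml -[gam a j l]sum_delta mulr_sumr -sumrB.
  by apply: eq_bigr => m _; rewrite mxzE [gdelta _ _ _ _]mxE; ring.
by rewrite !dg; ring.
Qed.

Lemma del_psim C a n j : del a (psim C n j) = nab_psim C a n j
  + \sum_m gam a n m *: psim C m j + \sum_m gam a j m *: psim C n m.
Proof.
rewrite /psim delD del_prodm del_gdelta.
under [in RHS]eq_bigr do rewrite scalerDr.
under [X in _ = _ + X]eq_bigr do rewrite scalerDr.
rewrite !big_split /=.
by apply/matrixP => i k; rewrite !(mxaE, mxnE); ring.
Qed.

(** The Ricci identity for phi with nabla phi = t.psi substituted in both orders of differentiation.
    The Christoffel term that [del] brings in on the first index of t drops out by [gam_sym]. *)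
Lemma nab_torsion_comm C (t : M7) a b j :
  (forall p j, nab C p j = \sum_n t p n *: psim C n j) ->
  - (\sum_m curv a b j m *: C m) - curv a b *m C j + C j *m curv a b
  = \sum_n (del a t b n - del b t a n) *: psim C n j
  + \sum_n (t b n *: nab_psim C a n j - t a n *: nab_psim C b n j).
Proof.
move=> hC; rewrite -nab_comm.
have E p q : nab (nab C q) p j = \sum_n (del p t q n + (gam p *m t) q n) *: psim C n j
   + \sum_n t q n *: nab_psim C p n j.
  have delE i : del p (t q i *: psim C i j) = d p (t q i) *: psim C i j
     + (t q i *: nab_psim C p i j + t q i *: (\sum_m gam p i m *: psim C m j)
     + t q i *: (\sum_m gam p j m *: psim C i m)).
    by rewrite delZ del_psim [X in _ + X = _]scalerDr [X in _ + (X + _) = _]scalerDr.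
  rewrite {1}/nab hC del_sum; under eq_bigr do rewrite delE.
  rewrite big_split [X in _ + X - _]big_split [X in _ + (X + _) - _]big_split /=.
  have -> : \sum_i t q i *: \sum_m gam p i m *: psim C m j =
     \sum_m (t *m gam p) q m *: psim C m j.
    under eq_bigr do rewrite scaler_sumr; rewrite exchange_big /=.
    apply: eq_bigr => n _; rewrite mxE scaler_suml; apply: eq_bigr => m _.
    by rewrite scalerA.
  have -> : \sum_i t q i *: \sum_m gam p j m *: psim C i m = \sum_m gam p j m *: nab C q m.
    under [RHS]eq_bigr do rewrite hC scaler_sumr; rewrite [RHS]exchange_big /=.
    apply: eq_bigr => n _; rewrite scaler_sumr; apply: eq_bigr => m _.
    by rewrite !scalerA mulrC.
  transitivity (\sum_n (d p (t q n) + (t *m gam p) q n) *: psim C n j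
    + \sum_n t q n *: nab_psim C p n j).
    under [X in _ = X + _]eq_bigr do rewrite scalerDl; rewrite big_split /=.
    by apply/matrixP => i k; rewrite !(mxaE, mxnE); ring.
  congr (_ + _); apply: eq_bigr => n _; congr (_ *: _).
  by rewrite /del !(mxaE, mxnE) [dm _ _ _ _]mxE; ring.
rewrite !E sumrB.
transitivity (\sum_n (del a t b n + (gam a *m t) b n) *: psim C n j
  - \sum_n (del b t a n + (gam b *m t) a n) *: psim C n j
  + (\sum_n t b n *: nab_psim C a n j - \sum_n t a n *: nab_psim C b n j)).
  by apply/matrixP => i k; rewrite !(mxaE, mxnE); ring.
congr (_ + _); rewrite -sumrB; apply: eq_bigr => n _; rewrite -scalerBl; congr (_ *: _).
have -> : (gam a *m t) b n = (gam b *m t) a n.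
  by rewrite !mxE; apply: eq_bigr => m _; rewrite gam_sym.
ring.
Qed.

Lemma mulmxE3 (B B' : M7) i j : (B *m B') i j = \sum_k B i k * B' k j.
Proof. by rewrite mxE. Qed.

Lemma skew_del (t : M7) p : (t *m g)^T = - (t *m g) ->
  (del p t *m g)^T = - (del p t *m g).
Proof.
move=> sk; have := congr1 (dm p) sk.
have E : dm p (t *m g) = del p t *m g + gam p *m (t *m g) + t *m g *m (gam p)^T.
  rewrite dmM metric_compat /del; mx_expand.
  by apply/matrixP => i j; rewrite !(mxaE, mxnE); ring.
rewrite dm_tr dmN E !trD (trmx_mul (gam p)) (trmx_mul (t *m g)) sk trmxK mulmxN mulNmx => e.
transitivity ((del p t *m g)^T - (t *m g *m (gam p)^T) - (gam p *m (t *m g))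
   + (t *m g *m (gam p)^T) + gam p *m (t *m g)).
  by apply/matrixP => i j; rewrite !(mxaE, mxnE); ring.
rewrite e.
by apply/matrixP => i j; rewrite !(mxaE, mxnE); ring.
Qed.

Lemma d_low (t : M7) p j k : d p ((t *m g) j k) = (del p t *m g) j k
  + \sum_m gam p j m * (t *m g) m k + \sum_m gam p k m * (t *m g) j m.
Proof.
have E : dm p (t *m g) = del p t *m g + gam p *m (t *m g) + t *m g *m (gam p)^T.
  rewrite dmM metric_compat /del; mx_expand.
  by apply/matrixP => a b; rewrite !(mxaE, mxnE); ring.
have := congr1 (fun B : M7 => B j k) E; rewrite !mxaE [dm _ _ _ _]mxE => ->.
congr (_ + _ + _); rewrite mulmxE3 //.
by apply: eq_bigr => m _; rewrite [(gam p)^T _ _]mxE mulrC.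
Qed.

(** The exterior derivative of a 2-form through a torsion-free connection: the Christoffel terms
    cancel in pairs. *)
Lemma cyc_d_low (t : M7) i j k : (t *m g)^T = - (t *m g) ->
  d i ((t *m g) j k) + d j ((t *m g) k i) + d k ((t *m g) i j) =
  (del i t *m g) j k + (del j t *m g) k i + (del k t *m g) i j.
Proof.
move=> sk; rewrite !d_low.
have sk' a b : (t *m g) a b = - (t *m g) b a.
  by have := congr1 (fun B : M7 => B b a) sk; rewrite mxE mxnE.
have E a b c : \sum_m gam a b m * (t *m g) c m = - \sum_m gam b a m * (t *m g) m c.
  by rewrite -sumrN; apply: eq_bigr => m _; rewrite sk' gam_sym mulrN.
by rewrite !E; ring.
Qed.

Lemma nab_trace_torsion C (t : M7) k : (forall m, \tr (t *m C m) = 0) ->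
  forall p, \tr (del p t *m C k) + \tr (t *m nab C p k) = 0.
Proof.
move=> h0 p; have := d_trace_mul p t (C k); rewrite h0 d0 => ->.
congr (_ + _); rewrite /nab mulmxBr raddfB /= [X in _ - X](_ : _ = 0) ?subr0 //.
rewrite mulmx_sumr raddf_sum big1 // => m _ /=.
by rewrite -scalemxAr mxtraceZ h0 mulr0.
Qed.

Section ThreeForm.
Variable C : 'I_7 -> M7.
Let f i j k := (C i *m g) j k.
Hypothesis fC : forall i j k, f j i k = - f i j k.
Hypothesis fC' : forall i j k, f i k j = - f i j k.

Lemma d_three_form p i j k : d p (f i j k) = (nab C p i *m g) j k
  + \sum_m gam p i m * f m j k + \sum_m gam p j m * f i m k + \sum_m gam p k m * f i j m.
Proof.
rewrite /f d_low /nab mulmxBl mxaE mxnE mulmx_suml summxE.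
under [X in _ - X]eq_bigr do rewrite -scalemxAl mxzE.
ring.
Qed.

Lemma ext_three_form i j k l :
  d i (f j k l) - d j (f i k l) + d k (f i j l) - d l (f i j k) =
  (nab C i j *m g) k l - (nab C j i *m g) k l + (nab C k i *m g) j l
  - (nab C l i *m g) j k.
Proof.
pose a p i j k := \sum_m gam p i m * f m j k.
have aS p i' j' k' : a i' p j' k' = a p i' j' k'.
  by apply: eq_bigr => m _; rewrite gam_sym.
have E p i' j' k' : d p (f i' j' k') = (nab C p i' *m g) j' k' + a p i' j' k'
    - a p j' i' k' + a p k' i' j'.
  rewrite d_three_form; congr (_ + _ + _ + _); first rewrite -sumrN.
    by apply: eq_bigr => m _; rewrite fC mulrN.
  by apply: eq_bigr => m _; rewrite fC' fC opprK.
rewrite !E (aS j i) (aS k i) (aS l i) (aS k j) (aS l j) (aS l k).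
ring.
Qed.

Variable X : 'I_7 -> A.
Definition nab_vec p m := d p (X m) + \sum_l X l * gam p l m.

(** Partial derivatives may be replaced by covariant ones in a Lie derivative: the corrections of
    the derivative of f along X cancel those of nabla X, by symmetry of the connection. *)
Lemma lie_three_form i j k :
  \sum_p X p * d p (f i j k) + (\sum_m d i (X m) * f m j k
    + \sum_m d j (X m) * f i m k + \sum_m d k (X m) * f i j m) =
  \sum_p X p * (nab C p i *m g) j k + (\sum_m nab_vec i m * f m j k
    + \sum_m nab_vec j m * f i m k + \sum_m nab_vec k m * f i j m).
Proof.
under [in LHS]eq_bigr do rewrite d_three_form !mulrDr.
rewrite !big_split /=.
have E a (F : 'I_7 -> A) : \sum_m nab_vec a m * F m =
   \sum_m d a (X m) * F m + \sum_p X p * \sum_m gam p a m * F m.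
  under eq_bigr do rewrite mulrDl; rewrite big_split /=; congr (_ + _).
  under eq_bigr do rewrite mulr_suml; rewrite exchange_big /=.
  apply: eq_bigr => p _; rewrite mulr_sumr; apply: eq_bigr => m _.
  by rewrite gam_sym mulrA.
by rewrite !E; ring.
Qed.

Lemma lie_metric i j :
  \sum_p X p * d p (g i j) + (\sum_m d i (X m) * g m j + \sum_m d j (X m) * g i m) =
  \sum_m nab_vec i m * g m j + \sum_m nab_vec j m * g i m.
Proof.
have E a (F : 'I_7 -> A) : \sum_m nab_vec a m * F m =
   \sum_m d a (X m) * F m + \sum_p X p * \sum_m gam p a m * F m.
  under eq_bigr do rewrite mulrDl; rewrite big_split /=; congr (_ + _).
  under eq_bigr do rewrite mulr_suml; rewrite exchange_big /=.
  apply: eq_bigr => p _; rewrite mulr_sumr; apply: eq_bigr => m _.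
  by rewrite gam_sym mulrA.
have dg p : d p (g i j) = \sum_m gam p i m * g m j + \sum_m gam p j m * g i m.
  have := congr1 (fun B : M7 => B i j) (metric_compat p); rewrite [dm _ _ _ _]mxE => ->.
  rewrite mxaE !mulmxE3; congr (_ + _).
  by apply: eq_bigr => m _; rewrite [(gam p)^T _ _]mxE mulrC.
under [in LHS]eq_bigr do rewrite dg mulrDr; rewrite !E big_split /=.
ring.
Qed.

Variable nu : A.
Hypothesis d_nu : forall p, d p nu = nu * \tr (gam p).

(** With W = h B skew, one Christoffel term of nabla_p W^pm is the contraction Gamma_pl^p W^lm,
    which the derivative of nu supplies; the other contracts the skew W with the symmetric lower
    indices of Gamma and vanishes. *)
Lemma divergence_two_form : let B := \sum_m X m *: C m in
  (h *m B)^T = - (h *m B) -> forall m,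
  \sum_p d p (nu * (h *m B) p m) =
  nu * \sum_p (h *m \sum_q (nab_vec p q *: C q + X q *: nab C p q)) p m.
Proof.
move=> B skB m; rewrite mulr_sumr.
have dB p : del p B = \sum_q (nab_vec p q *: C q + X q *: nab C p q).
  rewrite /B del_sum; under eq_bigr do rewrite delZ; rewrite !big_split /=.
  under [X in _ = X + _]eq_bigr do rewrite scalerDl; rewrite big_split /=.
  rewrite -addrA; congr (_ + _).
  under [X in _ = _ + X]eq_bigr do rewrite scalerBr.
  rewrite sumrB addrC; set S := \sum_i X i *: del p (C i).
  rewrite [X in S - X + _](_ : _ = \sum_i (\sum_l X l * gam p l i) *: C i) ?subrK //.
  under eq_bigr do rewrite scaler_sumr; rewrite exchange_big /=.
  apply: eq_bigr => q _; rewrite scaler_suml; apply: eq_bigr => l _.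
  by rewrite scalerA.
set W := h *m B.
have dW p : dm p W = h *m del p B - (gam p)^T *m W - W *m gam p.
  rewrite /W dmM metric_compat_inv /del; mx_expand.
  by apply/matrixP => a b; rewrite !(mxaE, mxnE); ring.
have skW a b : W a b = - W b a.
  by have := congr1 (fun D : M7 => D b a) skB; rewrite mxE mxnE.
transitivity (\sum_p nu * (h *m del p B) p m
   + nu * (\sum_p \tr (gam p) * W p m - \sum_p ((gam p)^T *m W) p m)
   - nu * \sum_p (W *m gam p) p m).
  rewrite mulrBr !mulr_sumr addrA -big_split -!sumrB; apply: eq_bigr => p _ /=.
  rewrite dM d_nu; have -> : d p (W p m) = (dm p W) p m by rewrite [RHS]mxE.
  by rewrite dW !(mxaE, mxnE); ring.
have -> : \sum_p ((gam p)^T *m W) p m = \sum_p \tr (gam p) * W p m.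
  under eq_bigr do rewrite mulmxE3; rewrite exchange_big /=; apply: eq_bigr => l _.
  rewrite -mulr_suml; congr (_ * _); apply: eq_bigr => p _.
  by rewrite [(gam p)^T _ _]mxE gam_sym.
rewrite subrr mulr0 addr0.
suff -> : \sum_p (W *m gam p) p m = 0.
  by rewrite mulr0 subr0; apply: eq_bigr => p _; rewrite dB.
(* In a mere ring, x = - x gives x = 0 only by means of [half]. *)
suff e : \sum_p (W *m gam p) p m = - \sum_p (W *m gam p) p m.
  by rewrite -[LHS]mul1r -halfP mulrDl {1}e mulrN addNr.
under eq_bigr do rewrite mulmxE3; rewrite {1}exchange_big -sumrN; apply: eq_bigr => l _ /=.
rewrite ?mulmxE3 -sumrN; apply: eq_bigr => p _.
by rewrite skW (gam_sym p) mulNr.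
Qed.

(** Same cancellation as for 2-forms. Each of the two free indices now brings a term in which a skew
    pair meets the symmetric Christoffel symbols ([cancel]). *)
Lemma divergence_three_form :
  let W p := \sum_q h p q *: (h *m C q) in
  (forall p j k, W j p k = - W p j k) -> (forall p j k, W p k j = - W p j k) ->
  forall j k, \sum_p d p (nu * W p j k) = nu * (\sum_p \sum_q h p q *: (h *m nab C p q)) j k.
Proof.
move=> W WC WC' j k.
have cancel (F : 'I_7 -> 'I_7 -> A) : (forall p l, F l p = - F p l) ->
    forall i, \sum_p \sum_l F p l * gam p l i = 0.
  move=> sk i; set S := LHS; suff e : S = - S.
    by rewrite -[LHS]mul1r -halfP mulrDl {1}e mulrN addNr.
  rewrite {1}/S exchange_big -sumrN; apply: eq_bigr => l _; rewrite -sumrN.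
  by apply: eq_bigr => p _; rewrite sk gam_sym mulNr.
have dh p a b : d p (h a b) = - \sum_m gam p m a * h m b - \sum_m h a m * gam p m b.
  have -> : d p (h a b) = (dm p h) a b by rewrite [RHS]mxE.
  rewrite metric_compat_inv mulNmx !(mxaE, mxnE) !mulmxE3; congr (- _ - _).
  by apply: eq_bigr => m _; rewrite [(gam p)^T _ _]mxE.
have dhC p q : dm p (h *m C q) = h *m nab C p q + \sum_m gam p q m *: (h *m C m)
    - (gam p)^T *m (h *m C q) - (h *m C q) *m gam p.
  have -> : \sum_m gam p q m *: (h *m C m) = h *m (\sum_m gam p q m *: C m).
    by rewrite mulmx_sumr; apply: eq_bigr => m _; rewrite scalemxAr.
  rewrite dmM metric_compat_inv /nab /del; mx_expand.
  by apply/matrixP => a b; rewrite !(mxaE, mxnE); ring.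
have dW p : dm p (W p) = \sum_q h p q *: (h *m nab C p q) - \sum_m gam p m p *: W m
   - \sum_m (\sum_l h p l * gam p l m) *: (h *m C m)
   + \sum_q (h p q *: \sum_m gam p q m *: (h *m C m))
   - (gam p)^T *m W p - W p *m gam p.
  rewrite /W dm_sum mulmx_sumr mulmx_suml.
  have -> : \sum_m gam p m p *: (\sum_q h m q *: (h *m C q)) =
      \sum_q (\sum_m gam p m p * h m q) *: (h *m C q).
    under eq_bigr do rewrite scaler_sumr; rewrite exchange_big /=.
    apply: eq_bigr => q _; rewrite scaler_suml; apply: eq_bigr => m _.
    by rewrite scalerA.
  rewrite -!sumrB -big_split -!sumrB; apply: eq_bigr => q _ /=.
  rewrite dmZ dhC dh -scalemxAr -scalemxAl.
  by apply/matrixP => a b; rewrite !(mxaE, mxnE, mxzE); ring.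
transitivity (nu * (\sum_p \tr (gam p) *: W p + \sum_p dm p (W p)) j k).
  rewrite mxaE !summxE mulrDr !mulr_sumr -big_split; apply: eq_bigr => p _ /=.
  by rewrite dM d_nu mxzE [dm _ _ _ _]mxE; ring.
congr (_ * _); congr (fun_of_matrix _ j k).
under [X in _ + X = _]eq_bigr do rewrite dW.
rewrite !sumrB big_split !sumrB /=.
have -> : \sum_p \sum_m gam p m p *: W m = \sum_m \tr (gam m) *: W m.
  rewrite exchange_big; apply: eq_bigr => m _ /=; rewrite -scaler_suml; congr (_ *: _).
  by apply: eq_bigr => p _; rewrite gam_sym.
have -> : \sum_p \sum_m (\sum_l h p l * gam p l m) *: (h *m C m) =
    \sum_p \sum_q h p q *: \sum_m gam p q m *: (h *m C m).
  apply: eq_bigr => p _; under [RHS]eq_bigr do rewrite scaler_sumr.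
  rewrite [RHS]exchange_big; apply: eq_bigr => m _ /=; rewrite scaler_suml.
  by apply: eq_bigr => l _; rewrite scalerA.
have -> : \sum_p (gam p)^T *m W p = 0.
  apply/matrixP => a b; rewrite summxE mxE -[RHS](cancel (fun p l => W p l b) _ a) //.
  apply: eq_bigr => p _; rewrite mulmxE3; apply: eq_bigr => l _.
  by rewrite [(gam p)^T _ _]mxE mulrC.
have -> : \sum_p W p *m gam p = 0.
  have W3 p a l : W l a p = - W p a l by rewrite WC' WC WC' opprK.
  apply/matrixP => a b; rewrite summxE mxE -[RHS](cancel (fun p l => W p a l) _ b) //.
  by apply: eq_bigr => p _; rewrite mulmxE3.
by apply/matrixP => a b; rewrite !(mxaE, mxnE) [(0 : M7) _ _]mxE; ring.
Qed.
End ThreeForm.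

End Calculus.

(** * The ring of smooth functions *)

Section DirectionalDerivative.
Local Open Scope classical_set_scope.
Local Open Scope ring_scope.
Variables (R : realType).
Local Notation E := 'rV[R]_7.
Implicit Types (f : E -> R) (x v : E).

Lemma derive_line f x v : 'D_v f x = 'D_1 (fun h : R => f (h *: v + x)) 0.
Proof.
rewrite /derive; set g1 := fun h => h^-1 *: _; set g2 := fun h => h^-1 *: _.
suff -> : g1 = g2 by [].
by apply/funext => h; rewrite /g1 /g2 /= addr0 scale0r add0r [_%:A]mulr1.
Qed.

Lemma is_derive_line f x v (t : R) : derivable f (t *: v + x) v ->
  is_derive t (1 : R) (fun h : R => f (h *: v + x)) ('D_v f (t *: v + x)).
Proof.
move=> df; have dl := (derivable1P _ _ _).1 df.
rewrite derive_line; move: dl; rewrite /derivable /derive => dl.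
set g1 := fun h => h^-1 *: _ in dl; apply: DeriveDef; rewrite /derivable /derive.
all: set g2 := fun h => h^-1 *: _; suff -> : g2 = g1 by [].
all: apply/funext => h; rewrite /g1 /g2 /= addr0 scale0r add0r.
all: by rewrite [_%:A]mulr1 scalerDl addrA.
Qed.

(** Only the derivative of f along v is assumed, not differentiability, so the chain rule is applied
    to the restriction of f to a line. *)
Lemma is_derive_comp1 f (G : R -> R) x v (dG : R) : derivable f x v ->
  is_derive (f x) (1 : R) G dG -> is_derive x v (G \o f) (dG * 'D_v f x).
Proof.
move=> df [dGx GE]; pose l := fun h : R => f (h *: v + x).
have dl : derivable l 0 1 := (derivable1P _ _ _).1 df.
have l0 : l 0 = f x by rewrite /l scale0r add0r.
have dG0 : derivable G (l 0) 1 by rewrite l0.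
have dGl : derivable (G \o l) 0 1.
  apply/derivable1_diffP; apply: differentiable_comp; exact/derivable1_diffP.
apply: DeriveDef; first exact: (derivable1P (G \o f) x v).2 dGl.
rewrite derive_line (derive_line f) -!derive1E.
by rewrite (derive1_comp dl dG0) l0 derive1E GE.
Qed.

End DirectionalDerivative.

Section Smooth.
Local Open Scope classical_set_scope.
Local Open Scope ring_scope.
Variables (R : realType) (U : set 'rV[R]_7).
Local Notation E := 'rV[R]_7.
Hypothesis Uopen : open U.
Implicit Types (f g : E -> R).

Lemma eqU_near f g x : U x -> (forall y, U y -> f y = g y) -> {near x, f =1 g}.
Proof.
by move=> Ux fg; apply: filterS (open_nbhs_nbhs (conj Uopen Ux)) => y; exact: fg.
Qed.

Lemma pd_eqU i f g x : U x -> (forall y, U y -> f y = g y) -> pd i f x = pd i g x.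
Proof. by move=> Ux fg; apply: near_eq_derive; exact: eqU_near. Qed.

Lemma derivable_eqU f g x v : U x -> (forall y, U y -> f y = g y) ->
  derivable f x v -> derivable g x v.
Proof. by move=> Ux fg; apply: near_eq_derivable; exact: eqU_near. Qed.

Lemma continuous_eqU f g x : U x -> (forall y, U y -> f y = g y) ->
  {for x, continuous f} -> {for x, continuous g}.
Proof.
move=> Ux fg cf; rewrite /prop_for /continuous_at -(fg x Ux).
apply: cvg_trans cf; exact: (near_eq_cvg (eqU_near Ux fg)).
Qed.

(** [smooth_on] speaks of all iterated derivatives, and closure under products would need Leibniz
    formulas of every order. This family is instead closed under one partial derivative
    ([smoothc_step]), and induction on the list of indices gives smoothness. Real powers of positive
    functions are included for the sake of vol and its inverse. *)
Inductive smoothc : (E -> R) -> Prop :=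
| Smoothc_smooth f : smooth_on U f -> smoothc f
| Smoothc_cst c : smoothc (fun=> c)
| Smoothc_add f g : smoothc f -> smoothc g -> smoothc (fun x => f x + g x)
| Smoothc_mul f g : smoothc f -> smoothc g -> smoothc (fun x => f x * g x)
| Smoothc_powR f r : (forall x, U x -> 0 < f x) -> smoothc f ->
    smoothc (fun x => f x `^ r)
| Smoothc_ext f g : (forall x, U x -> f x = g x) -> smoothc f -> smoothc g.

Definition C1_on f := forall x, U x ->
  {for x, continuous f} /\ forall i : 'I_7, derivable f x (delta_mx 0 i).

Lemma pd_add f g i x : C1_on f -> C1_on g -> U x ->
  pd i (fun y => f y + g y) x = pd i f x + pd i g x.
Proof. by move=> cf cg Ux; apply: deriveD; [apply: (cf x Ux).2 | apply: (cg x Ux).2]. Qed.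

Lemma pd_mul f g i x : C1_on f -> C1_on g -> U x ->
  pd i (fun y => f y * g y) x = pd i f x * g x + f x * pd i g x.
Proof.
move=> cf cg Ux; rewrite /pd (deriveM ((cf x Ux).2 i) ((cg x Ux).2 i)) addrC.
by congr (_ + _); exact: mulrC.
Qed.

Lemma pd_cst (c : R) i (x : E) : pd i (fun=> c) x = 0.
Proof. exact: derive_cst. Qed.

Lemma pd_powR f r i x : C1_on f -> U x -> 0 < f x ->
  pd i (fun y => f y `^ r) x = r * f x `^ (r - 1) * pd i f x.
Proof.
move=> cf Ux fx0.
by have [_ <-] := is_derive_comp1 ((cf x Ux).2 i) (is_derive1_powR r fx0).
Qed.

Lemma smoothc_step f : smoothc f -> C1_on f /\ forall i, smoothc (pd i f).
Proof.
elim=> {f}.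
- move=> f sf; split; first by move=> x Ux; exact: (sf [::] x Ux).
  move=> i; apply: Smoothc_smooth => s x Ux.
  by have := sf (rcons s i) x Ux; rewrite /iter_pd foldr_rcons.
- move=> c; split.
    by move=> x Ux; split; [exact: cst_continuous | move=> i; exact: derivable_cst].
  move=> i; apply: (@Smoothc_ext (fun=> 0)); last exact: Smoothc_cst.
  by move=> x Ux; rewrite pd_cst.
- move=> f g _ [cf sf] _ [cg sg]; split.
    move=> x Ux; split; first exact: continuousD (cf x Ux).1 (cg x Ux).1.
    by move=> i; exact: derivableD ((cf x Ux).2 i) ((cg x Ux).2 i).
  move=> i; apply: (@Smoothc_ext (fun x => pd i f x + pd i g x)).
    by move=> x Ux; rewrite pd_add.
  exact: Smoothc_add.
- move=> f g sf' [cf sf] sg' [cg sg]; split.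
    move=> x Ux; split; first exact: continuousM (cf x Ux).1 (cg x Ux).1.
    by move=> i; exact: derivableM ((cf x Ux).2 i) ((cg x Ux).2 i).
  move=> i; apply: (@Smoothc_ext (fun x => pd i f x * g x + f x * pd i g x)).
    by move=> x Ux; rewrite pd_mul.
  by apply: Smoothc_add; apply: Smoothc_mul.
- move=> f r f0 sf' [cf sf]; split.
    move=> x Ux; have dp := is_derive1_powR r (f0 x Ux); split.
      apply: (@continuous_comp _ _ _ f (fun y : R => y `^ r)); first exact: (cf x Ux).1.
      by apply/differentiable_continuous/derivable1_diffP; case: dp.
    by move=> i; case: (is_derive_comp1 ((cf x Ux).2 i) dp).
  move=> i; apply: (@Smoothc_ext (fun x => r * f x `^ (r - 1) * pd i f x)).
    by move=> x Ux; rewrite pd_powR // f0.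
  apply: Smoothc_mul => //; apply: Smoothc_mul; first exact: Smoothc_cst.
  exact: Smoothc_powR.
- move=> f g fg _ [cf sf]; split.
    move=> x Ux; split; first exact: continuous_eqU Ux fg (cf x Ux).1.
    by move=> i; exact: derivable_eqU Ux fg ((cf x Ux).2 i).
  by move=> i; apply: Smoothc_ext (sf i) => x Ux; exact: pd_eqU.
Qed.

Lemma smoothcP f : smoothc f -> smooth_on U f.
Proof.
move=> sf s; have {sf} : smoothc (iter_pd s f).
  by elim: s => //= i s /smoothc_step[]; exact.
by move=> /smoothc_step[].
Qed.

End Smooth.

(** * Symmetry of second partial derivatives *)

Section Schwarz.
Local Open Scope classical_set_scope.
Local Open Scope ring_scope.
Variables (R : realType) (U : set 'rV[R]_7).
Local Notation E := 'rV[R]_7.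
Hypothesis Uopen : open U.
Implicit Types (f g : E -> R).

Lemma small_box (V : set E) (x u v : E) : nbhs x V -> exists2 e : R, 0 < e &
  forall s t : R, 0 <= s <= e -> 0 <= t <= e -> V (s *: u + (t *: v + x)).
Proof.
move=> /nbhs_ballP[r /= r0 rV].
pose K := `|u| + `|v| + 1; have K0 : 0 < K by rewrite ltr_wpDl // addr_ge0.
exists (r / K / 2); first by rewrite divr_gt0 // divr_gt0.
move=> s t /andP[s0 se] /andP[t0 te]; apply: rV.
rewrite -ball_normE /= -normrN opprB addrA addrK.
apply: (le_lt_trans (ler_normD _ _)); rewrite !normrZ (ger0_norm s0) (ger0_norm t0).
apply: (@le_lt_trans _ _ (r / K / 2 * (`|u| + `|v|))).
  by rewrite mulrDr lerD // ler_wpM2r.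
apply: (@le_lt_trans _ _ (r / K / 2 * K)).
  by rewrite ler_wpM2l ?lerDl // ltW // divr_gt0 // divr_gt0.
rewrite mulrAC divfK ?gt_eqF //; lra.
Qed.

Lemma mvt_line f (v x : E) (e : R) : 0 < e ->
  (forall t : R, 0 <= t <= e -> derivable f (t *: v + x) v) ->
  exists2 c : R, 0 <= c <= e & f (e *: v + x) - f x = e * 'D_v f (c *: v + x).
Proof.
move=> e0 df; pose l := fun t : R => f (t *: v + x).
have dl (t : R) : 0 <= t <= e -> is_derive t (1 : R) l ('D_v f (t *: v + x)).
  by move=> /df; exact: is_derive_line.
have [c ce] : exists2 c, c \in `]0, e[%R & l e - l 0 = 'D_v f (c *: v + x) * (e - 0).
  apply: MVT => //.
    by move=> t; rewrite in_itv /= => /andP[t0 te]; apply: dl; rewrite !ltW.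
  apply: derivable_within_continuous => t; rewrite in_itv /= => te.
  by case: (dl t te).
rewrite /l scale0r add0r subr0 mulrC => ->; exists c => //.
by move: ce; rewrite in_itv /= => /andP[? ?]; rewrite !ltW.
Qed.

(** Two mean value theorems: along u for the difference of f between the two sides of the box, then
    along v for the first derivative of f. *)
Lemma mixed_difference f i j (x : E) (e : R) : smooth_on U f -> 0 < e ->
  let u := delta_mx 0 i in let v := delta_mx 0 j in
  (forall s t : R, 0 <= s <= e -> 0 <= t <= e -> U (s *: u + (t *: v + x))) ->
  exists c : R * R, [/\ 0 <= c.1 <= e, 0 <= c.2 <= e &
    f (e *: u + (e *: v + x)) - f (e *: u + x) - (f (e *: v + x) - f x)
    = e * (e * pd j (pd i f) (c.1 *: u + (c.2 *: v + x)))].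
Proof.
move=> sf e0 u v inU.
have U0 (s : R) : 0 <= s <= e -> U (s *: u + x).
  by move=> se; have := inU s 0 se; rewrite scale0r add0r lexx ltW //=; apply.
have ee : 0 <= e <= e by rewrite lexx ltW.
pose l := (fun s : R => f (s *: u + (e *: v + x))) - (fun s : R => f (s *: u + x)).
have dl (s : R) : 0 <= s <= e -> is_derive s (1 : R) l
    (pd i f (s *: u + (e *: v + x)) - pd i f (s *: u + x)).
  move=> se; apply: is_deriveB; apply: is_derive_line.
    exact: (sf [::] _ (inU s e se ee)).2.
  exact: (sf [::] _ (U0 s se)).2.
have [c ce] : exists2 c, c \in `]0, e[%R & l e - l 0 =
    (pd i f (c *: u + (e *: v + x)) - pd i f (c *: u + x)) * (e - 0).
  apply: MVT => //.
    by move=> t; rewrite in_itv /= => /andP[t0 te]; apply: dl; rewrite !ltW.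
  apply: derivable_within_continuous => t; rewrite in_itv /= => te.
  by case: (dl t te).
have {}ce : 0 <= c <= e by move: ce; rewrite in_itv /= => /andP[? ?]; rewrite !ltW.
have swap (t : R) : c *: u + (t *: v + x) = t *: v + (c *: u + x) by rewrite addrCA.
have [|d de] := @mvt_line (pd i f) v (c *: u + x) e e0.
  move=> t te; rewrite -swap; exact: (sf [:: i] _ (inU c t ce te)).2.
rewrite -!swap => E1; rewrite E1 /l => E2.
exists (c, d); split => //=.
move: E2; rewrite -![(_ - _ : _ -> _) _]/(_ - _) /= scale0r !add0r subr0.
by move=> ->; rewrite mulrC.
Qed.

(** The second difference over a small box does not depend on the order of the directions, so both
    mixed derivatives take a common value arbitrarily near x. If they differed at x, continuity with
    half the gap as tolerance would be contradicted. *)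
Lemma schwarz f i j (x : E) : smooth_on U f -> U x -> pd i (pd j f) x = pd j (pd i f) x.
Proof.
move=> sf Ux; pose A := pd i (pd j f); pose B := pd j (pd i f).
rewrite -/(A x) -/(B x).
have cA : {for x, continuous A} := (sf [:: i; j] x Ux).1.
have cB : {for x, continuous B} := (sf [:: j; i] x Ux).1.
apply/eqP; apply: contraT => ne.
pose r := `|A x - B x| / 2.
have r0 : 0 < r by rewrite divr_gt0 // normr_gt0 subr_eq0.
have near_close (g : E -> R) : {for x, continuous g} -> \forall y \near x, `|g x - g y| < r.
  by move=> /cvgrPdist_lt /(_ r r0).
have nA := near_close A cA; have nB := near_close B cB.
have nU : nbhs x U by exact: open_nbhs_nbhs.
pose W := [set y | [/\ U y, `|A x - A y| < r & `|B x - B y| < r]].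
have nW : nbhs x W by apply: filterS3 nU nA nB => y; split.
have [e e0 eW] := small_box (delta_mx 0 i) (delta_mx 0 j) nW.
have eW' (s t : R) : 0 <= s <= e -> 0 <= t <= e ->
    W (s *: delta_mx 0 j + (t *: delta_mx 0 i + x)).
  by move=> se te; rewrite addrCA; exact: eW.
have [|[c d] /= [ce de E1]] := @mixed_difference f i j x e sf e0.
  by move=> s t se te; case: (eW s t se te).
have [|[c' d'] /= [ce' de' E2]] := @mixed_difference f j i x e sf e0.
  by move=> s t se te; case: (eW' s t se te).
have [_ _ hB] := eW c d ce de; have [_ hA _] := eW' c' d' ce' de'.
have E : A (c' *: delta_mx 0 j + (d' *: delta_mx 0 i + x)) =
    B (c *: delta_mx 0 i + (d *: delta_mx 0 j + x)).
  apply: (mulfI (lt0r_neq0 e0)); apply: (mulfI (lt0r_neq0 e0)).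
  refine (etrans (esym E2) (etrans _ E1)).
  have h4 (p q r' s : R) : p - q - (r' - s) = p - r' - (q - s) by ring.
  by rewrite (addrCA (e *: delta_mx 0 j)); exact: h4.
have : `|A x - B x| < r + r.
  rewrite -[X in `|X|](subrKA (A (c' *: delta_mx 0 j + (d' *: delta_mx 0 i + x)))).
  apply: (le_lt_trans (ler_normD _ _)); apply: ltrD.
    exact: hA.
  by rewrite E distrC; exact: hB.
by rewrite -splitr ltxx.
Qed.
End Schwarz.

(* Smooth functions on [U], extended by 0 so that equality on [U] is Leibniz equality. *)
Record smooth_fun (R : realType) (U : set 'rV[R]_7) (Uo : open U) := SmoothFun {
  sfun_val :> 'rV[R]_7 -> R ;
  sfun_smooth : smooth_on U sfun_val ;
  sfun_out : forall x, ~ U x -> sfun_val x = 0 }.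

Section SmoothRing.
Local Open Scope classical_set_scope.
Local Open Scope ring_scope.
Variables (R : realType) (U : set 'rV[R]_7) (Uo : open U).
Local Notation E := 'rV[R]_7.
Local Notation A := (smooth_fun Uo).

Lemma sfun_eq (a b : A) : (forall x, U x -> a x = b x) -> a = b.
Proof.
case: a b => [f sf f0] [g sg g0] /= fg.
have e : f = g.
  apply/funext => x; have [Ux|nUx] := pselect (U x); first exact: fg.
  by rewrite f0 ?g0.
by subst g; congr SmoothFun; exact: Prop_irrelevance.
Qed.

Definition ext0 (f : E -> R) (x : E) : R := if `[< U x >] then f x else 0.
Lemma ext0E f x : U x -> ext0 f x = f x.
Proof. by move=> Ux; rewrite /ext0; case: asboolP. Qed.
Lemma ext0_smooth f : smoothc U f -> smooth_on U (ext0 f).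
Proof.
move=> sf; apply: smoothcP => //; apply: (@Smoothc_ext _ _ f) => // x Ux.
by rewrite ext0E.
Qed.
Lemma ext0_out f x : ~ U x -> ext0 f x = 0.
Proof. by move=> nUx; rewrite /ext0; case: asboolP. Qed.
Definition mk_sfun f (sf : smoothc U f) : A := SmoothFun Uo (ext0_smooth sf) (@ext0_out f).

Lemma sfun_smoothc (a : A) : smoothc U a. Proof. exact: Smoothc_smooth (sfun_smooth a). Qed.

Definition sfun_cst (c : R) : A := mk_sfun (Smoothc_cst U c).
Definition sfun_add (a b : A) : A := mk_sfun (Smoothc_add (sfun_smoothc a) (sfun_smoothc b)).
Definition sfun_mul (a b : A) : A := mk_sfun (Smoothc_mul (sfun_smoothc a) (sfun_smoothc b)).
Definition sfun_opp (a : A) : A := sfun_mul (sfun_cst (- 1)) a.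

HB.instance Definition _ := gen_eqMixin A.
HB.instance Definition _ := gen_choiceMixin A.

Fact sfun_addA : associative sfun_add.
Proof. by move=> a b c; apply: sfun_eq => x Ux; rewrite /= !ext0E // addrA. Qed.
Fact sfun_addC : commutative sfun_add.
Proof. by move=> a b; apply: sfun_eq => x Ux; rewrite /= !ext0E // addrC. Qed.
Fact sfun_add0 : left_id (sfun_cst 0) sfun_add.
Proof. by move=> a; apply: sfun_eq => x Ux; rewrite /= !ext0E // add0r. Qed.
Fact sfun_addN : left_inverse (sfun_cst 0) sfun_opp sfun_add.
Proof. by move=> a; apply: sfun_eq => x Ux; rewrite /= !ext0E // mulN1r addNr. Qed.
HB.instance Definition _ := GRing.isZmodule.Build A sfun_addA sfun_addC sfun_add0 sfun_addN.

Fact sfun_mulA : associative sfun_mul.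
Proof. by move=> a b c; apply: sfun_eq => x Ux; rewrite /= !ext0E // mulrA. Qed.
Fact sfun_mulC : commutative sfun_mul.
Proof. by move=> a b; apply: sfun_eq => x Ux; rewrite /= !ext0E // mulrC. Qed.
Fact sfun_mul1 : left_id (sfun_cst 1) sfun_mul.
Proof. by move=> a; apply: sfun_eq => x Ux; rewrite /= !ext0E // mul1r. Qed.
Fact sfun_mulD : left_distributive sfun_mul sfun_add.
Proof. by move=> a b c; apply: sfun_eq => x Ux; rewrite /= !ext0E // mulrDl. Qed.
HB.instance Definition _ := GRing.Zmodule_isComPzRing.Build A
  sfun_mulA sfun_mulC sfun_mul1 sfun_mulD.

Section Eval.
Local Open Scope classical_set_scope.
Local Open Scope ring_scope.
Variables (x : E) (Ux : U x).
(** The proof that x lies in U is an argument because evaluation elsewhere is zero and does not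
    preserve 1; with it, [ev Ux] can carry the structure of a ring morphism. *)
Definition ev (_ : U x) (a : A) : R := a x.
Fact ev_additive : zmod_morphism (ev Ux).
Proof. by move=> a b; rewrite /ev /= !ext0E // mulN1r. Qed.
Fact ev_multiplicative : monoid_morphism (ev Ux).
Proof. by split=> [|a b]; rewrite /ev /= !ext0E. Qed.
HB.instance Definition _ := GRing.isZmodMorphism.Build A R (ev Ux) ev_additive.
HB.instance Definition _ := GRing.isMonoidMorphism.Build A R (ev Ux) ev_multiplicative.
End Eval.

Lemma smoothc_pd i (a : A) : smoothc U (pd i a).
Proof. by case: (smoothc_step Uo (sfun_smoothc a)). Qed.
Lemma sfun_C1 (a : A) : C1_on U a.
Proof. by case: (smoothc_step Uo (sfun_smoothc a)). Qed.

Definition sfun_d (i : 'I_7) (a : A) : A := mk_sfun (smoothc_pd i a).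

Lemma sfun_dE i a x : U x -> sfun_d i a x = pd i a x.
Proof. exact: ext0E. Qed.

Lemma sfun_dD i a b : sfun_d i (a + b) = sfun_d i a + sfun_d i b.
Proof.
apply: sfun_eq => x Ux; rewrite /= !ext0E //.
rewrite -(pd_add i (sfun_C1 a) (sfun_C1 b) Ux); apply: (pd_eqU Uo _ Ux) => y Uy.
by rewrite ext0E.
Qed.
Lemma sfun_dM i a b : sfun_d i (a * b) = sfun_d i a * b + a * sfun_d i b.
Proof.
apply: sfun_eq => x Ux; rewrite /= !ext0E //.
rewrite -(pd_mul i (sfun_C1 a) (sfun_C1 b) Ux); apply: (pd_eqU Uo _ Ux) => y Uy.
by rewrite ext0E.
Qed.
Lemma sfun_dC i j a : sfun_d i (sfun_d j a) = sfun_d j (sfun_d i a).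
Proof.
apply: sfun_eq => x Ux.
have e k l : (sfun_d k (sfun_d l a)) x = pd k (pd l a) x.
  refine (etrans (sfun_dE k (sfun_d l a) Ux) _).
  exact: (@pd_eqU _ _ Uo k _ _ x Ux (fun y => @sfun_dE l a y)).
refine (etrans (e i j) (etrans _ (esym (e j i)))).
exact: (@schwarz _ _ Uo a i j x (sfun_smooth a) Ux).
Qed.

(* [reps f a]: the function [f] coincides on [U] with the element [a] of the ring. *)
Definition reps (f : E -> R) (a : A) := forall x, U x -> f x = a x.

Lemma reps_mk f (sf : smoothc U f) : reps f (mk_sfun sf).
Proof. by move=> x Ux /=; rewrite ext0E. Qed.
Lemma reps_cst c : reps (fun=> c) (sfun_cst c).
Proof. by move=> x Ux /=; rewrite ext0E. Qed.
Lemma repsD f g a b : reps f a -> reps g b -> reps (fun x => f x + g x) (a + b).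
Proof. by move=> fa gb x Ux /=; rewrite fa // gb // ext0E. Qed.
Lemma repsM f g a b : reps f a -> reps g b -> reps (fun x => f x * g x) (a * b).
Proof. by move=> fa gb x Ux /=; rewrite fa // gb // ext0E. Qed.
Lemma repsN f a : reps f a -> reps (fun x => - f x) (- a).
Proof. by move=> fa x Ux /=; rewrite fa // !ext0E // mulN1r. Qed.
Lemma repsB f g a b : reps f a -> reps g b -> reps (fun x => f x - g x) (a - b).
Proof. by move=> fa gb; apply: repsD => //; exact: repsN. Qed.
Lemma reps_sum (I : Type) (r : seq I) (P : pred I) (f : I -> E -> R) (a : I -> A) :
  (forall i, reps (f i) (a i)) ->
  reps (fun x => \sum_(i <- r | P i) f i x) (\sum_(i <- r | P i) a i).
Proof.
move=> fa x Ux; rewrite -[RHS]/(ev Ux _) rmorph_sum; apply: eq_bigr => i _; exact: fa.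
Qed.
Lemma reps_pd i f a : reps f a -> reps (pd i f) (sfun_d i a).
Proof. by move=> fa x Ux; rewrite sfun_dE //; exact: (pd_eqU Uo _ Ux). Qed.
Lemma reps_ext f g a : (forall x, U x -> f x = g x) -> reps f a -> reps g a.
Proof. by move=> fg fa x Ux; rewrite -fg // fa. Qed.
End SmoothRing.

(** * Alternating sums and determinants by integer evaluation *)

Definition signi (n : nat) (z : int) : int := if odd n then oppi z else z.
Definition sumi (n : nat) (f : nat -> int) : int :=
  foldr (fun i s => addi (f i) s) 0 (iota 0 n).
(** The signed sum of F over the permutations of 0, ..., n - 1 in one-line notation. It is unfolded
    on the first value x, whose removal costs the sign (-1)^x; [bump x] renumbers the remaining
    values. *)
Fixpoint alti_sum (n : nat) (F : seq nat -> int) : int :=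
  if n is n'.+1 then
    sumi n (fun x => signi x (alti_sum n' (fun L => F (x :: map (bump x) L))))
  else F [::].

(** The Levi-Civita symbol by expansion along the first row. A later entry equal to x is sent to n',
    which is out of range at the next level, so repeated indices give 0. *)
Fixpoint lci (n : nat) (s : seq nat) : int :=
  match n, s with
  | 0, _ => 1
  | n'.+1, x :: s' =>
    if (x < n)%N then
      signi x (lci n' [seq if y == x then n' else unbump x y | y <- s'])
    else 0
  | _, [::] => 0
  end.

Section Permutations.
Variable R : comNzRingType.

Lemma ir_signi n z : ir R (signi n z) = (-1) ^+ n * ir R z.
Proof. by rewrite /signi -signr_odd; case: (odd n); rewrite /= ?irN; ring. Qed.

Lemma ir_sumi n f : ir R (sumi n f) = \sum_(i < n) ir R (f i).
Proof.
rewrite -(big_mkord xpredT (fun i => ir R (f i))) /index_iota subn0 unlock /sumi.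
by elim: (iota 0 n) => //= a s ih; rewrite irD ih.
Qed.

Lemma sum_lift_perm n (F : 'S_n.+1 -> R) :
  \sum_s F s = \sum_j \sum_(s : 'S_n) F (lift_perm ord0 j s).
Proof.
rewrite pair_big /= (reindex (fun p : 'I_n.+1 * 'S_n => lift_perm ord0 p.1 p.2)) //.
apply: onW_bij; apply: inj_card_bij; last by rewrite card_prod !card_Sn card_ord factS.
move=> [j s] [j' s'] /= e; have ej : j = j'.
  by have := congr1 (fun t : 'S_n.+1 => t ord0) e; rewrite !lift_perm_id.
subst j'; congr (_, _); apply/permP => k.
have := congr1 (fun t : 'S_n.+1 => t (lift ord0 k)) e; rewrite !lift_perm_lift.
exact: lift_inj.
Qed.

Lemma perm_sum n (F : seq nat -> int) :
  \sum_(s : 'S_n) (-1) ^+ s * ir R (F [seq val (s i) | i <- enum 'I_n]) = ir R (alti_sum n F).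
Proof.
elim: n F => [|n ih] F.
  rewrite (big_pred1 1%g) => [|s]; last by apply/esym/eqP/permP => -[].
  by rewrite odd_perm1 mul1r (_ : enum 'I_0 = [::]) //; apply: size0nil; rewrite size_enum_ord.
rewrite sum_lift_perm [alti_sum _ _]/= ir_sumi; apply: eq_bigr => j _.
rewrite ir_signi -ih mulr_sumr; apply: eq_bigr => s _.
rewrite odd_lift_perm /= signr_addb mulrA signr_odd; congr (_ * ir R (F _)).
rewrite enum_ordSl /= lift_perm_id; congr (_ :: _); rewrite -!map_comp.
by apply: eq_map => i /=; rewrite lift_perm_lift.
Qed.

Lemma det_perm_sum n (m : nat -> nat -> int) (A : 'M[R]_n) :
  (forall i j, A i j = ir R (m i j)) ->
  \det A = ir R (alti_sum n (fun L => foldr muli 1 [seq m p.1 p.2 | p <- zip (iota 0 n) L])).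
Proof.
move=> hA; rewrite -perm_sum; apply: eq_bigr => s _; congr (_ * _).
have -> : zip (iota 0 n) [seq val (s i) | i <- enum 'I_n]
   = [seq (val i, val (s i)) | i <- enum 'I_n].
  by rewrite -val_enum_ord; elim: (enum 'I_n) => //= a r ->.
rewrite -map_comp -big_enum /=; elim: (enum 'I_n) => [|a r ih] /=; first by rewrite big_nil.
by rewrite big_cons irM ih hA.
Qed.

Lemma det_lci n (s : seq nat) : size s = n ->
  \det (\matrix_(r < n, q < n) (nth 0%N s r == q)%:R : 'M[R]_n) = ir R (lci n s).
Proof.
elim: n s => [|n ih] [|x s] //=; first by rewrite det_mx00.
move=> [sz]; rewrite (expand_det_row _ ord0).
case: ltnP => hx; last first.
  rewrite big1 // => j _; rewrite mxE /= (_ : (x == j) = false) ?mul0r //.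
  by apply/negbTE; rewrite neq_ltn (leq_trans (ltn_ord j) hx) orbT.
rewrite (bigD1 (Ordinal hx)) //= big1 ?addr0; last first.
  by move=> j; rewrite -val_eqE eq_sym /= mxE /= => /negbTE ->; rewrite mul0r.
rewrite mxE /= eqxx mul1r ir_signi -ih ?size_map // /cofactor add0n.
congr (_ * \det _); apply/matrixP => r q; rewrite !mxE /=.
rewrite (nth_map 0%N) ?sz //; set y := nth 0%N s r; congr (_%:R).
congr nat_of_bool; have [->|yx] := eqVneq y x.
  rewrite (negbTE (neq_bump x q)); apply/esym/negbTE.
  by rewrite neq_ltn ltn_ord orbT.
by apply/eqP/eqP => [->|<-]; rewrite ?bumpK ?unbumpK.
Qed.
End Permutations.

Section TupleSums.
Variable V : nmodType.

Lemma big_tuple0 (F : 0.-tuple 'I_7 -> V) : \sum_I F I = F [tuple].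
Proof. by rewrite (big_pred1 [tuple]) // => I; apply/esym/eqP; exact: tuple0. Qed.

Lemma big_tcons k (F : k.+1.-tuple 'I_7 -> V) :
  \sum_I F I = \sum_i \sum_(J : k.-tuple 'I_7) F (tcons i J).
Proof.
rewrite pair_big /= (reindex (fun p : 'I_7 * k.-tuple 'I_7 => tcons p.1 p.2)) //.
exists (fun I => (thead I, [tuple of behead I])) => [[i J] _|I _].
  by congr (_, _); apply: val_inj.
by rewrite [RHS](tuple_eta I); apply: val_inj.
Qed.

Lemma big_tuple1 (F : 1.-tuple 'I_7 -> V) : \sum_I F I = \sum_i F [tuple i].
Proof.
rewrite big_tcons; apply: eq_bigr => i _; rewrite big_tuple0; congr F.
Qed.
Lemma big_tuple2 (F : 2.-tuple 'I_7 -> V) : \sum_I F I = \sum_i \sum_j F [tuple i; j].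
Proof.
rewrite big_tcons; apply: eq_bigr => i _; rewrite big_tuple1; apply: eq_bigr => j _.
congr F; exact: val_inj.
Qed.
Lemma big_tuple3 (F : 3.-tuple 'I_7 -> V) :
  \sum_I F I = \sum_i \sum_j \sum_k F [tuple i; j; k].
Proof.
rewrite big_tcons; apply: eq_bigr => i _; rewrite big_tuple2; apply: eq_bigr => j _.
apply: eq_bigr => k _; congr F; exact: val_inj.
Qed.
End TupleSums.

(** * Naturality of the Hodge star and of the metric *)

Section Pullback.
Variable R : realType.

Lemma prod_sum_tuple k (F : 'I_k -> 'I_7 -> R) :
  \prod_(l < k) \sum_j F l j = \sum_(J : k.-tuple 'I_7) \prod_(l < k) F l (tnth J l).
Proof.
rewrite bigA_distr_bigA /= (reindex (fun J : k.-tuple 'I_7 => [ffun l => tnth J l])) /=.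
  by apply: eq_bigr => J _; apply: eq_bigr => l _; rewrite ffunE.
exists (fun f : {ffun 'I_k -> 'I_7} => [tuple f l | l < k]) => [J _|f _].
  by apply: eq_from_tnth => l; rewrite tnth_mktuple ffunE.
by apply/ffunP => l; rewrite ffunE tnth_mktuple.
Qed.

Lemma pullback_comp k (A B : 'M[R]_7) (w : cotensor R k) I :
  pullback A (pullback B w) I = pullback (A *m B) w I.
Proof.
rewrite /pullback; under eq_bigr do rewrite mulr_suml.
rewrite exchange_big; apply: eq_bigr => K _ /=.
under eq_bigr do rewrite -mulrA -big_split /=.
rewrite -mulr_sumr; congr (_ * _).
rewrite -(prod_sum_tuple (fun l j => B j (tnth K l) * A (tnth I l) j)).
by apply: eq_bigr => l _; rewrite mxE; apply: eq_bigr => j _; rewrite mulrC.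
Qed.

Lemma pullback1 k (w : cotensor R k) I : pullback 1%:M w I = w I.
Proof.
rewrite /pullback (bigD1 I) //= [X in _ + X]big1 ?addr0.
  by rewrite big1 ?mulr1 // => l _; rewrite mxE eqxx.
move=> J neJ; have [l nel] : exists l, tnth I l != tnth J l.
  apply/existsP; rewrite -negb_forall; apply: contra neJ => /forallP e.
  by apply/eqP/eq_from_tnth => l; apply/esym/eqP/e.
by rewrite (bigD1 l) //= mxE (negbTE nel) mul0r mulr0.
Qed.

Lemma pullback_adjoint k (A : 'M[R]_7) (w z : cotensor R k) :
  \sum_I pullback A w I * z I = \sum_I w I * pullback A^T z I.
Proof.
rewrite /pullback; under eq_bigr do rewrite mulr_suml.
rewrite exchange_big; apply: eq_bigr => J _ /=.
rewrite mulr_sumr; apply: eq_bigr => I _; rewrite -mulrA [_ * z I]mulrC; congr (_ * (_ * _)).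
by apply: eq_bigr => l _; rewrite mxE.
Qed.

Lemma eq_pullback k (A : 'M[R]_7) (w z : cotensor R k) I : (forall J, w J = z J) ->
  pullback A w I = pullback A z I.
Proof. by move=> h; apply: eq_bigr => J _; rewrite h. Qed.

Lemma levi_civitaE (K : 7.-tuple 'I_7) :
  levi_civita R K = \det (\matrix_(r < 7, q < 7) (tnth K r == q)%:R).
Proof. by congr (\det _); apply/matrixP => r q; rewrite !mxE (tnth_nth ord0). Qed.

Lemma levi_civita_perm (s : 'S_7) : levi_civita R [tuple s r | r < 7] = (-1) ^+ s.
Proof.
rewrite levi_civitaE -det_perm; congr (\det _); apply/matrixP => r q.
by rewrite !mxE tnth_mktuple.
Qed.

Lemma tuple_noninj (K : 7.-tuple 'I_7) : ~~ uniq K ->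
  exists i j, i != j /\ tnth K i = tnth K j.
Proof.
move=> h; have /injectivePn[i [j ij e]] : ~~ injectiveb (tnth K).
  apply: contra h => /injectiveP inj; rewrite -[tval K]map_tnth_enum map_inj_uniq ?enum_uniq //.
by exists i, j.
Qed.

Lemma levi_civita_noninj (K : 7.-tuple 'I_7) : ~~ uniq K -> levi_civita R K = 0.
Proof.
move=> /tuple_noninj[i [j [ij e]]]; rewrite levi_civitaE.
by apply: (determinant_alternate ij) => q; rewrite !mxE e.
Qed.

Lemma uniq_tuple_perm (K : 7.-tuple 'I_7) : uniq K -> exists s : 'S_7, K = [tuple s r | r < 7].
Proof.
move=> h; have inj : injective (tnth K) by apply/tuple_uniqP.
exists (perm inj); apply: eq_from_tnth => r; by rewrite tnth_mktuple permE.
Qed.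

Lemma levi_civita_sum (G : 7.-tuple 'I_7 -> R) :
  \sum_(K : 7.-tuple 'I_7) levi_civita R K * G K = \sum_(s : 'S_7) (-1) ^+ s * G [tuple s r | r < 7].
Proof.
rewrite (bigID (fun K : 7.-tuple 'I_7 => uniq K)) /= [X in _ + X]big1 ?addr0; last first.
  by move=> K h; rewrite levi_civita_noninj // mul0r.
rewrite (reindex_onto (fun s : 'S_7 => [tuple s r | r < 7])
  (fun K => odflt 1%g [pick s : 'S_7 | K == [tuple s r | r < 7]])) /=; last first.
  move=> K /uniq_tuple_perm[s ->]; case: pickP => [s' /eqP-> //|/(_ s)].
  by rewrite eqxx.
apply: eq_big => [s|s _]; last by rewrite levi_civita_perm.
have -> : uniq [tuple s r | r < 7].
  by apply/tuple_uniqP => i j; rewrite !tnth_mktuple; exact: perm_inj.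
case: pickP => [s' /eqP e|/(_ s)]; last by rewrite eqxx.
rewrite /=; apply/eqP/permP => r.
by have := congr1 (fun K => tnth K r) e; rewrite !tnth_mktuple.
Qed.

Definition lct : cotensor R 7 := fun K => levi_civita R K.

Lemma pullback_lct A K : pullback A lct K = \det A * lct K.
Proof.
rewrite /pullback /lct levi_civita_sum levi_civitaE mulrC -det_mulmx.
apply: eq_bigr => s _; congr (_ * _); apply: eq_bigr => l _.
rewrite mxE (bigD1 (tnth K l)) //= mxE eqxx mul1r big1 ?addr0 ?tnth_mktuple //.
by move=> q; rewrite mxE eq_sym => /negbTE->; rewrite mul0r.
Qed.

Lemma alternating7 (th : cotensor R 7) (J : 7.-tuple 'I_7) :
  alternating th -> th J = lct J * th (ord_tuple 7).
Proof.
move=> alt; have [h|h] := boolP (uniq J).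
  have [s ->] := uniq_tuple_perm h; rewrite /lct levi_civita_perm -alt.
  by congr th; apply: eq_from_tnth => r; rewrite !tnth_mktuple tnth_ord_tuple.
rewrite /lct levi_civita_noninj // mul0r; have [i [j [ij e]]] := tuple_noninj h.
have := alt (tperm i j) J; rewrite odd_tperm ij expr1 mulN1r.
have -> : tperm_idx (tperm i j) J = J; last by move=> /eqP; rewrite -addr_eq0 -mulr2n mulrn_eq0 /= => /eqP.
by apply: eq_from_tnth => r; rewrite tnth_mktuple; case: tpermP => // ->.
Qed.

Lemma pullback_alternating7 A (th : cotensor R 7) : alternating th ->
  pullback A th (ord_tuple 7) = \det A * th (ord_tuple 7).
Proof.
move=> alt; transitivity (pullback A lct (ord_tuple 7) * th (ord_tuple 7)).
  rewrite /pullback mulr_suml; apply: eq_bigr => J _.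
  by rewrite (alternating7 J alt) mulrAC.
rewrite pullback_lct; congr (_ * _).
have -> : ord_tuple 7 = [tuple (1%g : 'S_7) r | r < 7].
  by apply: eq_from_tnth => r; rewrite tnth_mktuple tnth_ord_tuple perm1.
by rewrite /lct levi_civita_perm odd_perm1 mulr1.
Qed.

Lemma big_cat_tuple k m (T : finType) (F : (k + m).-tuple T -> R) :
  \sum_K F K = \sum_(I : k.-tuple T) \sum_(J : m.-tuple T) F [tuple of I ++ J].
Proof.
rewrite pair_big /=.
rewrite (reindex (fun p : k.-tuple T * m.-tuple T => [tuple of p.1 ++ p.2])) //.
exists (fun K : (k + m).-tuple T => ([tuple tnth K (lshift m r) | r < k],
   [tuple tnth K (rshift k r) | r < m])) => [[I J] _|K _].
  congr (_, _); apply: eq_from_tnth => r; rewrite tnth_mktuple.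
    by rewrite tnth_lshift.
  by rewrite tnth_rshift.
apply: eq_from_tnth => i; case: (split_ordP i) => j ->.
  by rewrite tnth_lshift tnth_mktuple.
by rewrite tnth_rshift tnth_mktuple.
Qed.

Lemma big_tuple_cat n k m (T : finType) (F : seq T -> R) : (k + m)%N = n ->
  \sum_(K : n.-tuple T) F K = \sum_(I : k.-tuple T) \sum_(J : m.-tuple T) F (I ++ J).
Proof. by move=> <-; rewrite (big_cat_tuple (fun K => F (tval K))). Qed.

Lemma prod_zip k (A : 'M[R]_7) (I J : k.-tuple 'I_7) :
  \prod_(l < k) A (tnth I l) (tnth J l) = \prod_(p <- zip I J) A p.1 p.2.
Proof.
rewrite (big_nth (ord0, ord0)) size_zip !size_tuple minnn big_mkord.
by apply: eq_bigr => l _; rewrite nth_zip ?size_tuple //= -!tnth_nth.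
Qed.

(** Raising indices after pulling back by u is pulling back by the inverse transpose of u. By
    adjointness this moves to the Levi-Civita symbol, where [pullback_lct] absorbs det u and cancels
    the inverse on the summed slots; u survives on the slots of J only. *)
Lemma pullback_star k m (u : 'M[R]_7) (w : cotensor R k) J : (k + m)%N = 7 -> u \in unitmx ->
  star m (u *m u^T) (\det u) (pullback u w) J = pullback u (star m 1%:M 1 w) J.
Proof.
move=> km uu; pose F := invmx u.
have hu : invmx (u *m u^T) *m u = F^T.
  have uuT : u *m u^T \in unitmx by rewrite unitmx_mul uu unitmx_tr.
  apply: (can_inj (mulKmx uuT)); rewrite mulKVmx // -mulmxA -trmx_mul mulVmx //.
  by rewrite trmx1 mulmx1.
transitivity ((k`!%:R)^-1 * \sum_I w I * \sum_(J' : m.-tuple 'I_7)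
     levi_civita R (I ++ J') * \prod_(l < m) u (tnth J l) (tnth J' l)).
  congr (_ * _); pose z (I : k.-tuple 'I_7) := \det u * levi_civita R (I ++ J).
  transitivity (\sum_I pullback F^T w I * z I).
    by apply: eq_bigr => I _; rewrite /raise pullback_comp hu.
  rewrite pullback_adjoint trmxK; apply: eq_bigr => I _; congr (_ * _).
  pose y (I' : k.-tuple 'I_7) := \sum_(J' : m.-tuple 'I_7)
     levi_civita R (I' ++ J') * \prod_(l < m) u (tnth J l) (tnth J' l).
  rewrite (_ : \sum_J' _ = y I) // -(pullback1 y) -(mulVmx uu) -pullback_comp.
  apply: eq_pullback => I'; rewrite /z.
  have szK : size (I' ++ J) == 7 by rewrite size_cat !size_tuple km.
  have := pullback_lct u (Tuple szK); rewrite /lct /= => <-.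
  rewrite /pullback; under eq_bigr do rewrite prod_zip.
  rewrite (big_tuple_cat (fun L => levi_civita R L * \prod_(p <- zip (I' ++ J) L) u p.1 p.2) km).
  apply: eq_bigr => I'' _; rewrite mulr_suml; apply: eq_bigr => J' _.
  rewrite zip_cat ?size_tuple // big_cat /= -mulrA; congr (_ * _).
  by rewrite -!prod_zip mulrC.
rewrite /pullback /star mulr_sumr.
under [RHS]eq_bigr do rewrite -mulrA mulr_suml mulr_sumr.
rewrite [RHS]exchange_big; apply: eq_bigr => I _ /=; rewrite !mulr_sumr.
apply: eq_bigr => J' _; rewrite -mulrA; congr (_ * _).
by rewrite /raise invmx1 pullback1 mul1r; ring.
Qed.

Lemma iprod_pullback k (u : 'M[R]_7) (v : 'rV[R]_7) (w : cotensor R k.+1) I :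
  iprod v (pullback u w) I = pullback u (iprod (v *m u) w) I.
Proof.
rewrite /iprod /pullback; under eq_bigr do rewrite big_tcons mulr_sumr.
rewrite exchange_big; under [RHS]eq_bigr do rewrite mulr_suml.
rewrite [RHS]exchange_big; apply: eq_bigr => m _ /=.
under eq_bigr do rewrite mulr_sumr.
rewrite exchange_big; apply: eq_bigr => J _ /=.
rewrite mxE mulr_suml mulr_suml; apply: eq_bigr => i _.
have -> : \prod_(l < k.+1) u (tnth (tcons i I) l) (tnth (tcons m J) l) =
    u i m * \prod_(l < k) u (tnth I l) (tnth J l).
  by rewrite big_ord_recl; congr (_ * _); apply: eq_bigr => l _; rewrite !tnthS.
ring.
Qed.

Lemma wedge_pullback k m (A : 'M[R]_7) (w : cotensor R k) (z : cotensor R m) I :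
  wedge (pullback A w) (pullback A z) I = pullback A (wedge w z) I.
Proof.
rewrite /wedge {3}/pullback; under [RHS]eq_bigr do rewrite -mulrA mulr_suml.
rewrite -mulr_sumr; congr (_ * _); rewrite exchange_big; apply: eq_bigr => s _ /=.
rewrite (reindex_onto (fun J : (k + m).-tuple 'I_7 => [tuple tnth J ((s^-1)%g r) | r < k + m])
  (fun J => [tuple tnth J (s r) | r < k + m])) /=; last first.
  by move=> J _; apply: eq_from_tnth => r; rewrite !tnth_mktuple permKV.
rewrite (eq_bigl xpredT); last first.
  by move=> J; apply/eqP/eq_from_tnth => r; rewrite !tnth_mktuple permK.
transitivity (\sum_(J : (k + m).-tuple 'I_7)
   ((-1) ^+ s * w [tuple tnth J (lshift m r) | r < k] * z [tuple tnth J (rshift k r) | r < m]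
   * \prod_l A (tnth I (s l)) (tnth J l))); last first.
  apply: eq_bigr => J _; congr (_ * w _ * z _ * _).
  - by apply: eq_from_tnth => r; rewrite !tnth_mktuple permK.
  - by apply: eq_from_tnth => r; rewrite !tnth_mktuple permK.
  rewrite [RHS](reindex_inj (@perm_inj _ s)) /=.
  by apply: eq_bigr => l _; rewrite tnth_mktuple permK.
rewrite big_cat_tuple -mulrA mulr_suml mulr_sumr; apply: eq_bigr => I1 _.
rewrite !mulr_sumr; apply: eq_bigr => I2 _.
rewrite big_split_ord /= -mulrA.
have -> : [tuple tnth [tuple of I1 ++ I2] (lshift m r) | r < k] = I1.
  by apply: eq_from_tnth => r; rewrite tnth_mktuple tnth_lshift.
have -> : [tuple tnth [tuple of I1 ++ I2] (rshift k r) | r < m] = I2.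
  by apply: eq_from_tnth => r; rewrite tnth_mktuple tnth_rshift.
under [X in _ = _ * (_ * (X * _))]eq_bigr do rewrite tnth_lshift.
under [X in _ = _ * (_ * (_ * X))]eq_bigr do rewrite tnth_rshift.
under eq_bigr do rewrite tnth_mktuple.
under [X in _ * (_ * (_ * X)) = _]eq_bigr do rewrite tnth_mktuple.
by rewrite -!mulrA; congr (_ * (_ * _)); rewrite mulrCA.
Qed.

Lemma wedge_alternating k m (w : cotensor R k) (z : cotensor R m) : alternating (wedge w z).
Proof.
move=> t I; rewrite /wedge mulrCA; congr (_ * _); rewrite mulr_sumr.
rewrite [RHS](reindex_inj (@mulIg _ t)) /=; apply: eq_bigr => s _.
rewrite odd_permM signr_addb !mulrA; congr (_ * w _ * z _).
- by rewrite mulrAC -signr_addb addbb mul1r.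
- by apply: eq_from_tnth => r; rewrite !tnth_mktuple permM.
- by apply: eq_from_tnth => r; rewrite !tnth_mktuple permM.
Qed.
End Pullback.

(** * The Hodge dual and the metric of phi0 on the standard basis *)

Definition e3_sum (a b c i j k : nat) : int :=
  alti_sum 3 (fun L => foldr muli 1
    [seq deltai (nth 0 [:: i; j; k] p.1).+1 (nth 0 [:: a; b; c] p.2) | p <- zip (iota 0 3) L])%N.

Definition phi_sum (i j k : nat) : int :=
  addi (addi (addi (addi (addi (addi (e3_sum 1 2 3 i j k) (e3_sum 1 4 5 i j k))
   (e3_sum 1 6 7 i j k)) (e3_sum 2 4 6 i j k)) (oppi (e3_sum 2 5 7 i j k)))
   (oppi (e3_sum 3 4 7 i j k))) (oppi (e3_sum 3 5 6 i j k)).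

Lemma phi_sumP : all7_3 (fun i j k => phi_sum i j k == phii i j k).
Proof. by vm_compute. Qed.

(** Zero entries of phi are skipped, so that only 42 of the 343 triples require a Levi-Civita
    symbol. The factor 6 is the 3! in the definition of the Hodge star. *)
Lemma star_phi_sum : all7_4 (fun a b c d =>
  sumi7 (fun i => sumi7 (fun j => sumi7 (fun k =>
    if phii i j k == 0 then 0 else muli (phii i j k) (lci 7 [:: i; j; k; a; b; c; d]))))
  == muli 6 (psii a b c d)).
Proof. by vm_compute. Qed.

Definition wedge_sum (m n : nat) (L : seq nat) : int :=
  alti_sum 4 (fun T => muli
    (phii m (nth 0%N L (nth 0%N T 0)) (nth 0%N L (nth 0%N T 1)))
    (phii n (nth 0%N L (nth 0%N T 2)) (nth 0%N L (nth 0%N T 3)))).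
Definition metric_entry (m n : nat) (K : seq nat) : int :=
  if phii (nth 0%N K 4) (nth 0%N K 5) (nth 0%N K 6) == 0 then 0 else
  muli (wedge_sum m n (take 4 K)) (phii (nth 0%N K 4) (nth 0%N K 5) (nth 0%N K 6)).
(** 3456 = 6 * 4 * 144: the 6 in the definition of the metric, and the normalisations 2! 2! and 4!
    3! of the two wedge products. *)
Lemma metric_sum : all7_2 (fun m n => alti_sum 7 (metric_entry m n) == muli 3456 (deltai m n)).
Proof. by vm_compute. Qed.

Section Phi0.
Variable R : realType.
Local Notation E := 'rV[R]_7.

Lemma e3_sumE a b c (i j k : 'I_7) : e3 R a b c [tuple i; j; k] = ir R (e3_sum a b c i j k).
Proof.
apply: (@det_perm_sum _ 3 (fun r q => deltai (nth 0%N [:: i : nat; j : nat; k : nat] r).+1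
   (nth 0%N [:: a; b; c] q))) => r q.
rewrite mxE (tnth_nth ord0) /ir /deltai.
have -> : val (nth ord0 [tuple i; j; k] r) = nth 0%N [:: i : nat; j : nat; k : nat] r.
  by case: r => [[|[|[|]]]].
by case: eqP.
Qed.

Lemma phi0_ph (i j k : 'I_7) : phi0 R [tuple i; j; k] = ph R i j k.
Proof.
by rewrite /phi0 !e3_sumE /ph -(eqP (all7_3P phi_sumP i j k)) /phi_sum !(irD, irN).
Qed.

Lemma levi_civita_lci (s : seq 'I_7) : size s = 7 -> levi_civita R s = ir R (lci 7 [seq val i | i <- s]).
Proof.
move=> sz; rewrite -det_lci ?size_map //; congr (\det _); apply/matrixP => r q.
by rewrite !mxE (nth_map ord0) ?sz // val_eqE.
Qed.

Lemma star_phi0 (a b c d : 'I_7) :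
  star 4 1%:M 1 (phi0 R) [tuple a; b; c; d] = ps R a b c d.
Proof.
rewrite /star big_tuple3.
transitivity (6%:R^-1 * (ir R (muli 6 (psii a b c d)))); last first.
  by rewrite irM mulKf // pnatr_eq0.
rewrite -(eqP (all7_4P star_phi_sum a b c d)) -ir_sum3; congr (_ * _).
apply: eq_bigr => i _; apply: eq_bigr => j _; apply: eq_bigr => k _.
have -> : levi_civita R ([tuple i; j; k] ++ [tuple a; b; c; d]) =
  ir R (lci 7 [:: i : nat; j : nat; k : nat; a : nat; b : nat; c : nat; d : nat]).
  by rewrite levi_civita_lci.
rewrite /raise invmx1 pullback1 phi0_ph mul1r /ph.
have [->|_] := eqVneq (phii i j k) 0; first by rewrite /ir mulr0z mul0r.
by rewrite irM.
Qed.

Lemma mktuple2 (T : Type) (F : 'I_2 -> T) :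
  [tuple F r | r < 2] = [tuple F ord0; F ord_max].
Proof.
apply: eq_from_tnth => r; rewrite tnth_mktuple (tnth_nth (F r)) /=.
by case: r => [[|[|]]] //= h; congr F; apply: val_inj.
Qed.
Lemma mktuple3 (T : Type) (F : 'I_3 -> T) :
  [tuple F r | r < 3] = [tuple F ord0; F (lift ord0 ord0); F ord_max].
Proof.
apply: eq_from_tnth => r; rewrite tnth_mktuple (tnth_nth (F r)) /=.
by case: r => [[|[|[|]]]] //= h; congr F; apply: val_inj.
Qed.
Lemma nth_perm_enum n (s : 'S_n) (j : 'I_n) : nth 0%N [seq val (s i) | i <- enum 'I_n] j = s j.
Proof. by rewrite (nth_map j) ?size_enum_ord // nth_ord_enum. Qed.
Lemma nth_val_tuple n (I : n.-tuple 'I_7) (j : 'I_n) : nth 0%N [seq val i | i <- I] j = tnth I j.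
Proof. by rewrite (nth_map ord0) ?size_tuple // -tnth_nth. Qed.

Lemma metric_phi0 (u v : E) :
  wedge (wedge (iprod u (phi0 R)) (iprod v (phi0 R))) (phi0 R) (ord_tuple 7)
  = 6%:R * (u *m v^T) 0 0.
Proof.
pose iw (m n : 'I_7) (L : seq nat) : R := ir R (wedge_sum m n L).
have hw (I : 4.-tuple 'I_7) : wedge (iprod u (phi0 R)) (iprod v (phi0 R)) I =
   4%:R^-1 * \sum_m \sum_n u 0 m * v 0 n * iw m n [seq val i | i <- I].
  rewrite /wedge; congr (_ * _).
  transitivity (\sum_m \sum_n \sum_(s : 'S_4) u 0 m * v 0 n * ((-1) ^+ s *
     ir R (muli (phii m (tnth I (s (lshift 2 (ord0 : 'I_2)))) (tnth I (s (lshift 2 (ord_max : 'I_2)))))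
     (phii n (tnth I (s (rshift 2 (ord0 : 'I_2)))) (tnth I (s (rshift 2 (ord_max : 'I_2)))))))).
    under [RHS]eq_bigr do rewrite exchange_big.
    rewrite [RHS]exchange_big; apply: eq_bigr => s _ /=.
    rewrite /iprod -mulrA mulr_suml mulr_sumr; apply: eq_bigr => m _.
    rewrite !mulr_sumr; apply: eq_bigr => n _; rewrite irM !mktuple2.
    have tc (m' a b : 'I_7) : tcons m' [tuple a; b] = [tuple m'; a; b] by apply: val_inj.
    rewrite !tc !phi0_ph /ph.
    have h5 (s' a p b q : R) : s' * (a * p * (b * q)) = a * b * (s' * (p * q)) by ring.
    exact: h5.
  apply: eq_bigr => m _; apply: eq_bigr => n _; rewrite -mulr_sumr; congr (_ * _).
  rewrite /iw /wedge_sum -perm_sum; apply: eq_bigr => s _; congr (_ * ir R _).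
  have e (j : 'I_4) k : j = k :> nat ->
     nth 0%N [seq val i | i <- I] (nth 0%N [seq val (s i) | i <- enum 'I_4] k) = tnth I (s j).
    by move=> <-; rewrite nth_perm_enum nth_val_tuple.
  by rewrite (e (lshift 2 (ord0 : 'I_2))) // (e (lshift 2 (ord_max : 'I_2))) //
    (e (rshift 2 (ord0 : 'I_2))) // (e (rshift 2 (ord_max : 'I_2))).
rewrite {1}/wedge.
transitivity ((4`! * 3`!)%N%:R^-1 * (4%:R^-1 * \sum_m \sum_n u 0 m * v 0 n *
  \sum_(s : 'S_7) (-1) ^+ s * ir R (metric_entry m n [seq val (s i) | i <- enum 'I_7]))).
  congr (_ * _); rewrite mulr_sumr.
  under [RHS]eq_bigr do rewrite mulr_sumr.
  under [RHS]eq_bigr do (under eq_bigr do rewrite !mulr_sumr; rewrite exchange_big).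
  rewrite [RHS]exchange_big; apply: eq_bigr => s _ /=.
  have -> : [tuple tnth (ord_tuple 7) (s (rshift 4 r)) | r < 3] =
    [tuple s (rshift 4 (ord0 : 'I_3)); s (rshift 4 (lift ord0 ord0 : 'I_3)); s (rshift 4 (ord_max : 'I_3))].
    by rewrite mktuple3 !tnth_ord_tuple.
  rewrite phi0_ph hw !mulr_sumr mulr_suml; apply: eq_bigr => m _.
  rewrite !mulr_sumr mulr_suml; apply: eq_bigr => n _.
  have e (j : 'I_7) k : j = k :> nat -> nth 0%N [seq val (s i) | i <- enum 'I_7] k = s j.
    by move=> <-; rewrite nth_perm_enum.
  have -> : [seq val i | i <- [tuple tnth (ord_tuple 7) (s (lshift 3 r)) | r < 4]] =
     take 4 [seq val (s i) | i <- enum 'I_7].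
    apply: (@eq_from_nth _ 0%N) => [|j]; rewrite size_map size_tuple.
      by rewrite size_takel // size_map size_enum_ord.
    move=> hj; have := nth_val_tuple [tuple tnth (ord_tuple 7) (s (lshift 3 r)) | r < 4] (Ordinal hj).
    move=> /= ->; rewrite tnth_mktuple tnth_ord_tuple nth_take //.
    exact: esym (nth_perm_enum s (lshift 3 (Ordinal hj))).
  have h5 (s' c a b p q : R) : s' * (c * (a * b * q)) * p = c * (a * b * (s' * (q * p))) by ring.
  rewrite h5 /iw /ph /metric_entry (e (rshift 4 (ord0 : 'I_3))) // (e (rshift 4 (lift ord0 ord0 : 'I_3))) //
    (e (rshift 4 (ord_max : 'I_3))) //; congr (_ * (_ * (_ * _))).
  set c := phii (s _) _ _; have [->|_] := eqVneq c 0; first by rewrite /ir mulr0z mulr0.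
  by rewrite irM.
under eq_bigr do under eq_bigr do rewrite perm_sum.
have E (m n : 'I_7) : ir R (alti_sum 7 (metric_entry m n)) = 3456%:R * dl R m n.
  by rewrite (eqP (all7_2P metric_sum m n)) irM irdl.
under eq_bigr do under eq_bigr do rewrite E.
have -> : (4`! * 3`!)%N = 144 by [].
rewrite mxE !mulr_sumr; apply: eq_bigr => m _.
under eq_bigr do rewrite mulrA; rewrite sum_dl' [v^T _ _]mxE.
by move: (u 0 m) (v 0 m) => a b; field.
Qed.
End Phi0.

(** * Existence and uniqueness of the metric of a G2 form *)

Section G2Metric.
Variable R : realType.
Local Notation E := 'rV[R]_7.

Definition Bform (w : cotensor R 3) (u v : E) : R :=
  6%:R^-1 * wedge (wedge (iprod u w) (iprod v w)) w (ord_tuple 7).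

Lemma eq_wedge k m (w w' : cotensor R k) (z z' : cotensor R m) I :
  (forall J, w J = w' J) -> (forall J, z J = z' J) -> wedge w z I = wedge w' z' I.
Proof. by move=> hw hz; congr (_ * _); apply: eq_bigr => s _; rewrite hw hz. Qed.

Lemma Bform_pullback (A : 'M[R]_7) u v :
  Bform (pullback A (@phi0 R)) u v = (u *m (A *m A^T) *m v^T) 0 0 * \det A.
Proof.
rewrite /Bform.
rewrite (@eq_wedge _ _ _ (pullback A (wedge (iprod (u *m A) (@phi0 R)) (iprod (v *m A) (@phi0 R))))
  _ (pullback A (@phi0 R))) //; last first.
  move=> J; rewrite -wedge_pullback; apply: eq_wedge => K; exact: iprod_pullback.
rewrite wedge_pullback pullback_alternating7; last exact: (@wedge_alternating R 4 3).
rewrite metric_phi0 trmx_mul !mulmxA; set c := (_ *m _) 0 0.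
by field.
Qed.

Lemma expr9_lt (x y : R) : x < y -> x ^+ 9 < y ^+ 9.
Proof.
move=> xy; have N (z : R) : (- z) ^+ 9 = - z ^+ 9 by rewrite exprNn -signr_odd expr1 mulN1r.
have [x0|x0] := leP 0 x.
  by rewrite ltr_pXn2r // nnegrE // ltW // (le_lt_trans x0 xy).
have [y0|y0] := ltP 0 y.
  by apply: (@lt_trans _ _ 0); [rewrite exprn_odd_lt0 | rewrite exprn_gt0].
by rewrite -ltrN2 -!N ltr_pXn2r ?ltrN2 // nnegrE oppr_ge0 // ltW.
Qed.

Lemma expr9_inj (x y : R) : x ^+ 9 = y ^+ 9 -> x = y.
Proof.
move=> e; have [/expr9_lt|/expr9_lt|//] := ltgtP x y; by rewrite e ltxx.
Qed.

(** The form determines the matrix nu g. Its determinant is nu^7 nu^2 = nu^9, and ninth powers are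
    injective on the reals, so nu is determined and then g. This makes the chosen pair computable
    from any frame. *)
Lemma metric_volume_unique (w : cotensor R 3) (gn gn' : 'M[R]_7 * R) :
  metric_volume w gn -> metric_volume w gn' -> gn = gn'.
Proof.
case: gn gn' => [g n] [g' n'] [/= gs gp gd gB] [/= gs' gp' gd' gB'].
have entry (G : 'M[R]_7) i j : ((delta_mx 0 i : E) *m G *m (delta_mx 0 j : E)^T) 0 0 = G i j.
  by rewrite trmx_delta -colE -rowE !mxE.
have e : n *: g = n' *: g'.
  apply/matrixP => i j; rewrite !mxE [LHS]mulrC [RHS]mulrC -!entry.
  exact: etrans (gB _ _) (esym (gB' _ _)).
have := congr1 (fun G : 'M[R]_7 => \det G) e; rewrite !detZ -gd -gd' -!exprD => e9.
have nn : n = n' by apply: expr9_inj.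
subst n'; have n0 : n != 0.
  apply/eqP => n0; move: gd; rewrite n0 expr0n /= => /esym/eqP/det0P[v v0 vg].
  by have := gp v v0; rewrite vg mul0mx mxE ltxx.
congr (_, _); apply/matrixP => i j; apply: (mulfI n0).
by have := congr1 (fun G : 'M[R]_7 => G i j) e; rewrite !mxE.
Qed.

Lemma metric_volume_pullback (u : 'M[R]_7) : u \in unitmx ->
  metric_volume (pullback u (@phi0 R)) (u *m u^T, \det u).
Proof.
move=> uu; split => /=.
- by rewrite trmx_mul trmxK.
- move=> v v0; rewrite mulmxA -mulmxA -trmx_mul; set w := v *m u.
  have w0 : w != 0.
    by apply: contra v0 => /eqP e; rewrite -[v](mulmxK uu) -/w e mul0mx.
  rewrite mxE; under eq_bigr do rewrite [w^T _ _]mxE -expr2.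
  have h (i : 'I_7) : true -> 0 <= w 0 i ^+ 2 by rewrite sqr_ge0.
  rewrite lt_neqAle sumr_ge0 // andbT eq_sym psumr_eq0 //.
  apply: contra w0 => /allP h0; apply/eqP/rowP => i.
  by have := h0 i (mem_index_enum i); rewrite /= sqrf_eq0 => /eqP ->; rewrite mxE.
- by rewrite det_mulmx det_tr expr2.
- by move=> v w; rewrite -Bform_pullback.
Qed.

Lemma g2_metric_volumeE (w : cotensor R 3) gn : metric_volume w gn -> g2_metric_volume w = gn.
Proof.
move=> h; rewrite /g2_metric_volume; case: xgetP => [gn' _ h'|/(_ gn) []//].
exact: metric_volume_unique h' h.
Qed.
End G2Metric.

(** * Smooth dependence of the metric and volume on phi *)

Section SmoothClosure.
Local Open Scope classical_set_scope.
Local Open Scope ring_scope.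
Variables (R : realType) (U : set 'rV[R]_7).
Local Notation E := 'rV[R]_7.

Lemma smoothc_sum (I : Type) (r : seq I) (P : pred I) (f : I -> E -> R) :
  (forall i, smoothc U (f i)) -> smoothc U (fun x => \sum_(i <- r | P i) f i x).
Proof.
move=> sf; elim: r => [|i r ih].
  by apply: (@Smoothc_ext _ _ (fun=> 0)) (Smoothc_cst _ 0) => x _; rewrite big_nil.
have [Pi|nPi] := boolP (P i); last first.
  by apply: Smoothc_ext ih => x _; rewrite big_cons (negbTE nPi).
by apply: (Smoothc_ext _ (Smoothc_add (sf i) ih)) => x _; rewrite big_cons Pi.
Qed.

Lemma smoothc_prod (I : Type) (r : seq I) (f : I -> E -> R) :
  (forall i, smoothc U (f i)) -> smoothc U (fun x => \prod_(i <- r) f i x).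
Proof.
move=> sf; elim: r => [|i r ih].
  by apply: (@Smoothc_ext _ _ (fun=> 1)) (Smoothc_cst _ 1) => x _; rewrite big_nil.
by apply: (Smoothc_ext _ (Smoothc_mul (sf i) ih)) => x _; rewrite big_cons.
Qed.

Lemma smoothc_scale c (f : E -> R) : smoothc U f -> smoothc U (fun x => c * f x).
Proof. exact: Smoothc_mul (Smoothc_cst _ c). Qed.

Lemma smoothc_det n (B : E -> 'M[R]_n) :
  (forall i j, smoothc U (fun x => B x i j)) -> smoothc U (fun x => \det (B x)).
Proof.
by move=> sB; apply: smoothc_sum => s; apply: smoothc_scale; apply: smoothc_prod.
Qed.

Lemma smoothc_iprod k v (w : E -> cotensor R k.+1) I :
  (forall I, smoothc U (fun x => w x I)) -> smoothc U (fun x => iprod v (w x) I).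
Proof. by move=> sw; apply: smoothc_sum => m; apply: smoothc_scale. Qed.

Lemma smoothc_wedge k m (w : E -> cotensor R k) (z : E -> cotensor R m) I :
  (forall I, smoothc U (fun x => w x I)) -> (forall I, smoothc U (fun x => z x I)) ->
  smoothc U (fun x => wedge (w x) (z x) I).
Proof.
move=> sw sz; apply: smoothc_scale; apply: smoothc_sum => s.
by apply: Smoothc_mul => //; apply: smoothc_scale.
Qed.

Lemma smoothc_Bform (w : E -> cotensor R 3) u v :
  (forall I, smoothc U (fun x => w x I)) -> smoothc U (fun x => Bform (w x) u v).
Proof.
move=> sw; apply: smoothc_scale; apply: smoothc_wedge => // I.
by apply: smoothc_wedge => // J; apply: smoothc_iprod.
Qed.

Variable phi : E -> cotensor R 3.
Hypothesis phi_smooth : forall I, smooth_on U (fun x => phi x I).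
Hypothesis phi_G2 : forall x, U x -> exists2 u : 'M[R]_7, u \in unitmx & phi x = pullback u (@phi0 R).

Let phi_smoothc I : smoothc U (fun x => phi x I). Proof. exact: Smoothc_smooth. Qed.

Lemma g2_frame x : U x -> exists2 u : 'M[R]_7, u \in unitmx &
  [/\ phi x = pullback u (@phi0 R), gmet phi x = u *m u^T & gvol phi x = \det u].
Proof.
move=> /phi_G2[u uu e]; exists u => //; split => //.
  by rewrite /gmet /g2_metric e (g2_metric_volumeE (metric_volume_pullback uu)).
by rewrite /gvol /g2_volume e (g2_metric_volumeE (metric_volume_pullback uu)).
Qed.

Let b x : 'M[R]_7 := \matrix_(i, j) Bform (phi x) (delta_mx 0 i) (delta_mx 0 j).

Lemma b_metric x : U x -> b x = gvol phi x *: gmet phi x.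
Proof.
move=> /g2_frame[u uu [e -> ->]]; apply/matrixP => i j.
rewrite !mxE e Bform_pullback mulrC; congr (_ * _).
have entry (G : 'M[R]_7) : ((delta_mx 0 i : E) *m G *m (delta_mx 0 j : E)^T) 0 0 = G i j.
  by rewrite trmx_delta -colE -rowE !mxE.
by rewrite entry mxE.
Qed.

Lemma gvol_neq0 x : U x -> gvol phi x != 0.
Proof. by move=> /g2_frame[u uu [_ _ ->]]; move: uu; rewrite unitmxE unitfE. Qed.

Lemma det_gmet x : U x -> \det (gmet phi x) = gvol phi x ^+ 2.
Proof. by move=> /g2_frame[u uu [_ -> ->]]; rewrite det_mulmx det_tr expr2. Qed.

(* With b = vol g, det b = vol^9, hence vol = det b * (det b ^ 2) `^ (- 4 / 9). *)
Lemma smoothc_gvol : smoothc U (gvol phi).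
Proof.
have db x : U x -> \det (b x) = gvol phi x ^+ 9.
  by move=> Ux; rewrite b_metric // detZ det_gmet // -exprD.
apply: (@Smoothc_ext _ _ (fun x => \det (b x) * (\det (b x) * \det (b x)) `^ (- 4%:R / 9%:R))).
  move=> x Ux; rewrite db //; have n0 := gvol_neq0 Ux; set n := gvol phi x in n0 *.
  have n2 : 0 < n ^+ 2 by rewrite exprn_even_gt0.
  have -> : n ^+ 9 * n ^+ 9 = (n ^+ 2) `^ 9%:R by rewrite powR_mulrn ?ltW // -!exprM -exprD.
  rewrite -powRrM (_ : 9%:R * (- 4%:R / 9%:R) = - 4%:R); last by field.
  rewrite powRN powR_mulrn ?ltW // -exprM -[n ^+ 9]/(n ^+ (1 + 8)) exprD expr1.
  by rewrite mulfK // expf_neq0.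
have sb : smoothc U (fun x => \det (b x)).
  apply: smoothc_det => i j; apply: Smoothc_ext (smoothc_Bform (delta_mx 0 i) (delta_mx 0 j) phi_smoothc).
  by move=> x _; rewrite mxE.
apply: Smoothc_mul => //; apply: Smoothc_powR; last exact: Smoothc_mul.
move=> x Ux; rewrite -expr2 exprn_even_gt0 //= db // expf_neq0 //; exact: gvol_neq0.
Qed.

(** vol is negative in a chart of the opposite orientation, so the inverse is taken of its square,
    as a power with exponent - 1. *)
Lemma smoothc_gvol2V : smoothc U (fun x => (gvol phi x ^+ 2)^-1).
Proof.
apply: (@Smoothc_ext _ _ (fun x => (gvol phi x * gvol phi x) `^ (- 1))).
  by move=> x Ux; rewrite -expr2 powR_inv1 // sqr_ge0.
apply: Smoothc_powR; last exact: Smoothc_mul smoothc_gvol smoothc_gvol.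
by move=> x Ux; rewrite -expr2 exprn_even_gt0 //= gvol_neq0.
Qed.

Lemma smoothc_gmet i j : smoothc U (fun x => gmet phi x i j).
Proof.
apply: (@Smoothc_ext _ _ (fun x => Bform (phi x) (delta_mx 0 i) (delta_mx 0 j) *
   (gvol phi x * (gvol phi x ^+ 2)^-1))).
  move=> x Ux; have := congr1 (fun G : 'M[R]_7 => G i j) (b_metric Ux); rewrite !mxE => ->.
  by have n0 := gvol_neq0 Ux; move: (gvol phi x) n0 (gmet phi x i j) => n n0 y; field.
apply: Smoothc_mul; first exact: smoothc_Bform.
exact: Smoothc_mul smoothc_gvol smoothc_gvol2V.
Qed.

Lemma gmet_unit x : U x -> gmet phi x \in unitmx.
Proof. by move=> Ux; rewrite unitmxE det_gmet // unitfE expf_neq0 // gvol_neq0. Qed.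

Lemma smoothc_ginv i j : smoothc U (fun x => invmx (gmet phi x) i j).
Proof.
apply: (@Smoothc_ext _ _ (fun x => (gvol phi x ^+ 2)^-1 * cofactor (gmet phi x) j i)).
  by move=> x Ux; rewrite /invmx gmet_unit // !mxE det_gmet.
apply: Smoothc_mul; first exact: smoothc_gvol2V.
apply: smoothc_scale; apply: smoothc_det => k l.
apply: Smoothc_ext (smoothc_gmet (lift j k) (lift i l)) => x _; by rewrite !mxE.
Qed.

End SmoothClosure.

(** * The codifferential as a divergence *)

Section EpsilonContraction.
Variable R : realType.
Local Notation lc := (@levi_civita R).

Lemma det_perm_cat N n k (d : 'I_N) (I : n.-tuple 'I_N) (J : seq 'I_N) (s : 'S_n) :
  (n + k)%N = N -> size J = k ->
  \det (\matrix_(r < N, q < N) (nth d ([tuple tnth I (s r) | r < n] ++ J) r == q)%:R : 'M[R]_N)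
  = (-1) ^+ s * \det (\matrix_(r < N, q < N) (nth d (I ++ J) r == q)%:R : 'M[R]_N).
Proof.
move=> e szJ; subst N; set M' := (X in \det X = _); set M := (X in _ = _ * \det X).
have -> : M' = block_mx (perm_mx s) 0 0 1%:M *m M.
  rewrite -[M]vsubmxK mul_block_col !mul0mx mul1mx add0r addr0 -row_permE.
  rewrite -[LHS]vsubmxK; congr col_mx; apply/matrixP => r q; rewrite !mxE.
    have mk (F : 'I_n -> 'I_(n + k)) (r' : 'I_n) : nth d [tuple F r | r < n] r' = F r'.
      by rewrite -tnth_nth tnth_mktuple.
    have vl (r' : 'I_n) : nat_of_ord (lshift k r') = r' by [].
    by rewrite !vl !nth_cat !size_tuple !ltn_ord mk (tnth_nth d).
  have vr : nat_of_ord (rshift n r) = (n + r)%N by [].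
  by rewrite !vr !nth_cat !size_tuple ltnNge leq_addr.
by rewrite det_mulmx det_ublock det1 mulr1 det_perm.
Qed.

Lemma lc_perm n k (I : n.-tuple 'I_7) (J : seq 'I_7) (s : 'S_n) :
  (n + k)%N = 7%N -> size J = k -> lc ([tuple tnth I (s r) | r < n] ++ J) = (-1) ^+ s * lc (I ++ J).
Proof. exact: det_perm_cat. Qed.

Lemma lc_not_uniq (s : seq 'I_7) : size s = 7%N -> ~~ uniq s -> lc s = 0.
Proof. by move=> /eqP sz; exact: (@levi_civita_noninj R (Tuple sz)). Qed.

Lemma lc_sqr (s : seq 'I_7) : size s = 7%N -> lc s * lc s = (uniq s)%:R.
Proof.
move=> /eqP sz; have [us|us] := boolP (uniq s); last first.
  by rewrite lc_not_uniq ?mul0r //; apply/eqP.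
have [p e] := @uniq_tuple_perm (Tuple sz) us.
have -> : lc s = (-1) ^+ p by rewrite -(levi_civita_perm R p) -e.
by rewrite -signr_addb addbb.
Qed.

Lemma lc_move (s0 s1 s2 : seq 'I_7) (a : 'I_7) : size (s0 ++ a :: s1 ++ s2) = 7%N ->
  lc (s0 ++ s1 ++ a :: s2) = (-1) ^+ size s1 * lc (s0 ++ a :: s1 ++ s2).
Proof.
have swap (t0 t2 : seq 'I_7) (b c : 'I_7) : size (t0 ++ b :: c :: t2) = 7%N ->
    lc (t0 ++ b :: c :: t2) = - lc (t0 ++ c :: b :: t2).
  move=> sz; have szL : size (t0 ++ c :: b :: t2) == 7%N.
    by apply/eqP; rewrite -[RHS]sz !size_cat.
  have h0 : (size t0 < 7)%N by move: sz; rewrite size_cat /=; lia.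
  have h1 : ((size t0).+1 < 7)%N by move: sz; rewrite size_cat /=; lia.
  pose L : 7.-tuple 'I_7 := Tuple szL.
  pose i := Ordinal h0; pose j := Ordinal h1.
  have := lc_perm L (tperm i j) (k := 0) erefl (erefl : size [::] = 0%N).
  rewrite odd_tperm -val_eqE /= neq_ltn ltnSn /= expr1 mulN1r !cats0 => <-.
  congr (lc _); apply: (@eq_from_nth _ ord0); first by rewrite sz size_map size_enum_ord.
  rewrite sz => q hq; rewrite (nth_map (Ordinal hq)) ?size_enum_ord //.
  rewrite (nth_ord_enum (Ordinal hq) (Ordinal hq)) (tnth_nth ord0) /=.
  case: tpermP => [[e]|[e]|/eqP ni /eqP nj] /=; rewrite ?e.
  - by rewrite !nth_cat ltnn subnn ltnNge leqnSn /= subSnn.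
  - by rewrite !nth_cat ltnn subnn ltnNge leqnSn /= subSnn.
  - rewrite !nth_cat; case: ltnP => // hle; rewrite -!val_eqE /= in ni nj.
    case hd : (q - size t0)%N => [|[|m]] //.
      by move: ni; rewrite eqn_leq hle andbT -subn_eq0 hd.
    by move: nj; rewrite -(subnKC hle) hd addn1 eqxx.
elim: s1 s0 => [|b s1 ih] s0 sz; first by rewrite mul1r.
have sz' : size (rcons s0 b ++ a :: s1 ++ s2) = 7%N.
  by move: sz; rewrite !size_cat size_rcons /= !size_cat /=; lia.
rewrite /= -cat_rcons ih // cat_rcons swap; last by rewrite -cat_rcons.
by rewrite /= exprS mulN1r mulrN mulNr.
Qed.

(** For K complementary to I0, the surviving I are the n! rearrangements of I0, and the signs of W
    and of the Levi-Civita symbol cancel; there are k! such K. If I0 has a repeated index both sides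
    vanish. *)
Lemma contraction_alternating n k (W : cotensor R n) (I0 : n.-tuple 'I_7) :
  (n + k)%N = 7%N -> alternating W ->
  \sum_(I : n.-tuple 'I_7) \sum_(K : k.-tuple 'I_7) W I * lc (I ++ K) * lc (I0 ++ K)
  = (n`! * k`!)%N%:R * W I0.
Proof.
move=> e alt; have szc (I : n.-tuple 'I_7) (K : k.-tuple 'I_7) : size (I ++ K) = 7%N.
  by rewrite size_cat !size_tuple.
have cardK (m : nat) (s : seq 'I_7) : uniq s -> (size s + m)%N = 7%N ->
    #|[set t : m.-tuple 'I_7 | uniq (s ++ t)]| = m`!.
  move=> us em; rewrite -ffactnn.
  have cs : #|[pred x | x \notin s]| = m.
    have h := cardC (mem s); rewrite card_ord (card_uniqP us) in h.
    by apply: (@addnI (size s)); exact: etrans h (esym em).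
  transitivity (#|[pred x | x \notin s]| ^_ m); last by rewrite cs.
  rewrite -card_uniq_tuples; apply: eq_card => t.
  rewrite !inE cat_uniq us /= -all_predC; congr (_ && _).
have [u0|nu0] := boolP (uniq I0); last first.
  rewrite big1 => [|I _]; last first.
    rewrite big1 // => K _; rewrite (@lc_not_uniq (I0 ++ K)) ?mulr0 //.
    by rewrite cat_uniq (negbTE nu0).
  suff -> : W I0 = 0 by rewrite mulr0.
  have /injectivePn[i [j ij eij]] : ~~ injectiveb (tnth I0).
    apply: contra nu0 => /injectiveP inj; rewrite -[tval I0]map_tnth_enum map_inj_uniq ?enum_uniq //.
  have := alt (tperm i j) I0; rewrite odd_tperm ij expr1 mulN1r.
  have -> : tperm_idx (tperm i j) I0 = I0; last by lra.
  by apply: eq_from_tnth => r; rewrite tnth_mktuple; case: tpermP => // ->.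
rewrite exchange_big /=.
have inner (K : k.-tuple 'I_7) : \sum_(I : n.-tuple 'I_7) W I * lc (I ++ K) * lc (I0 ++ K)
   = n`!%:R * W I0 * (uniq (I0 ++ K))%:R.
  have [u1|nu1] := boolP (uniq (I0 ++ K)); last first.
    by rewrite mulr0 big1 // => I _; rewrite (lc_not_uniq (szc I0 K) nu1) mulr0.
  rewrite mulr1 (bigID (fun I : n.-tuple 'I_7 => uniq (I ++ K))) /= [X in _ + X]big1 ?addr0; last first.
    by move=> I nu; rewrite (lc_not_uniq (szc I K) nu) mulr0 mul0r.
  transitivity (\sum_(I : n.-tuple 'I_7 | uniq (I ++ K)) W I0).
    apply: eq_bigr => I uI.
    have pe : perm_eq I I0.
      apply: uniq_perm => //; first by move: uI; rewrite cat_uniq => /and3P[].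
      have full (J : n.-tuple 'I_7) : uniq (J ++ K) -> forall x, (x \in J) = (x \notin K).
        move=> uJ x; have xin : x \in J ++ K.
          have sub : {subset J ++ K <= enum 'I_7} by move=> y _; rewrite mem_enum.
          have sz : (size (enum 'I_7) <= size (J ++ K))%N by rewrite size_enum_ord szc.
          by have [_ ->] := uniq_min_size uJ sub sz; rewrite mem_enum.
        move: uJ xin; rewrite cat_uniq mem_cat => /and3P[_ /hasPn hK _].
        have [xK _|xK] := boolP (x \in K); last by rewrite orbF.
        by apply/negbTE; have := hK x xK.
      by move=> x; rewrite !full.
    have /tuple_permP[s es] := pe.
    have -> : I = tperm_idx s I0 by apply: val_inj; exact: es.
    rewrite alt (lc_perm I0 s e (size_tuple K)).
    have hs : (-1) ^+ s * (-1) ^+ s = 1 :> R by rewrite -signr_addb addbb.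
    have hl : lc (I0 ++ K) * lc (I0 ++ K) = 1 by rewrite lc_sqr // u1.
    have h5 (a w l : R) : a * w * (a * l) * l = (a * a) * (l * l) * w by ring.
    by rewrite h5 hs hl !mul1r.
  rewrite sumr_const mulr_natl; congr (_ *+ _).
  have uK : uniq K by move: u1; rewrite cat_uniq => /and3P[].
  rewrite -(cardK n K uK); last by rewrite size_tuple addnC.
  by apply: eq_card => I; rewrite !inE uniq_catC.
under eq_bigr do rewrite inner; rewrite -mulr_sumr.
have -> : \sum_(K : k.-tuple 'I_7) (uniq (I0 ++ K))%:R = k`!%:R :> R.
  rewrite -(cardK k I0 u0); last by rewrite size_tuple.
  rewrite -sum1_card natr_sum [RHS]big_mkcond /=; apply: eq_bigr => K _.
  by rewrite inE; case: (uniq _).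
by rewrite natrM mulrAC.
Qed.

Lemma lc_move_block (a : 'I_7) (K J : seq 'I_7) : size (a :: J ++ K) = 7%N ->
  lc (a :: K ++ J) = (-1) ^+ (size K * size J) * lc (a :: J ++ K).
Proof.
suff H (s0 J' : seq 'I_7) : size (s0 ++ J' ++ K) = 7%N ->
    lc (s0 ++ K ++ J') = (-1) ^+ (size K * size J') * lc (s0 ++ J' ++ K).
  exact: (H [:: a]).
elim: J' s0 => [|b J' ih] s0 sz; first by rewrite cats0 muln0 mul1r.
rewrite -[b :: J']/([:: b] ++ J') lc_move; last first.
  by move: sz; rewrite !size_cat /= !size_cat; lia.
rewrite -cat_rcons ih; last by move: sz; rewrite ?(size_cat, size_rcons) /= ?size_cat; lia.
by rewrite cat_rcons mulrA -exprD mulnS.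
Qed.

End EpsilonContraction.

Section Codifferential.
Variable R : realType.
Local Notation lc := (@levi_civita R).
Local Notation E := 'rV[R]_7.

Lemma lc_transfer n k (A : 'M[R]_7) (I : n.-tuple 'I_7) (J : k.-tuple 'I_7) : (n + k)%N = 7%N ->
  \det A * lc (I ++ J) = \sum_(I' : n.-tuple 'I_7) \sum_(J' : k.-tuple 'I_7)
    lc (I' ++ J') * ((\prod_l A (tnth I l) (tnth I' l)) * \prod_l A (tnth J l) (tnth J' l)).
Proof.
move=> e; have szK : size (I ++ J) == 7%N by rewrite size_cat !size_tuple e.
have := pullback_lct A (Tuple szK); rewrite /lct /= => <-.
rewrite /pullback; under [LHS]eq_bigr do rewrite prod_zip.
rewrite (big_tuple_cat (fun L => lc L * \prod_(p <- zip (I ++ J) L) A p.1 p.2) e).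
apply: eq_bigr => I' _; apply: eq_bigr => J' _.
by rewrite zip_cat ?size_tuple // big_cat /= -!prod_zip.
Qed.

Definition eps_contract n k (b : cotensor R n) : cotensor R k :=
  fun J => \sum_(I : n.-tuple 'I_7) b I * lc (I ++ J).

(** Instead of raising the argument one may lower the result: moving the inverse metric across the
    Levi-Civita symbol costs det g^-1 = nu^-2, which turns nu into nu^-1. The argument then enters
    without any metric. *)
Lemma star_lower n k (g : 'M[R]_7) (nu : R) (b : cotensor R n) J : (n + k)%N = 7%N ->
  g^T = g -> \det g = nu ^+ 2 -> nu != 0 ->
  star k g nu b J = (n`!%:R)^-1 * (nu^-1 * pullback g (eps_contract b) J).
Proof.
move=> e gs gd n0; congr (_ * _).
have gu : g \in unitmx by rewrite unitmxE gd unitfE expf_neq0.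
have hs : (invmx g)^T = invmx g by rewrite trmx_inv gs.
transitivity (nu * \sum_I b I * pullback (invmx g) (fun I => lc (I ++ J)) I).
  rewrite -[in RHS]hs -pullback_adjoint mulr_sumr; apply: eq_bigr => I _.
  by rewrite /raise mulrCA.
have tr (I : n.-tuple 'I_7) : pullback (invmx g) (fun I => lc (I ++ J)) I =
    (nu ^- 2) * \sum_(J' : k.-tuple 'I_7) lc (I ++ J') * \prod_l g (tnth J l) (tnth J' l).
  rewrite -gd -det_inv mulr_sumr.
  under [RHS]eq_bigr do rewrite mulrA lc_transfer // mulr_suml.
  rewrite [RHS]exchange_big; apply: eq_bigr => I' _ /=.
  transitivity (\prod_l invmx g (tnth I l) (tnth I' l) *
     pullback g (pullback (invmx g) (fun J' => lc (I' ++ J'))) J).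
    by rewrite pullback_comp mulmxV // pullback1 mulrC.
  rewrite mulr_sumr; apply: eq_bigr => J' _; rewrite {1}/pullback !mulr_suml mulr_sumr.
  have h4 (r1 r2 r3 r4 : R) : r1 * (r2 * r3 * r4) = r2 * (r1 * r3) * r4 by ring.
  by apply: eq_bigr => J'' _; exact: h4.
under eq_bigr do rewrite tr mulrCA; rewrite -mulr_sumr mulrA.
have -> : nu * nu ^- 2 = nu^-1 by field.
congr (_ * _); rewrite /pullback /eps_contract.
under [RHS]eq_bigr do rewrite mulr_suml; rewrite [RHS]exchange_big; apply: eq_bigr => I _ /=.
by rewrite mulr_sumr; apply: eq_bigr => J' _; rewrite mulrA.
Qed.

(** All m + 1 terms of the exterior derivative contribute equally once the differentiated index is
    moved to the front. *)
Lemma eps_contract_ext_d m k (s : E -> cotensor R m) x (J : k.-tuple 'I_7) : (m.+1 + k)%N = 7%N ->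
  eps_contract (ext_d s x) J = m.+1%:R *
    \sum_p \sum_(K : m.-tuple 'I_7) pd p (fun y => s y K) x * lc (p :: K ++ J).
Proof.
move=> e; rewrite /eps_contract /ext_d; under eq_bigr do rewrite mulr_suml.
rewrite exchange_big /=.
have term (r : 'I_m.+1) : \sum_(I : m.+1.-tuple 'I_7) (-1) ^+ r *
    pd (tnth I r) (fun y => s y [tuple tnth I (lift r l) | l < m]) x * lc (I ++ J) =
   \sum_p \sum_(K : m.-tuple 'I_7) pd p (fun y => s y K) x * lc (p :: K ++ J).
  (* The cycle that takes position r to the front. Its sign (-1)^r cancels the sign of the r-th term
     of [ext_d]. *)
  pose c : 'S_m.+1 := lift_perm r ord0 1.
  rewrite (reindex_onto (fun I : m.+1.-tuple 'I_7 => [tuple tnth I (c l) | l < m.+1])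
    (fun I => [tuple tnth I ((c^-1)%g l) | l < m.+1])) /=; last first.
    by move=> I _; apply: eq_from_tnth => l; rewrite !tnth_mktuple permK.
  rewrite (eq_bigl xpredT); last first.
    by move=> I; apply/eqP/eq_from_tnth => l; rewrite !tnth_mktuple permKV.
  rewrite big_tcons; apply: eq_bigr => p _; apply: eq_bigr => K _.
  have hc : lc ([tuple tnth (tcons p K) (c l) | l < m.+1] ++ J) = (-1) ^+ r * lc (p :: K ++ J).
    rewrite (lc_perm R (tcons p K) c e (size_tuple J)); congr (_ * _).
    by rewrite odd_lift_perm odd_perm1 addbF /= addbF signr_odd.
  rewrite hc tnth_mktuple lift_perm_id tnth0.
  have -> : [tuple tnth [tuple tnth (tcons p K) (c l) | l < m.+1] (lift r l) | l < m] = K.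
    by apply: eq_from_tnth => l; rewrite !tnth_mktuple lift_perm_lift perm1 tnthS.
  set u := pd _ _ _; set v := lc _.
  have h3 (r1 r2 r3 : R) : r1 * r2 * (r1 * r3) = (r1 * r1) * (r2 * r3) by ring.
  rewrite h3.
  by rewrite -signr_odd -signr_addb addbb mul1r.
under eq_bigr do rewrite term.
by rewrite sumr_const card_ord mulr_natl.
Qed.

Variables (U : set E) (Uo : open U) (g : E -> 'M[R]_7) (nu : E -> R).
Hypothesis g_sym : forall x, U x -> (g x)^T = g x.
Hypothesis g_det : forall x, U x -> \det (g x) = nu x ^+ 2.
Hypothesis nu_neq0 : forall x, U x -> nu x != 0.

Lemma pd_sum_scale (I : finType) (c : I -> R) (f : I -> E -> R) i x :
  (forall j, smoothc U (f j)) -> U x ->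
  pd i (fun y => \sum_j c j * f j y) x = \sum_j c j * pd i (f j) x.
Proof.
move=> sf Ux; pose a j := mk_sfun Uo (sf j).
have hr : reps (fun y => \sum_j c j * f j y) (\sum_j sfun_cst Uo (c j) * a j).
  by apply: reps_sum => j; apply: repsM; [exact: reps_cst | exact: reps_mk].
rewrite (reps_pd i hr Ux).
have ds : sfun_d i (\sum_j sfun_cst Uo (c j) * a j) = \sum_j sfun_cst Uo (c j) * sfun_d i (a j).
  have d0 : sfun_d i 0 = 0 :> smooth_fun Uo.
    by apply: (addrI (sfun_d i 0)); rewrite -sfun_dD !addr0.
  rewrite (big_morph _ (@sfun_dD _ _ Uo i) d0); apply: eq_bigr => j _.
  rewrite sfun_dM (_ : sfun_d i (sfun_cst Uo (c j)) = 0) ?mul0r ?add0r //.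
  apply: sfun_eq => y Uy; rewrite -(reps_pd i (reps_cst Uo (c j)) Uy) pd_cst.
  by rewrite -[RHS]/(ev Uy 0) rmorph0.
rewrite ds -[LHS]/(ev Ux _) rmorph_sum; apply: eq_bigr => j _; rewrite rmorphM.
congr (_ * _); first exact: (esym (reps_cst Uo (c j) Ux)).
exact: (esym (reps_pd i (reps_mk Uo (sf j)) Ux)).
Qed.

(** The formula d^* w = - nabla_p w^p in density form. The inner star is a constant-coefficient
    combination of the components nu w^I, so d differentiates just those; the outer star, in the
    form [star_lower], then contracts two Levi-Civita symbols. *)
Lemma codiffE k (w : E -> cotensor R k.+1) x J : (k <= 6)%N ->
  (forall I, smoothc U (fun y => nu y * raise (g y) (w y) I)) ->
  (forall y, U y -> alternating (raise (g y) (w y))) -> U x ->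
  codiff g nu w x J = - ((nu x)^-1 *
    pullback (g x) (fun J' => \sum_p pd p (fun y => nu y * raise (g y) (w y) (tcons p J')) x) J).
Proof.
move=> k6 sW altW Ux; set m := (6 - k)%N.
have e1 : (m.+1 + k)%N = 7%N by rewrite /m; lia.
have e2 : (k.+1 + m)%N = 7%N by rewrite /m; lia.
rewrite /codiff -/m (star_lower _ _ e1 (g_sym Ux) (g_det Ux) (nu_neq0 Ux)).
pose V p : cotensor R k.+1 := fun I => pd p (fun y => nu y * raise (g y) (w y) I) x.
have Valt p : alternating (V p).
  move=> s I; rewrite /V.
  transitivity (pd p (fun y => (-1) ^+ s * (nu y * raise (g y) (w y) I)) x).
    by apply: (pd_eqU Uo _ Ux) => y Uy; rewrite altW // mulrCA.
  transitivity (pd p (fun y => \sum_(j : 'I_1) (-1) ^+ s * (nu y * raise (g y) (w y) I)) x).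
    by apply: (pd_eqU Uo _ Ux) => y Uy; rewrite big_ord1.
  by rewrite (@pd_sum_scale _ (fun=> (-1) ^+ s) (fun=> fun y => nu y * raise (g y) (w y) I)) // big_ord1.
have E1 (J' : k.-tuple 'I_7) :
   eps_contract (ext_d (fun y => star m (g y) (nu y) (w y)) x) J' =
   m.+1`!%:R * (-1) ^+ (m * k) * \sum_p V p (tcons p J').
  rewrite (eps_contract_ext_d _ _ _ e1).
  have E2 p (K : m.-tuple 'I_7) : pd p (fun y => star m (g y) (nu y) (w y) K) x =
     (k.+1`!%:R)^-1 * \sum_I V p I * lc (I ++ K).
    rewrite mulr_sumr.
    under [RHS]eq_bigr do rewrite [V _ _ * _]mulrC mulrA.
    rewrite -(@pd_sum_scale _ (fun I : k.+1.-tuple 'I_7 => (k.+1`!%:R)^-1 * lc (I ++ K))) //.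
    apply: (pd_eqU Uo _ Ux) => y Uy; rewrite /star mulr_sumr; apply: eq_bigr => I _.
    have h4 (a b c e' : R) : a * (b * (c * e')) = a * e' * (c * b) by ring.
    exact: h4.
  transitivity (m.+1%:R * \sum_p ((k.+1`!%:R)^-1 * (-1) ^+ (m * k) *
      \sum_(K : m.-tuple 'I_7) \sum_I V p I * lc (I ++ K) * lc (tcons p J' ++ K))).
    congr (_ * _); apply: eq_bigr => p _; rewrite mulr_sumr; apply: eq_bigr => K _.
    rewrite E2 lc_move_block; last by rewrite /= size_cat !size_tuple; lia.
    rewrite (size_tuple K) (size_tuple J').
    rewrite [in RHS]mulr_sumr mulr_sumr mulr_suml; apply: eq_bigr => I _ /=.
    have h5 (a b c e' f : R) : a * (b * c) * (e' * f) = a * e' * (b * c * f) by ring.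
    exact: h5.
  rewrite [LHS]mulr_sumr [RHS]mulr_sumr; apply: eq_bigr => p _.
  rewrite exchange_big (contraction_alternating (tcons p J') e2 (Valt p)) natrM (factS m)
    [(m.+1 * m`!)%N%:R]natrM.
  have f0 : k.+1`!%:R != 0 :> R by rewrite pnatr_eq0 -lt0n fact_gt0.
  by move: (V p _) (m.+1%:R : R) (m`!%:R : R) (_ ^+ _) (k.+1`!%:R : R) f0 => v1 v0 v2 v3 v4 f0; field.
have pE : pullback (g x) (eps_contract (ext_d (fun y => star m (g y) (nu y) (w y)) x)) J =
  m.+1`!%:R * (-1) ^+ (m * k) * pullback (g x) (fun J' => \sum_p V p (tcons p J')) J.
  by rewrite /pullback mulr_sumr; apply: eq_bigr => J' _; rewrite E1 mulrA.
rewrite pE /V; set P := pullback _ _ _.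
have f0 : m.+1`!%:R != 0 :> R by rewrite pnatr_eq0 -lt0n fact_gt0.
(* As m = 6 - k, the exponent k + 1 + m k has the parity of 2 k + 1. The second sign comes from
   moving the block K past J' in the Levi-Civita symbol. *)
have sg : (-1) ^+ k.+1 * (-1) ^+ (m * k) = - 1 :> R.
  rewrite -exprD -signr_odd (_ : odd _ = true) //.
  by rewrite oddD oddM /= /m oddB //= ; case: (odd k).
transitivity (((-1) ^+ k.+1 * (-1) ^+ (m * k)) * ((nu x)^-1 * P)); last by rewrite sg mulN1r.
have n0 := nu_neq0 Ux.
move: (m.+1`!%:R) f0 (nu x) n0 P ((-1) ^+ k.+1) ((-1) ^+ (m * k)).
by move=> f f0 n n0 P s1 s2; field; rewrite n0 f0.
Qed.
End Codifferential.

(** * Derivative of the volume density *)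

Section Jacobi.
Variables (A : comPzRingType) (d : 'I_7 -> A -> A) (half : A).
Hypothesis dD : forall p x y, d p (x + y) = d p x + d p y.
Hypothesis dM : forall p x y, d p (x * y) = d p x * y + x * d p y.
Hypothesis halfP : half + half = 1.
Local Notation M7 := 'M[A]_7.

Lemma d_prod p (I : finType) (F : I -> A) :
  d p (\prod_i F i) = \sum_i d p (F i) * \prod_(j | j != i) F j.
Proof.
have H (r : seq I) : uniq r ->
    d p (\prod_(i <- r) F i) = \sum_(i <- r) d p (F i) * \prod_(j <- r | j != i) F j.
  elim: r => [|a r ih] /=; first by rewrite !big_nil (d1 dM).
  move=> /andP[ar ur]; rewrite !big_cons eqxx dM ih //=; congr (_ * _ + _).
    rewrite big_seq_cond [RHS]big_seq_cond; apply: eq_bigl => j.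
    by case: (boolP (j \in r)) => //= jr; apply/esym; apply: contraNneq ar => <-.
  rewrite mulr_sumr big_seq [RHS]big_seq; apply: eq_bigr => i ir.
  rewrite big_cons; have -> : a != i by apply: contraNneq ar => ->.
  by rewrite mulrCA.
by rewrite H ?index_enum_uniq.
Qed.

Lemma d_det p (B : M7) : d p (\det B) = \sum_i \sum_j d p (B i j) * cofactor B i j.
Proof.
have dsign (s : 'S_7) x : d p ((-1) ^+ s * x) = (-1) ^+ s * d p x.
  by case: (s : bool); rewrite ?expr1 ?expr0 ?mulN1r ?mul1r ?(dN dD).
transitivity (\sum_i \det (\matrix_(k, j) if k == i then d p (B i j) else B k j)).
  rewrite /determinant (d_sum dD).
  under eq_bigr do rewrite dsign d_prod mulr_sumr.
  rewrite exchange_big; apply: eq_bigr => i _; apply: eq_bigr => s _ /=.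
  congr (_ * _); rewrite [RHS](bigD1 i) //= mxE eqxx; congr (_ * _).
  by apply: eq_bigr => j /negbTE ji; rewrite mxE ji.
apply: eq_bigr => i _; rewrite (expand_det_row _ i); apply: eq_bigr => j _.
rewrite mxE eqxx; congr (_ * _); rewrite /cofactor; congr (_ * \det _).
by apply/matrixP => k l; rewrite !mxE eq_sym (negbTE (neq_lift _ _)).
Qed.

Variables (g h : M7) (nu nui : A).
Hypothesis g_sym : g^T = g.
Hypothesis h_sym : h^T = h.
Hypothesis hg : h *m g = 1%:M.
Hypothesis nu_sqr : nu * nu = \det g.
Hypothesis nuV : nu * nui = 1.

(** Jacobi's formula applied to nu^2 = det g gives 2 nu d nu = 2 nu^2 tr Gamma, each half of the
    symmetric expression [metric_compat] contributing one trace; [half] and the inverse [nui] cancel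
    the factor 2 nu. *)
Lemma volume_derivative p : d p nu = nu * \tr (gam d half g h p).
Proof.
set G := gam _ _ _ _ _; have hadj : \adj g = \det g *: h.
  by rewrite -[LHS]mul1mx -hg -mulmxA mul_mx_adj mul_mx_scalar.
have e : d p nu * nu + nu * d p nu = nu * nu * (\tr G + \tr G).
  rewrite -dM nu_sqr d_det.
  transitivity (\tr (dm d p g *m \adj g)).
    apply: eq_bigr => i _; rewrite mxE; apply: eq_bigr => j _.
    by rewrite [\adj g _ _]mxE [dm _ _ _ _ _]mxE.
  rewrite hadj -scalemxAr mxtraceZ; congr (_ * _).
  rewrite (metric_compat d halfP g_sym h_sym hg) mulmxDl mxtraceD -/G; congr (_ + _).
    by rewrite -mulmxA (mulmx1C hg) mulmx1.
  by rewrite mxtrace_mulC mulmxA hg mul1mx mxtrace_tr.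
have {}e : (half + half) * (nu * nui) * d p nu = (half + half) * (nu * nui) * (nu * \tr G).
  have h1 (a b c x : A) : (a + a) * (b * c) * x = a * c * (x * b + b * x) by ring.
  have h2 (a b c x : A) : (a + a) * (b * c) * (b * x) = a * c * (b * b * (x + x)) by ring.
  by rewrite h1 h2 e.
by move: e; rewrite halfP nuV !mul1r.
Qed.
End Jacobi.

Section CurvatureEntry.
Variables (A : comPzRingType) (d : 'I_7 -> A -> A) (half : A) (g h : 'M[A]_7).
Hypothesis g_sym : g^T = g.
Local Notation gam := (gam d half g h).

Lemma curv_entry i j k : curv d half g h k j i k = d k (gam i j k) - d j (gam i k k)
  + \sum_l (gam k l k * gam i j l - gam j l k * gam i k l).
Proof.
have E1 : dm d k (gam j) i k = d k (gam i j k) by rewrite mxE (gam_sym _ _ _ g_sym j i).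
have E2 : dm d j (gam k) i k = d j (gam i k k) by rewrite mxE (gam_sym _ _ _ g_sym k i).
have E3 : (gam k *m gam j) i k = \sum_l gam j l k * gam i k l.
  by rewrite mulmxE3; apply: eq_bigr => l _; rewrite mulrC (gam_sym _ _ _ g_sym k i).
have E4 : (gam j *m gam k) i k = \sum_l gam k l k * gam i j l.
  by rewrite mulmxE3; apply: eq_bigr => l _; rewrite mulrC (gam_sym _ _ _ g_sym j i).
rewrite /curv !(mxaE, mxnE) E1 E2 E3 E4 sumrB.
have h4 (a b c e : A) : a - b - c + e = a - b + (e - c) by ring.
exact: h4.
Qed.
End CurvatureEntry.

(** * Evaluation of tensor identities at a point *)

Section MapTensors.
Variables (A B : comPzRingType) (f : {rmorphism A -> B}).
Local Notation "C ^f" := (map_mx f C).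

Lemma map_mx_sum (I : Type) (r : seq I) (P : pred I) (F : I -> 'M[A]_7) :
  (\sum_(i <- r | P i) F i)^f = \sum_(i <- r | P i) (F i)^f.
Proof. exact: raddf_sum. Qed.

Lemma map_lincomb (c : 'I_7 -> A) (F : 'I_7 -> 'M[A]_7) :
  (\sum_i c i *: F i)^f = \sum_i f (c i) *: (F i)^f.
Proof. by rewrite map_mx_sum; apply: eq_bigr => i _; rewrite map_mxZ. Qed.

Lemma map_lincomb2 (c e : 'I_7 -> A) (S T : 'I_7 -> 'M[A]_7) :
  (\sum_i (c i *: S i + e i *: T i))^f = \sum_i (f (c i) *: (S i)^f + f (e i) *: (T i)^f).
Proof. by rewrite map_mx_sum; apply: eq_bigr => i _; rewrite map_mxD !map_mxZ. Qed.

Lemma map_psim (g : 'M[A]_7) C n j : (psim g C n j)^f = psim g^f (fun q => (C q)^f) n j.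
Proof.
rewrite /psim map_mxD /prodm map_lincomb; congr (_ + _).
  by apply: eq_bigr => q _; rewrite [_^f _ _]mxE.
apply/matrixP => k l; rewrite !mxE raddfB /= !rmorphM.
by do 2!case: eqP => _; rewrite ?rmorph1 ?rmorph0.
Qed.

(** Carries the Ricci identity [nab_torsion_comm] to a point. [P] and [Q] stand for the two
    derivatives of psi, whose images are supplied as hypotheses. *)
Lemma map_rotation_comm (g O t Da Db : 'M[A]_7) (C : 'I_7 -> 'M[A]_7)
    (P Q : 'I_7 -> 'M[A]_7) (g' : 'M[B]_7) (P' Q' : 'I_7 -> 'M[B]_7) a b j :
  g^f = g' -> (forall n, (P n)^f = P' n) -> (forall n, (Q n)^f = Q' n) ->
  - (\sum_m O j m *: C m) - O *m C j + C j *m O =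
    \sum_n (Da b n - Db a n) *: psim g C n j + \sum_n (t b n *: P n - t a n *: Q n) ->
  - (\sum_m O^f j m *: (C m)^f) - O^f *m (C j)^f + (C j)^f *m O^f =
    \sum_n (Da^f b n - Db^f a n) *: psim g' (fun q => (C q)^f) n j
    + \sum_n (t^f b n *: P' n - t^f a n *: Q' n).
Proof.
move=> <- eP eQ /(congr1 (map_mx f)).
rewrite !(map_mxD, map_mxN) !map_mxM !map_lincomb map_mx_sum => e.
transitivity (- (\sum_i f (O j i) *: (C i)^f) - O^f *m (C j)^f + (C j)^f *m O^f).
  by congr (- _ - _ + _); apply: eq_bigr => m _; rewrite mxE.
rewrite e; congr (_ + _); apply: eq_bigr => n _.
  by rewrite map_psim raddfB /= ![_^f _ _]mxE.
by rewrite map_mxD map_mxN !map_mxZ eP eQ ![_^f _ _]mxE.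
Qed.

Lemma map_product_rule (Na : 'M[A]_7) (N C : 'I_7 -> 'M[A]_7) (Cn : 'M[A]_7) (j : 'I_7) :
  (\sum_q (Na j q *: C q + Cn j q *: N q))^f =
  \sum_q (Na^f j q *: (C q)^f + Cn^f j q *: (N q)^f).
Proof.
rewrite map_mx_sum; apply: eq_bigr => q _.
by rewrite map_mxD !map_mxZ ![_^f _ _]mxE.
Qed.
End MapTensors.

Section NablaAlternating.
Variables (A : comPzRingType) (d : 'I_7 -> A -> A) (half : A).
Hypothesis dD : forall p x y, d p (x + y) = d p x + d p y.
Hypothesis dM : forall p x y, d p (x * y) = d p x * y + x * d p y.
Hypothesis halfP : half + half = 1.
Variables g h : 'M[A]_7.
Hypothesis g_sym : g^T = g.
Hypothesis h_sym : h^T = h.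
Hypothesis hg : h *m g = 1%:M.
Variable C : 'I_7 -> 'M[A]_7.
Let f i j k := (C i *m g) j k.
Hypothesis fC : forall i j k, f j i k = - f i j k.
Hypothesis fC' : forall i j k, f i k j = - f i j k.
Let gam := gam d half g h.
Let n p i j k := (nab d half g h C p i *m g) j k.

Let nE p i j k : n p i j k = d p (f i j k)
  - \sum_m gam p i m * f m j k - \sum_m gam p j m * f i m k - \sum_m gam p k m * f i j m.
Proof.
rewrite (d_three_form dD dM halfP g_sym h_sym hg) /n -/gam -/(f _ _ _).
have h4 (a b c e : A) : a = a + b + c + e - b - c - e by ring.
exact: h4.
Qed.

Lemma nab_swap p i j k : n p j i k = - n p i j k.
Proof.
rewrite !nE fC (dN dD).
have e a b : \sum_m gam p a m * f b m k = - \sum_m gam p a m * f m b k.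
  by rewrite -sumrN; apply: eq_bigr => m _; rewrite fC mulrN.
have -> : \sum_m gam p k m * f j i m = - \sum_m gam p k m * f i j m.
  by rewrite -sumrN; apply: eq_bigr => m _; rewrite fC mulrN.
by rewrite !e; ring.
Qed.

Lemma nab_swap' p i j k : n p i k j = - n p i j k.
Proof.
rewrite !nE fC' (dN dD).
have e a b : \sum_m gam p a m * f i b m = - \sum_m gam p a m * f i m b.
  by rewrite -sumrN; apply: eq_bigr => m _; rewrite fC' mulrN.
have -> : \sum_m gam p i m * f m k j = - \sum_m gam p i m * f m j k.
  by rewrite -sumrN; apply: eq_bigr => m _; rewrite fC' mulrN.
by rewrite !e; ring.
Qed.
End NablaAlternating.

(** * Tensors at a point, in a frame adapted to the G2 structure *)

(* With phi = pullback u phi0 and F inverse to u, [cnj] gives the frame components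
   of an endomorphism and [fr] those of a covariant index. *)
Section AdaptedFrame.
Variable R : realFieldType.
Local Notation M7 := 'M[R]_7.
Local Notation ph := (ph R).
Local Notation ps := (ps R).
Local Notation dl := (dl R).
Variables u F : M7.
Hypothesis uF : u *m F = 1%:M.
Let Fu : F *m u = 1%:M. Proof. exact: mulmx1C. Qed.
Local Notation g := (u *m u^T).
Local Notation h := (F^T *m F).

Definition cnj (B : M7) : M7 := F *m B *m u.
Definition fr (T : 'I_7 -> M7) a : M7 := \sum_p F a p *: T p.

Lemma cnjD B B' : cnj (B + B') = cnj B + cnj B'.
Proof. by rewrite /cnj mulmxDr mulmxDl. Qed.
Lemma cnjN B : cnj (- B) = - cnj B.
Proof. by rewrite /cnj mulmxN mulNmx. Qed.
Lemma cnjZ c B : cnj (c *: B) = c *: cnj B.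
Proof. by rewrite /cnj -scalemxAr -scalemxAl. Qed.
Lemma cnj0 : cnj 0 = 0.
Proof. by rewrite /cnj mulmx0 mul0mx. Qed.
Lemma cnj_sum (T : 'I_7 -> M7) : cnj (\sum_i T i) = \sum_i cnj (T i).
Proof. exact: (big_morph _ cnjD cnj0). Qed.
Lemma cnjM B B' : cnj (B *m B') = cnj B *m cnj B'.
Proof. by rewrite /cnj -!mulmxA (mulmxA u F) uF mul1mx. Qed.
Lemma cnjK B : u *m cnj B *m F = B.
Proof. by rewrite /cnj !mulmxA uF mul1mx -mulmxA uF mulmx1. Qed.
(** The frame is orthonormal, so lowered and mixed components agree in it. *)
Lemma cnj_low B : F *m (B *m g) *m F^T = cnj B.
Proof. by rewrite /cnj -!mulmxA -trmx_mul Fu trmx1 mulmx1. Qed.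
Lemma tr_cnj B : \tr (cnj B) = \tr B.
Proof. by rewrite /cnj mxtrace_mulC mulmxA uF mul1mx. Qed.

Lemma eq_fr T T' a : (forall p, T p = T' p) -> fr T a = fr T' a.
Proof. by move=> e; apply: eq_bigr => p _; rewrite e. Qed.
Lemma frD T T' a : fr (fun p => T p + T' p) a = fr T a + fr T' a.
Proof. by rewrite -big_split; apply: eq_bigr => p _; rewrite scalerDr. Qed.
Lemma frN T a : fr (fun p => - T p) a = - fr T a.
Proof. by rewrite -sumrN; apply: eq_bigr => p _; rewrite scalerN. Qed.
Lemma frB T T' a : fr (fun p => T p - T' p) a = fr T a - fr T' a.
Proof. by rewrite frD frN. Qed.
Lemma frZ c T a : fr (fun p => c *: T p) a = c *: fr T a.
Proof. by rewrite /fr scaler_sumr; apply: eq_bigr => p _; rewrite !scalerA mulrC. Qed.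
Lemma fr_sum (T : 'I_7 -> 'I_7 -> M7) a : fr (fun p => \sum_q T p q) a = \sum_q fr (fun p => T p q) a.
Proof.
by rewrite /fr exchange_big; apply: eq_bigr => p _; rewrite scaler_sumr.
Qed.
Lemma frMr B T a : fr (fun p => T p *m B) a = fr T a *m B.
Proof. by rewrite /fr mulmx_suml; apply: eq_bigr => p _; rewrite scalemxAl. Qed.
Lemma frMl B T a : fr (fun p => B *m T p) a = B *m fr T a.
Proof. by rewrite /fr mulmx_sumr; apply: eq_bigr => p _; rewrite scalemxAr. Qed.
Lemma fr_tr T a : fr (fun p => (T p)^T) a = (fr T a)^T.
Proof. by rewrite /fr linear_sum; apply: eq_bigr => p _; rewrite linearZ. Qed.
Lemma fr_scal (c : 'I_7 -> R) B a : fr (fun p => c p *: B) a = (\sum_p F a p * c p) *: B.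
Proof. by rewrite /fr scaler_suml; apply: eq_bigr => p _; rewrite scalerA. Qed.
Lemma fr_exchange (T : 'I_7 -> 'I_7 -> M7) a b :
  fr (fun p => fr (fun q => T p q) b) a = fr (fun q => fr (fun p => T p q) a) b.
Proof.
rewrite /fr; under eq_bigr do rewrite scaler_sumr; rewrite exchange_big.
apply: eq_bigr => q _; rewrite scaler_sumr; apply: eq_bigr => p _.
by rewrite !scalerA mulrC.
Qed.
Lemma frK T j : \sum_a u j a *: fr T a = T j.
Proof.
rewrite /fr; under eq_bigr do rewrite scaler_sumr; rewrite exchange_big.
transitivity (\sum_p (u *m F) j p *: T p).
  apply: eq_bigr => p _; rewrite mxE scaler_suml; apply: eq_bigr => a _.
  by rewrite scalerA.
rewrite uF (bigD1 j) //= mxE eqxx scale1r big1 ?addr0 // => p pj.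
by rewrite mxE eq_sym (negbTE pj) scale0r.
Qed.

Lemma sum_sep (x y p q r s : 'I_7 -> R) :
  \sum_n x n * (\sum_j y j * (p j * q n - r n * s j)) =
  (\sum_j y j * p j) * (\sum_n x n * q n) - (\sum_n x n * r n) * (\sum_j y j * s j).
Proof.
rewrite (mulrC (\sum_j y j * p j)) !mulr_suml -sumrB; apply: eq_bigr => n _.
rewrite !mulr_sumr -sumrB; apply: eq_bigr => j _; ring.
Qed.

Lemma fr_contract (B : M7) T a : fr (fun j => \sum_m B j m *: T m) a = \sum_b cnj B a b *: fr T b.
Proof.
transitivity (\sum_q (cnj B *m F) a q *: T q).
  have -> : cnj B *m F = F *m B by rewrite /cnj -mulmxA uF mulmx1.
  rewrite fr_sum; apply: eq_bigr => m _; rewrite mxE scaler_suml.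
  by apply: eq_bigr => p _; rewrite scalerA.
rewrite /fr; under [RHS]eq_bigr do rewrite scaler_sumr; rewrite [RHS]exchange_big.
apply: eq_bigr => q _; rewrite mxE scaler_suml; apply: eq_bigr => b _.
by rewrite scalerA.
Qed.

Lemma fr_entry_contract (B T : 'I_7 -> M7) (a b : 'I_7) :
  fr (fun n => \sum_c B n b c *: T c) a = \sum_c fr B a b c *: T c.
Proof.
rewrite fr_sum; apply: eq_bigr => c _; rewrite fr_scal; congr (_ *: _).
by rewrite /fr summxE; apply: eq_bigr => p _; rewrite mxE.
Qed.

Definition phm a : M7 := \matrix_(b, c) ph a b c.
Definition psm a b : M7 := \matrix_(c, d) ps a b c d.
Variable C : 'I_7 -> M7.
Hypothesis C_frame : forall a, fr (fun j => cnj (C j)) a = phm a.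

(** [psim] is the expression that [ph_ph] equates with psi. In the frame, phi becomes its constant
    table and [gdelta] the Kronecker terms, which cancel those of [ph_ph]. *)
Lemma psim_frame a b : fr (fun n => fr (fun j => cnj (psim g C n j)) b) a = psm a b.
Proof.
have E n : fr (fun j => cnj (psim g C n j)) b =
    \sum_c cnj (C n) b c *: phm c + fr (fun j => cnj (gdelta g n j)) b.
  under [LHS]eq_fr do rewrite /psim cnjD; rewrite frD; congr (_ + _).
  under eq_fr do rewrite /prodm cnj_sum.
  under eq_fr do under eq_bigr do rewrite cnjZ.
  by rewrite fr_contract; apply: eq_bigr => c _; rewrite C_frame.
under eq_fr do rewrite E; rewrite frD fr_entry_contract C_frame.
have gd n j : cnj (gdelta g n j) = \matrix_(k, l) (u j k * u n l - u n k * u j l).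
  apply/matrixP => k l; rewrite mxE.
  have Fg : F *m g = u^T by rewrite mulmxA Fu mul1mx.
  have E1 m : (F *m gdelta g n j) k m = u j k * (n == m)%:R - u n k * (j == m)%:R.
    have e i : u i k = (F *m g) k i by rewrite Fg mxE.
    rewrite mxE !e [(F *m g) k j]mxE [(F *m g) k n]mxE !mulr_suml -sumrB.
    apply: eq_bigr => i _; rewrite mxE.
    have gs i' j' : g i' j' = g j' i' by rewrite -[in LHS](trmxK u) -trmx_mul trmxK mxE.
    by rewrite mulrBr !mulrA (gs j) (gs n).
  rewrite mxE; under eq_bigr do rewrite E1 mulrBl -!mulrA; rewrite sumrB -!mulr_sumr.
  congr (_ * _ - _ * _).
    by rewrite (bigD1 n) //= eqxx mul1r big1 ?addr0 // => i; rewrite eq_sym => /negbTE ->; rewrite mul0r.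
  by rewrite (bigD1 j) //= eqxx mul1r big1 ?addr0 // => i; rewrite eq_sym => /negbTE ->; rewrite mul0r.
have Fue i k : \sum_j F i j * u j k = dl i k.
  by have := congr1 (fun B : M7 => B i k) Fu; rewrite !mxE.
have -> : fr (fun n => fr (fun j => cnj (gdelta g n j)) b) a =
    \matrix_(k, l) (dl b k * dl a l - dl a k * dl b l).
  apply/matrixP => k l; rewrite [RHS]mxE -!Fue /fr summxE -sum_sep.
  apply: eq_bigr => n _; rewrite mxzE summxE; congr (_ * _); apply: eq_bigr => j _.
  by rewrite mxzE gd mxE.
apply/matrixP => k l; rewrite mxaE summxE [in RHS]mxE [X in _ + X]mxE.
have -> : \sum_c (phm a b c *: phm c) k l = \sum_c ph a b c * ph k l c.
  by apply: eq_bigr => c _; rewrite mxzE !mxE (phCyc _ c k l).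
rewrite ph_ph; have hr (x1 x2 x3 x4 x5 : R) : x1 * x2 - x3 * x4 + x5 + (x4 * x3 - x1 * x2) = x5 by ring.
exact: hr.
Qed.

Definition low3 (f : 'I_7 -> 'I_7 -> 'I_7 -> R) a b c :=
  \sum_i \sum_j \sum_k F a i * (F b j * (F c k * f i j k)).

Lemma low3_ext f f' a b c : (forall i j k, f i j k = f' i j k) -> low3 f a b c = low3 f' a b c.
Proof. by move=> e; do 3! apply: eq_bigr => ? _; rewrite e. Qed.

Lemma low3D f f' a b c : low3 (fun i j k => f i j k + f' i j k) a b c = low3 f a b c + low3 f' a b c.
Proof.
rewrite /low3 -big_split; apply: eq_bigr => i _; rewrite -big_split.
apply: eq_bigr => j _; rewrite -big_split; apply: eq_bigr => k _.
by rewrite /= !mulrDr.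
Qed.

Lemma low3Z z f a b c : low3 (fun i j k => z * f i j k) a b c = z * low3 f a b c.
Proof.
rewrite /low3 mulr_sumr; apply: eq_bigr => i _; rewrite mulr_sumr.
apply: eq_bigr => j _; rewrite mulr_sumr; apply: eq_bigr => k _; ring.
Qed.

Lemma low3_swap12 f a b c : low3 (fun i j k => f j i k) a b c = low3 f b a c.
Proof.
rewrite /low3 exchange_big; apply: eq_bigr => j _; apply: eq_bigr => i _.
by apply: eq_bigr => k _; rewrite mulrCA.
Qed.

Lemma low3_swap23 f a b c : low3 (fun i j k => f i k j) a b c = low3 f a c b.
Proof.
rewrite /low3; apply: eq_bigr => i _; rewrite exchange_big; apply: eq_bigr => j _.
by apply: eq_bigr => k _; rewrite [F b k * _]mulrCA.
Qed.

Lemma low3_cyc f a b c : low3 (fun i j k => f j k i) a b c = low3 f b c a.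
Proof. by rewrite (low3_swap12 (fun i j k => f i k j)) low3_swap23. Qed.

Lemma low3_mx (T : 'I_7 -> M7) a b c : low3 (fun i => T i) a b c = fr (fun i => F *m T i *m F^T) a b c.
Proof.
rewrite /fr summxE; apply: eq_bigr => i _; rewrite mxzE.
under eq_bigr do rewrite -mulr_sumr.
rewrite -mulr_sumr; congr (_ * _).
rewrite [RHS]mxE exchange_big; apply: eq_bigr => k _; rewrite [F^T _ _]mxE mxE mulr_suml.
by apply: eq_bigr => j _; rewrite mulrAC mulrA.
Qed.

Lemma low3_low (T : 'I_7 -> M7) a b c :
  low3 (fun i j k => (T i *m g) j k) a b c = fr (fun i => cnj (T i)) a b c.
Proof. by rewrite (low3_mx (fun i => T i *m g)); congr fun_of_matrix; apply: eq_fr => i; rewrite cnj_low. Qed.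

Lemma mx_sum3 (T : 'I_7 -> M7) (B : M7) j k l :
  \sum_m B j m * (T m *m g) k l = ((\sum_m B j m *: T m) *m g) k l.
Proof.
by rewrite mulmx_suml summxE; apply: eq_bigr => m _; rewrite -scalemxAl mxzE.
Qed.

Section PointTorsion.
Variable N : 'I_7 -> M7.
Let n j k l := (N j *m g) k l.
Hypothesis nC : forall i j k, n j i k = - n i j k.
Hypothesis nC' : forall i j k, n i k j = - n i j k.
Hypothesis N_tr : forall j k, \tr (N j *m C k) + \tr (C j *m N k) = 0.

(** N is the covariant derivative of phi in one fixed direction. In the frame [N_tr] says that the
    symmetric part of [trace2] vanishes, so [three_form_eq_pi7] applies; the coefficients are the
    frame components of a row of T, and [F m p] returns their index to coordinates. *)
Lemma point_torsion j :
  N j = \sum_p (\sum_m (24%:R^-1 * \sum_a \sum_b \sum_c low3 n a b c * ps m a b c) * F m p)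
     *: psim g C p j.
Proof.
have nE a b c : low3 n a b c = fr (fun i => cnj (N i)) a b c by exact: low3_low.
have e1 a b c : low3 n b a c = - low3 n a b c.
  rewrite -(low3_swap12 n a b c) -mulN1r -low3Z; apply: low3_ext => i k l.
  by rewrite nC mulN1r.
have e1' a b c : low3 n a c b = - low3 n a b c.
  rewrite -(low3_swap23 n a b c) -mulN1r -low3Z; apply: low3_ext => i k l.
  by rewrite nC' mulN1r.
have e2 a b c : low3 n b c a = low3 n a b c by rewrite e1' e1 opprK.
have e3 a b : trace2 (low3 n) a b = - \tr (fr (fun i => cnj (N i)) a *m phm b).
  rewrite /mxtrace -sumrN /trace2; apply: eq_bigr => k _; rewrite mxE -sumrN.
  by apply: eq_bigr => l _; rewrite nE [phm _ _ _]mxE phC' mulrN.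
have e4 a b : trace2 (low3 n) a b + trace2 (low3 n) b a = 0.
  have trE a' b' : \tr (fr (fun i => cnj (N i)) a' *m phm b') =
      \sum_p \sum_q F a' p * F b' q * \tr (N p *m C q).
    rewrite -C_frame -frMr raddf_sum; apply: eq_bigr => p _ /=.
    rewrite mxtraceZ -frMl raddf_sum mulr_sumr; apply: eq_bigr => q _ /=.
    by rewrite mxtraceZ -cnjM tr_cnj mulrA.
  rewrite !e3 !trE -opprD [X in _ + X]exchange_big /=.
  rewrite -big_split big1 ?oppr0 // => p _; rewrite -big_split big1 // => q _ /=.
  rewrite (mulrC (F b q)) -mulrDr.
  by rewrite [X in _ + X]mxtrace_mulC N_tr mulr0.
set tau := fun m => 24%:R^-1 * \sum_a \sum_b \sum_c low3 n a b c * ps m a b c.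
have e5 a : fr (fun i => cnj (N i)) a = \sum_m tau m *: psm m a.
  apply/matrixP => b c; have := three_form_eq_pi7 e1 e2 e4 a b c; rewrite -/(tau _) nE => ->; rewrite summxE.
  by apply: eq_bigr => m _; rewrite mxzE [psm _ _ _ _]mxE.
pose N' j' := cnj (N j'); have e6 : N' j = cnj (\sum_p (\sum_m tau m * F m p) *: psim g C p j).
  rewrite -(frK N' j) cnj_sum.
  under [RHS]eq_bigr do rewrite cnjZ -(frK (fun i => cnj (psim g C _ i)) j) scaler_sumr.
  rewrite exchange_big; apply: eq_bigr => a _ /=; rewrite e5.
  under [RHS]eq_bigr do rewrite scalerA mulrC -scalerA.
  rewrite -scaler_sumr; congr (_ *: _).
  under [RHS]eq_bigr do rewrite scaler_suml.
  rewrite exchange_big; apply: eq_bigr => m _ /=; rewrite -psim_frame scaler_sumr.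
  by apply: eq_bigr => p _; rewrite scalerA.
by rewrite -[LHS]cnjK -[RHS]cnjK -e6.
Qed.
End PointTorsion.

End AdaptedFrame.

(** * The soliton equation at one point, from coordinates to the frame and back *)

Section PointSoliton.
Variable R : realFieldType.
Local Notation M7 := 'M[R]_7.
Local Notation ph := (ph R).
Local Notation ps := (ps R).
Local Notation dl := (dl R).
Local Notation phm := (phm R).
Local Notation psm := (psm R).
Variables u F : M7.
Hypothesis uF : u *m F = 1%:M.
Let Fu : F *m u = 1%:M. Proof. exact: mulmx1C. Qed.
Local Notation g := (u *m u^T).
Local Notation h := (F^T *m F).
Local Notation cnj := (cnj u F).
Local Notation fr := (fr F).
Variable C : 'I_7 -> M7.
Hypothesis C_frame : forall a, fr (fun j => cnj (C j)) a = phm a.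
Variables (t Y : M7) (X : 'I_7 -> R) (N Om : 'I_7 -> 'I_7 -> M7) (D : 'I_7 -> M7) (lam : R).
Hypothesis N_tor : forall p j, N p j = \sum_n t p n *: psim g C n j.
Hypothesis t_skew : (t *m g)^T = - (t *m g).
Hypothesis t_tr : forall k, \tr (t *m C k) = 0.
Hypothesis D_skew : forall p, (D p *m g)^T = - (D p *m g).
Hypothesis D_tr : forall p k, \tr (D p *m C k) + \tr (t *m N p k) = 0.
Hypothesis Om_skew1 : forall p q, Om q p = - Om p q.
Hypothesis Om_metric : forall p q, Om p q *m g + g *m (Om p q)^T = 0.
Hypothesis Om_bianchi : forall p q r k, Om p q r k + Om q r p k + Om r p q k = 0.
Definition dpsim p n j : M7 := \sum_q (N p n j q *: C q + C n j q *: N p q).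
Hypothesis Om_comm : forall p q j,
  - (\sum_m Om p q j m *: C m) - Om p q *m C j + C j *m Om p q =
  \sum_n (D p q n - D q p n) *: psim g C n j
  + \sum_n (t q n *: dpsim p n j - t p n *: dpsim q n j).
Hypothesis soliton : forall i j k,
  - 2%:R * ((D i *m g) j k + (D j *m g) k i + (D k *m g) i j) =
  lam * (C i *m g) j k + \sum_p X p * (N p i *m g) j k
  + (\sum_m Y i m * (C m *m g) j k + \sum_m Y j m * (C i *m g) m k
     + \sum_m Y k m * (C i *m g) j m).

Let t' := cnj t.
Let Y' := cnj Y.
Let D' a := fr (fun p => cnj (D p)) a.
Let Z a b := fr (fun p => fr (fun q => cnj (Om p q)) b) a.
Let X' b := \sum_p X p * u p b.
Let N' a b := fr (fun p => fr (fun q => cnj (N p q)) b) a.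

Lemma skew_cnj (B : M7) : (B *m g)^T = - (B *m g) -> (cnj B)^T = - cnj B.
Proof.
move=> sk; rewrite -cnj_low // trmx_mul trmxK trmx_mul sk mulmxA mulmxN mulNmx.
by rewrite mulmxA.
Qed.

Lemma skewE (B : M7) i j : B^T = - B -> B j i = - B i j.
Proof. by move=> e; rewrite -mxnE -e mxE. Qed.

Lemma t'_skew i j : t' j i = - t' i j.
Proof. exact/skewE/skew_cnj. Qed.

Lemma fr_tr0 (B : 'I_7 -> M7) a : (forall p, (B p)^T = - B p) -> (fr B a)^T = - fr B a.
Proof. by move=> e; rewrite -fr_tr -frN; apply: eq_fr => p. Qed.

Lemma D'_skew a i j : D' a j i = - D' a i j.
Proof. by apply/skewE/fr_tr0 => p; exact: skew_cnj. Qed.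

Lemma tr_phm (B : M7) k : \sum_i \sum_j B i j * ph i j k = - \tr (B *m phm k).
Proof.
rewrite /mxtrace -sumrN; apply: eq_bigr => i _; rewrite mxE -sumrN.
by apply: eq_bigr => j _; rewrite [phm _ _ _]mxE (phC' _ k i j) mulrN opprK (phCyc _ k i j).
Qed.

Lemma fr_tr_mul (B : M7) (T : 'I_7 -> M7) k :
  \tr (cnj B *m fr (fun j => cnj (T j)) k) = \sum_p F k p * \tr (B *m T p).
Proof.
rewrite -frMl raddf_sum; apply: eq_bigr => p _ /=.
by rewrite mxtraceZ -cnjM // tr_cnj.
Qed.

Lemma t'_ph k : \sum_i \sum_j t' i j * ph i j k = 0.
Proof.
rewrite tr_phm -C_frame fr_tr_mul big1 ?oppr0 // => p _.
by rewrite t_tr mulr0.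
Qed.

Lemma N'_frame a b : N' a b = \sum_m t' a m *: psm m b.
Proof.
rewrite /N'; under eq_fr => p.
  under eq_fr => q do rewrite N_tor cnj_sum.
  under eq_fr => q do under eq_bigr => n _ do rewrite cnjZ.
  rewrite fr_sum; under eq_bigr => n _ do rewrite frZ.
  over.
rewrite (fr_contract uF); apply: eq_bigr => m _; congr (_ *: _).
exact: (psim_frame uF C_frame).
Qed.

Lemma N'E a j k l : N' a j k l = dphi t' a j k l.
Proof.
rewrite N'_frame summxE; apply: eq_bigr => m _.
by rewrite mxzE [psm _ _ _ _]mxE.
Qed.

Lemma D'_ph a k : \sum_i \sum_j (D' a i j * ph i j k + t' i j * dphi t' a i j k) = 0.
Proof.
under eq_bigr do rewrite big_split; rewrite big_split /= tr_phm.
have -> : \sum_i \sum_j t' i j * dphi t' a i j k = - \tr (t' *m N' a k).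
  rewrite /mxtrace -sumrN; apply: eq_bigr => i _; rewrite mxE -sumrN.
  apply: eq_bigr => j _; rewrite N'E -mulrN; congr (_ * _).
  rewrite /dphi -sumrN; apply: eq_bigr => m _; rewrite -mulrN; congr (_ * _).
  by rewrite (psC' _ m j i k) (psC'' _ m j k i) (psC' _ m k j i) opprK.
rewrite -opprD -C_frame -frMr raddf_sum /= /N' -frMl raddf_sum -big_split big1 ?oppr0 //= => p _.
rewrite !mxtraceZ -mulrDr !fr_tr_mul -big_split big1 ?mulr0 //= => q _.
by rewrite -mulrDr D_tr mulr0.
Qed.

Lemma Z_skew1 a b i j : Z b a i j = - Z a b i j.
Proof.
rewrite -mxnE /Z fr_exchange -frN; congr fun_of_matrix; apply: eq_fr => p.
by rewrite -frN; apply: eq_fr => q; rewrite Om_skew1 cnjN.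
Qed.

Lemma Z_skew2 a b i j : Z a b j i = - Z a b i j.
Proof.
apply/skewE/fr_tr0 => p; apply: fr_tr0 => q; apply: skew_cnj.
have gs : g^T = g by rewrite trmx_mul trmxK.
rewrite trmx_mul gs; apply/eqP; rewrite -addr_eq0 addrC.
by rewrite Om_metric.
Qed.

Lemma Z_bianchi a b i j : Z a b i j + Z b i a j + Z i a b j = 0.
Proof.
(* The last index is a spectator, carried by the factor u, while [low3] converts the three indices
   that are permuted cyclically. *)
have E a' b' i' : Z a' b' i' j = low3 F (fun p q r => (Om p q *m u) r j) a' b' i'.
  rewrite /Z /fr /low3 summxE; apply: eq_bigr => p _; rewrite mxzE summxE mulr_sumr.
  apply: eq_bigr => q _; rewrite mxzE /cnj -mulmxA mxE !mulr_sumr.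
  by apply: eq_bigr => r _.
rewrite !E; set f := fun p q r => (Om p q *m u) r j.
rewrite -(low3_cyc F f a b i) -(low3_cyc F f b i a) -(low3_cyc F (fun p q r => f q r p) a b i).
rewrite -!low3D /low3 big1 // => p _; rewrite big1 // => q _; rewrite big1 // => r _.
rewrite /f !mxE -!big_split big1 ?mulr0 //= => k _.
by rewrite -!mulrDl Om_bianchi mul0r.
Qed.

(** Frame components of a family with three outer covariant indices. The coordinate Ricci identity
    is an equality of such families, and linearity of [G] lets its terms be converted one by one. *)
Let G (E : 'I_7 -> 'I_7 -> 'I_7 -> M7) a b j :=
  fr (fun p => fr (fun q => fr (fun r => cnj (E p q r)) j) b) a.

Lemma eq_G E E' a b j : (forall p q r, E p q r = E' p q r) -> G E a b j = G E' a b j.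
Proof. by move=> e; apply: eq_fr => p; apply: eq_fr => q; apply: eq_fr => r; rewrite e. Qed.
Lemma GD E E' a b j : G (fun p q r => E p q r + E' p q r) a b j = G E a b j + G E' a b j.
Proof.
rewrite /G -frD; apply: eq_fr => p; rewrite -frD; apply: eq_fr => q.
by rewrite -frD; apply: eq_fr => r; rewrite cnjD.
Qed.
Lemma GN E a b j : G (fun p q r => - E p q r) a b j = - G E a b j.
Proof.
rewrite /G -frN; apply: eq_fr => p; rewrite -frN; apply: eq_fr => q.
by rewrite -frN; apply: eq_fr => r; rewrite cnjN.
Qed.
Lemma G_swap E a b j : G (fun p q r => E q p r) a b j = G E b a j.
Proof. by rewrite /G fr_exchange. Qed.

Lemma G_dpsim a n j : G dpsim a n j =
  \sum_q (N' a n j q *: phm q + phm n j q *: N' a q).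
Proof.
have -> : G dpsim a n j = G (fun p n j => \sum_q N p n j q *: C q) a n j
    + G (fun p n j => \sum_q C n j q *: N p q) a n j.
  by rewrite -GD; apply: eq_G => p q r; rewrite /dpsim big_split.
rewrite big_split; congr (_ + _).
  rewrite /G; under eq_fr => p.
    under eq_fr => q.
      under eq_fr => r do rewrite cnj_sum.
      under eq_fr => r do under eq_bigr => m _ do rewrite cnjZ.
      rewrite (fr_contract uF); under eq_bigr => m _ do rewrite C_frame.
      over.
    rewrite fr_entry_contract.
    over.
  by rewrite fr_entry_contract.
rewrite /G; under eq_fr => p.
  under eq_fr => q.
    under eq_fr => r do rewrite cnj_sum.
    under eq_fr => r do under eq_bigr => m _ do rewrite cnjZ.
    rewrite (fr_contract uF).
    over.
  rewrite fr_entry_contract C_frame.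
  over.
by rewrite fr_sum; apply: eq_bigr => q _; rewrite frZ.
Qed.

Lemma G_t (E : 'I_7 -> 'I_7 -> 'I_7 -> M7) a b j :
  G (fun p q r => \sum_n t q n *: E p n r) a b j = \sum_n t' b n *: G E a n j.
Proof.
rewrite /G; under eq_fr => p.
  under eq_fr => q.
    under eq_fr => r do rewrite cnj_sum.
    under eq_fr => r do under eq_bigr => m _ do rewrite cnjZ.
    rewrite fr_sum; under eq_bigr => m _ do rewrite frZ.
    over.
  rewrite (fr_contract uF).
  over.
by rewrite fr_sum; apply: eq_bigr => q _; rewrite frZ.
Qed.

Lemma G_D a b j :
  G (fun p q r => \sum_n D p q n *: psim g C n r) a b j = \sum_n D' a b n *: psm n j.
Proof.
rewrite /G; under eq_fr => p.
  under eq_fr => q.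
    under eq_fr => r do rewrite cnj_sum.
    under eq_fr => r do under eq_bigr => m _ do rewrite cnjZ.
    rewrite fr_sum; under eq_bigr => m _ do rewrite frZ.
    over.
  rewrite (fr_contract uF); under eq_bigr => m _ do rewrite (psim_frame uF C_frame).
  over.
by rewrite fr_entry_contract.
Qed.

Lemma Z_phi a b j k l :
  - (\sum_m Z a b j m * ph m k l + \sum_m Z a b k m * ph j m l
     + \sum_m Z a b l m * ph j k m)
  = \sum_n (D' a b n - D' b a n) * ps n j k l
    + \sum_n (t' b n * dpsi t' a n j k l - t' a n * dpsi t' b n j k l).
Proof.
have E1 : G (fun p q r => \sum_m Om p q r m *: C m) a b j = \sum_m Z a b j m *: phm m.
  rewrite /G; under eq_fr => p.
    under eq_fr => q.
      under eq_fr => r do rewrite cnj_sum.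
      under eq_fr => r do under eq_bigr => m _ do rewrite cnjZ.
      rewrite (fr_contract uF); under eq_bigr => m _ do rewrite C_frame.
      over.
    rewrite fr_entry_contract.
    over.
  by rewrite fr_entry_contract.
have E2 : G (fun p q r => Om p q *m C r) a b j = Z a b *m phm j.
  rewrite /G; under eq_fr => p.
    under eq_fr => q.
      under eq_fr => r do rewrite (cnjM uF).
      rewrite frMl C_frame.
      over.
    rewrite frMr.
    over.
  by rewrite frMr.
have E3 : G (fun p q r => C r *m Om p q) a b j = phm j *m Z a b.
  rewrite /G; under eq_fr => p.
    under eq_fr => q.
      under eq_fr => r do rewrite (cnjM uF).
      rewrite frMr C_frame.
      over.
    rewrite frMl.
    over.
  by rewrite frMl.
have E4 p q r : - (\sum_m Om p q r m *: C m) - Om p q *m C r + C r *m Om p q =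
  \sum_n D p q n *: psim g C n r - \sum_n D q p n *: psim g C n r
  + (\sum_n t q n *: dpsim p n r - \sum_n t p n *: dpsim q n r).
  by rewrite Om_comm -!sumrB; congr (_ + _); apply: eq_bigr => n _; rewrite scalerBl.
have E5 := eq_G a b j E4.
move: E5; rewrite 2!GD 2!GN E1 E2 E3 !GD !GN.
rewrite (G_swap (fun p q r => \sum_n D p q n *: psim g C n r)).
rewrite (G_swap (fun p q r => \sum_n t q n *: dpsim p n r)) !G_D !G_t.
move=> /(congr1 (fun B : M7 => B k l)); rewrite !(mxaE, mxnE) !summxE => E5.
have dE a' n : G dpsim a' n j k l = dpsi t' a' n j k l.
  rewrite G_dpsim summxE; apply: eq_bigr => q _.
  by rewrite mxaE !mxzE !N'E ![phm _ _ _]mxE.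
transitivity (- (\sum_m (Z a b j m *: phm m) k l) - (Z a b *m phm j) k l + (phm j *m Z a b) k l).
  rewrite !mulmxE3 !opprD; congr (- _ - _ + _).
  - by apply: eq_bigr => m _; rewrite mxzE [phm _ _ _]mxE.
  - by apply: eq_bigr => m _; rewrite [phm _ _ _]mxE.
  - rewrite -sumrN; apply: eq_bigr => m _.
    by rewrite [phm _ _ _]mxE (Z_skew2 _ _ l) mulrN mulrC.
rewrite E5; under [X in _ = X + _]eq_bigr do rewrite mulrBl.
rewrite !sumrB; congr (_ - _ + (_ - _)).
- by apply: eq_bigr => n _; rewrite mxzE [psm _ _ _ _]mxE.
- by apply: eq_bigr => n _; rewrite mxzE [psm _ _ _ _]mxE.
- by apply: eq_bigr => n _; rewrite mxzE dE.
- by apply: eq_bigr => n _; rewrite mxzE dE.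
Qed.

Lemma cnj_cols (B B' : M7) : F *m (B *m g *m B'^T) *m F^T = cnj B *m (cnj B')^T.
Proof. by rewrite /cnj !trmx_mul !mulmxA. Qed.

Lemma frame_soliton i j k :
  - 2%:R * (D' i j k + D' j k i + D' k i j) = lam * ph i j k
  + \sum_p X' p * dphi t' p i j k + (\sum_m Y' i m * ph m j k
  + \sum_m Y' j m * ph i m k + \sum_m Y' k m * ph i j m).
Proof.
have := low3_ext F i j k soliton; rewrite low3Z !low3D low3Z.
have cE a b c : fr (fun p => cnj (C p)) a b c = ph a b c by rewrite C_frame mxE.
have E0 := low3_low uF.
pose f p q r := (D p *m g) q r.
have E1 : low3 F (fun i j k => f j k i) i j k = low3 F f j k i := low3_cyc F f i j k.
have E2 : low3 F (fun i j k => f k i j) i j k = low3 F f k i j.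
  by rewrite (low3_cyc F (fun i j k => f j k i)) low3_cyc.
rewrite E1 E2 !E0 cE => ->; congr (_ + _ + (_ + _ + _)).
- transitivity (low3 F (fun i j k => ((\sum_p X p *: N p i) *m g) j k) i j k).
    apply: low3_ext => a b c; rewrite mulmx_suml summxE; apply: eq_bigr => p _.
    by rewrite -scalemxAl mxzE.
  rewrite (E0 (fun i => \sum_p X p *: N p i)).
  under eq_fr do rewrite cnj_sum.
  under eq_fr do under eq_bigr do rewrite cnjZ.
  rewrite fr_sum summxE; under eq_bigr do rewrite frZ mxzE.
  under [LHS]eq_bigr do rewrite -(frK uF (fun p => fr (fun q => cnj (N p q)) i)) summxE mulr_sumr.
  rewrite exchange_big; apply: eq_bigr => b _; rewrite mulr_suml /=; apply: eq_bigr => p _.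
  by rewrite mxzE -N'E mulrA.
- transitivity (low3 F (fun i j k => ((\sum_m Y i m *: C m) *m g) j k) i j k).
    by apply: low3_ext => a b c; rewrite mx_sum3.
  rewrite (E0 (fun i => \sum_m Y i m *: C m)).
  under eq_fr do rewrite cnj_sum.
  under eq_fr do under eq_bigr do rewrite cnjZ.
  rewrite (fr_contract uF) summxE; apply: eq_bigr => m _.
  by rewrite mxzE cE.
- transitivity (low3 F (fun i j k => ((Y *m C i) *m g) j k) i j k).
    by apply: low3_ext => a b c; rewrite -mulmxA [RHS]mxE.
  rewrite (E0 (fun i => Y *m C i)); under eq_fr do rewrite (cnjM uF).
  by rewrite frMl C_frame mxE; apply: eq_bigr => m _; rewrite [phm _ _ _]mxE.
transitivity (low3 F (fun i j k => (C i *m g *m Y^T) j k) i j k).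
  apply: low3_ext => a b c; rewrite [RHS]mxE; apply: eq_bigr => m _.
  by rewrite [Y^T _ _]mxE mulrC.
rewrite (low3_mx F (fun i => C i *m g *m Y^T)); under eq_fr do rewrite cnj_cols.
rewrite frMr C_frame mxE; apply: eq_bigr => m _.
by rewrite [phm _ _ _]mxE [(_)^T _ _]mxE mulrC.
Qed.

Let Rc : M7 := \matrix_(i, j) \sum_k Om k j i k.

Lemma frame_ricci a b : \sum_k Z k b a k = (F *m Rc *m F^T) a b.
Proof.
transitivity (\sum_p \sum_q F b q * (F *m Om p q) a p).
  transitivity (\sum_k \sum_p \sum_q F k p * (F b q * cnj (Om p q) a k)).
    apply: eq_bigr => k _; rewrite /Z /fr summxE; apply: eq_bigr => p _.
    by rewrite mxzE summxE mulr_sumr; apply: eq_bigr => q _; rewrite mxzE.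
  rewrite exchange_big; apply: eq_bigr => p _; rewrite exchange_big; apply: eq_bigr => q _ /=.
  have -> : F *m Om p q = cnj (Om p q) *m F by rewrite /cnj -mulmxA uF mulmx1.
  rewrite [in RHS]mxE mulr_sumr; apply: eq_bigr => k _; ring.
rewrite exchange_big mxE; apply: eq_bigr => q _ /=; rewrite [F^T _ _]mxE -mulr_sumr mulrC.
congr (_ * _); under eq_bigr do rewrite mxE.
rewrite exchange_big mxE; apply: eq_bigr => i _ /=.
by rewrite [Rc _ _]mxE mulr_sumr.
Qed.

Let metric_eq := frame_metric_equation t'_skew t'_ph D'_skew D'_ph Z_skew1 Z_skew2
  Z_bianchi Z_phi frame_soliton.
Let divergence_eq := frame_divergence t'_skew t'_ph D'_skew D'_ph Z_skew1 Z_skew2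
  Z_bianchi Z_phi frame_soliton.

Lemma torsion_norm_frame :
  \sum_i \sum_j \sum_k \sum_l (t *m g) i k * (t *m g) j l * h i j * h k l
  = \sum_k \sum_l t' k l * t' k l.
Proof.
have tr2 (B B' : M7) : \sum_i \sum_k B i k * B' i k = \tr (B^T *m B').
  rewrite exchange_big; apply: eq_bigr => k _; rewrite mxE.
  by apply: eq_bigr => i _; rewrite mxE.
have uE (B : M7) : cnj B *m u^T = F *m (B *m g) by rewrite /cnj !mulmxA.
have tE : t *m g = u *m t' *m u^T by rewrite -[RHS]mulmxA uE [RHS]mulmxA uF mul1mx.
have uFT : u^T *m F^T = 1%:M by rewrite -trmx_mul Fu trmx1.
transitivity (\sum_i \sum_k (t *m g) i k * (h *m (t *m g) *m h) i k).
  apply: eq_bigr => i _; rewrite exchange_big; apply: eq_bigr => k _.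
  have hs l : h k l = h l k by rewrite -[in LHS](trmxK F) -trmx_mul trmxK mxE.
  rewrite [(_ *m h) i k]mxE mulr_sumr exchange_big; apply: eq_bigr => l _ /=.
  rewrite [(h *m _) i l]mxE mulr_suml mulr_sumr; apply: eq_bigr => j _.
  rewrite hs; have e (a b c d : R) : a * b * c * d = a * (c * b * d) by ring.
  exact: e.
rewrite !tr2 tE.
have -> : h *m (u *m t' *m u^T) *m h = F^T *m t' *m F.
  by rewrite -!mulmxA (mulmxA u^T) uFT mul1mx (mulmxA F u) Fu mul1mx.
have key (s : M7) : \tr ((u *m s *m u^T)^T *m (F^T *m s *m F)) = \tr (s^T *m s).
  rewrite !trmx_mul trmxK -!mulmxA (mulmxA u^T) uFT mul1mx mxtrace_mulC -!mulmxA Fu.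
  by rewrite mulmx1.
exact: key.
Qed.

(** The frame equation multiplied by u on the left and u^T on the right: this turns the identity
    into g, the frame components of Ric into those in coordinates, and a mixed tensor into its
    lowered form. *)
Theorem point_metric_equation i j :
  - (\sum_k Om k j i k) - 3%:R^-1 *
    (\sum_i \sum_j \sum_k \sum_l (t *m g) i k * (t *m g) j l * h i j * h k l) * g i j
  - 2%:R * \sum_k t i k * (t *m g) k j
  = 3%:R^-1 * lam * g i j + 2%:R^-1 * ((Y *m g) i j + (Y *m g) j i).
Proof.
rewrite torsion_norm_frame; set c := \sum_k _.
have E : - (F *m Rc *m F^T) - (3%:R^-1 * c) *: 1%:M - 2%:R *: (t' *m t') =
    (3%:R^-1 * lam) *: 1%:M + 2%:R^-1 *: (Y' + Y'^T).
  apply/matrixP => a b; rewrite !(mxaE, mxnE) !mxzE mxaE.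
  rewrite -frame_ricci [Y'^T _ _]mxE [(t' *m t') _ _]mxE [1%:M _ _]mxE.
  exact: metric_eq.
have {}E : u *m (- (F *m Rc *m F^T) - (3%:R^-1 * c) *: 1%:M - 2%:R *: (t' *m t')) *m u^T =
    u *m ((3%:R^-1 * lam) *: 1%:M + 2%:R^-1 *: (Y' + Y'^T)) *m u^T by rewrite E.
have uRu (B : M7) : u *m (F *m B *m F^T) *m u^T = B.
  by rewrite !mulmxA uF mul1mx -mulmxA -trmx_mul uF trmx1 mulmx1.
have uYu (B : M7) : u *m cnj B *m u^T = B *m g.
  by rewrite /cnj !mulmxA uF mul1mx.
have uYTu (B : M7) : u *m (cnj B)^T *m u^T = (B *m g)^T.
  have tr3 (s : M7) : u *m s^T *m u^T = (u *m s *m u^T)^T by rewrite !trmx_mul trmxK mulmxA.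
  by rewrite tr3 uYu.
have utu : u *m (t' *m t') *m u^T = t *m (t *m g).
  by rewrite /t' -(cnjM uF) uYu !mulmxA.
move: E; rewrite !(mulmxDr, mulmxDl, mulmxN, mulNmx) uRu -!scalemxAr -!scalemxAl.
rewrite mulmx1 utu mulmxDr mulmxDl uYu uYTu => /(congr1 (fun B : M7 => B i j)).
by rewrite !(mxaE, mxnE) !mxzE mxaE [Rc _ _]mxE (mulmxE3 t) [(Y *m g)^T _ _]mxE.
Qed.

Theorem point_divergence m :
  \sum_p (h *m \sum_q (Y p q *: C q + X q *: N p q)) p m = 0.
Proof.
pose B p := \sum_q (Y p q *: C q + X q *: N p q).
have frB a : fr (fun p => cnj (B p)) a =
    \sum_c Y' a c *: phm c + \sum_b X' b *: N' a b.
  have -> : fr (fun p => cnj (B p)) a = fr (fun p => cnj (\sum_q Y p q *: C q)) a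
      + fr (fun p => cnj (\sum_q X q *: N p q)) a.
    by rewrite -frD; apply: eq_fr => p; rewrite -cnjD /B big_split.
  congr (_ + _).
    under eq_fr do rewrite cnj_sum.
    under eq_fr do under eq_bigr do rewrite cnjZ.
    by rewrite (fr_contract uF); apply: eq_bigr => c _; rewrite C_frame.
  under eq_fr => p.
    rewrite cnj_sum.
    under eq_bigr => q _ do rewrite cnjZ -(frK uF (fun q => cnj (N p q)) q) scaler_sumr.
    rewrite exchange_big /=.
    under eq_bigr => b _ do under eq_bigr => q _ do rewrite scalerA.
    under eq_bigr => b _ do rewrite -scaler_suml.
    over.
  by rewrite fr_sum; apply: eq_bigr => b _; rewrite frZ.
transitivity (\sum_a (fr (fun p => cnj (B p)) a *m F) a m).
  under eq_bigr do rewrite -mulmxA mulmxE3.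
  rewrite exchange_big; apply: eq_bigr => a _ /=; rewrite -frMr /fr summxE.
  apply: eq_bigr => p _; rewrite [F^T _ _]mxE mxzE; congr (_ * _).
  by rewrite /cnj -mulmxA uF mulmx1.
transitivity (\sum_k (\sum_a fr (fun p => cnj (B p)) a a k) * F k m).
  under eq_bigr do rewrite mulmxE3.
  by rewrite exchange_big; apply: eq_bigr => k _; rewrite mulr_suml.
rewrite big1 // => k _; rewrite (_ : \sum_a _ = 0) ?mul0r // -[RHS](divergence_eq k).
transitivity (\sum_a (\sum_c Y' a c * ph c a k + \sum_b X' b * dphi t' a b a k)).
  apply: eq_bigr => a _; rewrite frB mxaE !summxE; congr (_ + _).
    by apply: eq_bigr => c _; rewrite mxzE [phm _ _ _]mxE.
  by apply: eq_bigr => c _; rewrite mxzE N'E.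
rewrite big_split; congr (_ + _); rewrite exchange_big; apply: eq_bigr => b _.
by rewrite mulr_sumr.
Qed.
End PointSoliton.

(** * Consequences of closedness at one point *)

Section PointClosed.
Variable R : realFieldType.
Local Notation M7 := 'M[R]_7.
Local Notation ph := (ph R).
Local Notation ps := (ps R).
Local Notation phm := (phm R).
Local Notation psm := (psm R).
Variables u F : M7.
Hypothesis uF : u *m F = 1%:M.
Let Fu : F *m u = 1%:M. Proof. exact: mulmx1C. Qed.
Local Notation g := (u *m u^T).
Local Notation h := (F^T *m F).
Local Notation cnj := (cnj u F).
Local Notation fr := (fr F).
Local Notation low3 := (low3 F).
Variable C : 'I_7 -> M7.
Hypothesis C_frame : forall a, fr (fun j => cnj (C j)) a = phm a.
Variables (t : M7) (N : 'I_7 -> 'I_7 -> M7).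
Hypothesis N_tor : forall p j, N p j = \sum_n t p n *: psim g C n j.
Let n i j k l := (N i j *m g) k l.
Hypothesis N_closed : forall i j k l, n i j k l - n j i k l + n k i j l - n l i j k = 0.

Lemma frame_trace j k : \tr (C j *m C k) = - 6%:R * g j k.
Proof.
have tr_ph a b : \tr (phm a *m phm b) = - 6%:R * dl R a b.
  rewrite mulNr -ph_ph2 -sumrN; apply: eq_bigr => i _; rewrite mxE -sumrN.
  by apply: eq_bigr => l _; rewrite ![phm _ _ _]mxE (phC' _ b i l) mulrN.
have E a b : \tr (phm a *m phm b) = \sum_i \sum_l F a i * F b l * \tr (C i *m C l).
  rewrite -!C_frame -frMr raddf_sum; apply: eq_bigr => p _ /=.
  rewrite mxtraceZ -frMl raddf_sum mulr_sumr; apply: eq_bigr => q _ /=.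
  by rewrite mxtraceZ -(cnjM uF) (tr_cnj uF) mulrA.
pose K : M7 := \matrix_(i, l) \tr (C i *m C l).
have e : F *m K *m F^T = (- 6%:R) *: 1%:M.
  apply/matrixP => a b; rewrite mxzE [1%:M _ _]mxE -/(dl R a b) -tr_ph E mxE.
  rewrite exchange_big; apply: eq_bigr => l _; rewrite [F^T _ _]mxE mxE mulr_suml.
  by apply: eq_bigr => i _; rewrite mxE mulrAC.
have -> : \tr (C j *m C k) = K j k by rewrite mxE.
have -> : K = u *m (F *m K *m F^T) *m u^T.
  by rewrite !mulmxA uF mul1mx -mulmxA -trmx_mul uF trmx1 mulmx1.
by rewrite e -scalemxAr mulmx1 -scalemxAl mxzE.
Qed.

Let t' := cnj t.
(** Frame components of a 4-tensor, kept linear and compatible with index swaps so that d phi = 0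
    passes to the frame as the hypothesis of [closed_torsion]. *)
Definition low4 (f : 'I_7 -> 'I_7 -> 'I_7 -> 'I_7 -> R) a b c e := \sum_i F a i * low3 (f i) b c e.

Lemma low4D f f' a b c e :
  low4 (fun i j k l => f i j k l + f' i j k l) a b c e = low4 f a b c e + low4 f' a b c e.
Proof.
rewrite /low4 -big_split; apply: eq_bigr => i _.
by rewrite /= -mulrDr -low3D.
Qed.
Lemma low4N f a b c e : low4 (fun i j k l => - f i j k l) a b c e = - low4 f a b c e.
Proof.
rewrite /low4 -sumrN; apply: eq_bigr => i _; rewrite -mulrN; congr (_ * _).
by rewrite -mulN1r -low3Z; apply: low3_ext => *; rewrite mulN1r.
Qed.
Lemma low4_swap f a b c e : low4 (fun i j k l => f j i k l) a b c e = low4 f b a c e.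
Proof.
rewrite /low4 /low3; under eq_bigr do rewrite mulr_sumr; rewrite exchange_big.
apply: eq_bigr => j _; rewrite mulr_sumr; apply: eq_bigr => i _; rewrite !mulr_sumr.
apply: eq_bigr => k _; rewrite !mulr_sumr; apply: eq_bigr => l _; ring.
Qed.

Lemma frame_closed a b c e : \sum_m t' a m * ps m b c e - \sum_m t' b m * ps m a c e
  + \sum_m t' c m * ps m a b e - \sum_m t' e m * ps m a b c = 0.
Proof.
have E a' b' c' e' : \sum_m t' a' m * ps m b' c' e' = low4 n a' b' c' e'.
  rewrite -[LHS]/(dphi t' a' b' c' e') -(N'E uF C_frame N_tor).
  rewrite /low4 /fr summxE; apply: eq_bigr => p _.
  by rewrite mxzE -(low3_low uF).
rewrite !E -(low4_swap n a b) -[low4 n c a b e](low4_swap n a c).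
rewrite -[low4 n e a b c](low4_swap n a e).
have s3 : low4 (fun i j k l => n j i k l) a c b e = low4 (fun i j k l => n k i j l) a b c e.
  by apply: eq_bigr => i _; rewrite (low3_swap12 F (fun j k l => n j i k l)).
have s4 : low4 (fun i j k l => n j i k l) a e b c = low4 (fun i j k l => n l i j k) a b c e.
  apply: eq_bigr => i _; rewrite (low3_swap23 F (fun j k l => n k i j l)).
  by rewrite (low3_swap12 F (fun j k l => n j i k l)).
rewrite s3 s4 -!(low4N, low4D) /low4 big1 // => i _; rewrite /low3.
rewrite big1 ?mulr0 // => j _; rewrite big1 // => k _; rewrite big1 // => l _.
by rewrite N_closed !mulr0.
Qed.

Let tE : t *m g = u *m t' *m u^T.
Proof. by rewrite /t' /cnj !mulmxA uF mul1mx. Qed.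

Lemma point_closed_skew : (t *m g)^T = - (t *m g).
Proof.
have [sk _] := closed_torsion frame_closed.
have sk' : t'^T = - t' by apply/matrixP => i j; rewrite mxE mxnE sk.
have tr3 (s : M7) : (u *m s *m u^T)^T = u *m s^T *m u^T by rewrite !trmx_mul trmxK mulmxA.
by rewrite tE tr3 sk' mulmxN mulNmx.
Qed.

Lemma point_closed_trace k : \tr (t *m C k) = 0.
Proof.
have [_ tp] := closed_torsion frame_closed.
rewrite -(frK uF C k) mulmx_sumr raddf_sum big1 // => a _ /=.
rewrite -scalemxAr mxtraceZ -(tr_cnj uF) (cnjM uF).
have -> : cnj (fr C a) = phm a.
  rewrite -C_frame /fr (cnj_sum u F); apply: eq_bigr => p _; exact: cnjZ.
by rewrite -[\tr _]opprK -tr_phm tp oppr0 mulr0.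
Qed.

(** In the frame the sum is T_am psi_makl = - T_am psi_amkl, and psi acts on Lambda^2_14 as - 2.
    This is the origin of d^* phi = - 2 T. *)
Lemma point_closed_divergence : \sum_p \sum_q h p q *: N p q = 2%:R *: t.
Proof.
have [sk tp] := closed_torsion frame_closed.
rewrite -[LHS](cnjK uF) -[RHS](cnjK uF); congr (_ *m _ *m _).
transitivity (\sum_a fr (fun p => fr (fun q => cnj (N p q)) a) a).
  rewrite cnj_sum; under eq_bigr => p _ do rewrite cnj_sum.
  under eq_bigr => p _ do under eq_bigr => q _ do rewrite cnjZ mxE scaler_suml.
  under eq_bigr => p _ do rewrite exchange_big.
  rewrite exchange_big; apply: eq_bigr => a _ /=; apply: eq_bigr => p _.
  rewrite scaler_sumr; apply: eq_bigr => q _; by rewrite [F^T _ _]mxE scalerA.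
rewrite cnjZ; apply/matrixP => k l; rewrite summxE mxzE.
under eq_bigr => a _ do rewrite (N'E uF C_frame N_tor).
have := torsion14_ps sk tp k l => e.
transitivity (- \sum_i \sum_j t' i j * ps i j k l); last by rewrite e mulNr opprK.
rewrite -sumrN; apply: eq_bigr => i _; rewrite -sumrN; apply: eq_bigr => j _.
by rewrite (psC _ i j k l) mulrN.
Qed.
End PointClosed.

(** * Tuple-indexed tensors in adapted components *)

Section LowTensors.
Variable R : realType.
Local Notation E := 'rV[R]_7.
Local Notation ps := (ps R).
Local Notation ph := (ph R).

Lemma pullback_tcons k (A : 'M[R]_7) (w : cotensor R k.+1) j I :
  pullback A w (tcons j I) = \sum_m A j m * pullback A (fun J => w (tcons m J)) I.
Proof.
rewrite {1}/pullback big_tcons; apply: eq_bigr => m _; rewrite mulr_sumr.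
apply: eq_bigr => J _; rewrite big_ord_recl !tnth0.
under eq_bigr do rewrite !tnthS.
by rewrite mulrCA.
Qed.

Lemma pullback0 (A : 'M[R]_7) (w : cotensor R 0) : pullback A w [tuple] = w [tuple].
Proof. by rewrite /pullback big_tuple0 big_ord0 mulr1. Qed.

Lemma tuple1E (a : 'I_7) : [tuple a] = tcons a [tuple]. Proof. exact: val_inj. Qed.
Lemma tuple2E (a b : 'I_7) : [tuple a; b] = tcons a [tuple b]. Proof. exact: val_inj. Qed.
Lemma tuple3E (a b c : 'I_7) : [tuple a; b; c] = tcons a [tuple b; c]. Proof. exact: val_inj. Qed.
Lemma tuple4E (a b c d : 'I_7) : [tuple a; b; c; d] = tcons a [tuple b; c; d]. Proof. exact: val_inj. Qed.

Lemma pullback_tuple1 (A : 'M[R]_7) (w : cotensor R 1) i :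
  pullback A w [tuple i] = \sum_a A i a * w [tuple a].
Proof.
rewrite tuple1E pullback_tcons; apply: eq_bigr => a _.
by rewrite pullback0 -tuple1E.
Qed.
Lemma pullback_tuple2 (A : 'M[R]_7) (w : cotensor R 2) i j :
  pullback A w [tuple i; j] = \sum_a \sum_b A i a * (A j b * w [tuple a; b]).
Proof.
rewrite tuple2E pullback_tcons; apply: eq_bigr => a _.
rewrite pullback_tuple1 mulr_sumr; apply: eq_bigr => b _.
by rewrite -tuple2E.
Qed.
Lemma pullback_tuple3 (A : 'M[R]_7) (w : cotensor R 3) i j k :
  pullback A w [tuple i; j; k] = low3 A (fun a b c => w [tuple a; b; c]) i j k.
Proof.
rewrite tuple3E pullback_tcons; apply: eq_bigr => a _.
rewrite pullback_tuple2 mulr_sumr; apply: eq_bigr => b _; rewrite mulr_sumr.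
by apply: eq_bigr => c _; rewrite -tuple3E.
Qed.

Lemma pullback_alternating k (A : 'M[R]_7) (w : cotensor R k) :
  alternating w -> alternating (pullback A w).
Proof.
move=> aw s I; rewrite /pullback mulr_sumr.
rewrite (reindex_onto (tperm_idx s) (tperm_idx s^-1%g)) /=; last first.
  by move=> J _; apply: eq_from_tnth => l; rewrite !tnth_mktuple permK.
rewrite (eq_bigl xpredT); last first.
  by move=> J; apply/eqP/eq_from_tnth => l; rewrite !tnth_mktuple permKV.
apply: eq_bigr => J _; rewrite aw -mulrA; congr (_ * (_ * _)).
rewrite [RHS](reindex_inj (@perm_inj _ s)) /=; apply: eq_bigr => l _.
by rewrite !tnth_mktuple.
Qed.

Lemma iprod_alternating k (v : E) (w : cotensor R k.+1) : alternating w -> alternating (iprod v w).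
Proof.
move=> aw s I; rewrite /iprod mulr_sumr; apply: eq_bigr => m _.
rewrite mulrCA; congr (_ * _).
have -> : tcons m (tperm_idx s I) = tperm_idx (lift_perm ord0 ord0 s) (tcons m I).
  apply: eq_from_tnth => l; rewrite tnth_mktuple; case: (unliftP ord0 l) => [j ->|->].
    by rewrite lift_perm_lift !tnthS tnth_mktuple.
  by rewrite lift_perm_id !tnth0.
by rewrite aw odd_lift_perm.
Qed.

Section AtPoint.
Variables (phi : E -> cotensor R 3) (x : E) (u F : 'M[R]_7).
Hypothesis uF : u *m F = 1%:M.
Hypothesis phiE : phi x = pullback u (@phi0 R).
Hypothesis gE : gmet phi x = u *m u^T.
Hypothesis nuE : gvol phi x = \det u.
Let Fu : F *m u = 1%:M. Proof. exact: mulmx1C. Qed.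
Let uu : u \in unitmx. Proof. by have [] := mulmx1_unit uF. Qed.

Lemma ginv_frame : invmx (gmet phi x) = F^T *m F.
Proof.
have H : gmet phi x *m (F^T *m F) = 1%:M.
  by rewrite gE -mulmxA (mulmxA u^T) -trmx_mul Fu trmx1 mul1mx.
have gu : gmet phi x \in unitmx by have [] := mulmx1_unit H.
by rewrite -[RHS]mul1mx -(mulVmx gu) -mulmxA H mulmx1.
Qed.

Lemma raise_psi_frame I : raise (gmet phi x) (psi phi x) I = pullback F^T (star 4 1%:M 1 (@phi0 R)) I.
Proof.
rewrite /raise ginv_frame.
transitivity (pullback (F^T *m F) (pullback u (star 4 1%:M 1 (@phi0 R))) I).
  by apply: eq_pullback => J; rewrite /psi gE nuE phiE pullback_star.
by rewrite pullback_comp -mulmxA Fu mulmx1.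
Qed.

(** Puts the definition of the torsion into the shape of the coefficients in [point_torsion], so
    that the two can be identified. *)
Lemma torsion_mixed_frame i j : torsion_mixed phi i j x =
  \sum_m (24%:R^-1 * \sum_a \sum_b \sum_c
    low3 F (fun k l n => nabla (gmet phi) phi i x [tuple k; l; n]) a b c * ps m a b c) * F m j.
Proof.
rewrite /torsion_mixed; under eq_bigr do rewrite raise_psi_frame pullback_tcons mulr_sumr.
rewrite exchange_big mulr_sumr; apply: eq_bigr => m _ /=.
rewrite -mulrA; congr (_ * _); rewrite [F^T _ _]mxE.
under eq_bigr do rewrite mulrCA; rewrite -mulr_sumr mulrC; congr (_ * _).
rewrite -pullback_adjoint big_tuple3; do 3! apply: eq_bigr => ? _.
by rewrite pullback_tuple3 -tuple4E star_phi0.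
Qed.

Lemma phi_tuple_frame i j k : phi x [tuple i; j; k] = low3 u ph i j k.
Proof.
rewrite phiE pullback_tuple3; apply: low3_ext => a b c; exact: phi0_ph.
Qed.

Lemma phi_frame a b c : low3 F (fun i j k => phi x [tuple i; j; k]) a b c = ph a b c.
Proof. by rewrite -pullback_tuple3 phiE pullback_comp Fu pullback1 phi0_ph. Qed.
End AtPoint.
End LowTensors.

Arguments ev : simpl never.

Section SmallSums.
Variable V : nmodType.
Lemma sum_ord2 (f : 'I_2 -> V) : \sum_l f l = f ord0 + f (lift ord0 ord0).
Proof. by rewrite !big_ord_recl big_ord0 addr0. Qed.
Lemma sum_ord3 (f : 'I_3 -> V) :
  \sum_l f l = f ord0 + (f (lift ord0 ord0) + f (lift ord0 (lift ord0 ord0))).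
Proof. by rewrite !big_ord_recl big_ord0 addr0. Qed.
Lemma sum_ord4 (f : 'I_4 -> V) :
  \sum_l f l = f ord0 + (f (lift ord0 ord0) + (f (lift ord0 (lift ord0 ord0))
    + f (lift ord0 (lift ord0 (lift ord0 ord0))))).
Proof. by rewrite !big_ord_recl big_ord0 addr0. Qed.
End SmallSums.

(** * The tensor fields of a chart *)

Section Chart.
Variables (R : realType) (U : set 'rV[R]_7) (Uo : open U).
Local Notation E := 'rV[R]_7.
Local Notation A := (smooth_fun Uo).
Local Notation d := (@sfun_d R U Uo).
Local Notation ph := (ph R).
Local Notation ps := (ps R).
Local Notation phm := (phm R).
Variable phi : E -> cotensor R 3.
Hypothesis phi_smooth : forall I, smooth_on U (fun x => phi x I).
Hypothesis phi_G2 : forall x, U x -> exists2 u : 'M[R]_7, u \in unitmx & phi x = pullback u (@phi0 R).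
Hypothesis phi_closed : forall x, U x -> forall I, ext_d phi x I = 0.

Definition half : A := sfun_cst Uo 2^-1.
Lemma halfP : half + half = 1.
Proof.
apply: sfun_eq => x Ux; rewrite -(repsD (reps_cst Uo 2^-1) (reps_cst Uo 2^-1) Ux).
by rewrite -[RHS]/(ev Ux 1) rmorph1; field.
Qed.

Lemma ev_mk x (Ux : U x) f (sf : smoothc U f) : ev Ux (mk_sfun Uo sf) = f x.
Proof. exact: (esym (reps_mk Uo sf Ux)). Qed.
Lemma ev_cst x (Ux : U x) c : ev Ux (sfun_cst Uo c) = c.
Proof. exact: (esym (reps_cst Uo c Ux)). Qed.
Lemma ev_d x (Ux : U x) i f a : reps f a -> ev Ux (d i a) = pd i f x.
Proof. by move=> fa; exact: (esym (reps_pd i fa Ux)). Qed.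
Lemma ev_eq (a b : A) : (forall x (Ux : U x), ev Ux a = ev Ux b) -> a = b.
Proof. by move=> e; apply: sfun_eq => x Ux; exact: e Ux. Qed.
Lemma reps_ev f (a : A) : (forall x (Ux : U x), f x = ev Ux a) -> reps f a.
Proof. by move=> e x Ux; exact: e Ux. Qed.
Lemma reps_smoothc f (a : A) : reps f a -> smoothc U f.
Proof. by move=> fa; apply: (Smoothc_ext _ (sfun_smoothc a)) => x Ux; rewrite fa. Qed.

Local Notation evm Ux := (map_mx (ev Ux)).
Lemma evm_eq m n (B B' : 'M[A]_(m, n)) : (forall x (Ux : U x), evm Ux B = evm Ux B') -> B = B'.
Proof.
move=> e; apply/matrixP => i j; apply: ev_eq => x Ux.
by have := congr1 (fun C : 'M[R]_(m, n) => C i j) (e x Ux); rewrite !mxE.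
Qed.

Definition phiA I : A := mk_sfun Uo (Smoothc_smooth (phi_smooth I)).
Definition gA : 'M[A]_7 := \matrix_(i, j) mk_sfun Uo (smoothc_gmet phi_smooth phi_G2 i j).
Definition hA : 'M[A]_7 := \matrix_(i, j) mk_sfun Uo (smoothc_ginv phi_smooth phi_G2 i j).
Definition nuA : A := mk_sfun Uo (smoothc_gvol phi_smooth phi_G2).
Definition nuVA : A := nuA * mk_sfun Uo (smoothc_gvol2V phi_smooth phi_G2).
Definition PA j : 'M[A]_7 := \matrix_(k, l) phiA [tuple j; k; l].
Definition CA j : 'M[A]_7 := PA j *m hA.

Lemma ev_phiA x (Ux : U x) I : ev Ux (phiA I) = phi x I. Proof. exact: ev_mk. Qed.
Lemma ev_nuA x (Ux : U x) : ev Ux nuA = gvol phi x. Proof. exact: ev_mk. Qed.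
Lemma evm_gA x (Ux : U x) : evm Ux gA = gmet phi x.
Proof. by apply/matrixP => i j; rewrite !mxE; exact: ev_mk. Qed.
Lemma evm_hA x (Ux : U x) : evm Ux hA = invmx (gmet phi x).
Proof. by apply/matrixP => i j; rewrite !mxE; exact: ev_mk. Qed.

Lemma gmet_sym x : U x -> (gmet phi x)^T = gmet phi x.
Proof. by move=> /(g2_frame phi_G2)[u _ [_ -> _]]; rewrite trmx_mul trmxK. Qed.

Lemma gA_sym : gA^T = gA.
Proof. by apply: evm_eq => x Ux; rewrite -map_trmx evm_gA gmet_sym. Qed.
Lemma hA_sym : hA^T = hA.
Proof. by apply: evm_eq => x Ux; rewrite -map_trmx evm_hA trmx_inv gmet_sym. Qed.
Lemma hgA : hA *m gA = 1%:M.
Proof.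
apply: evm_eq => x Ux; rewrite map_mxM map_mx1 evm_hA evm_gA mulVmx //.
exact: (gmet_unit phi_G2).
Qed.
Lemma nuA_sqr : nuA * nuA = \det gA.
Proof.
apply: ev_eq => x Ux; rewrite rmorphM /= ev_nuA -det_map_mx evm_gA.
by rewrite (det_gmet phi_G2).
Qed.
Lemma nuAV : nuA * nuVA = 1.
Proof.
apply: ev_eq => x Ux; rewrite !rmorphM rmorph1 /= ev_nuA (ev_mk Ux (smoothc_gvol2V _ _)).
have := gvol_neq0 phi_G2 Ux; move: (gvol phi x) => n n0; field; exact: n0.
Qed.

Local Notation gam := (@gam A d half gA hA).
Local Notation nab := (@nab A d half gA hA).
Local Notation del := (@del A d half gA hA).
Local Notation curv := (@curv A d half gA hA).
Let dD := @sfun_dD R U Uo.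
Let dM := @sfun_dM R U Uo.
Let dC := @sfun_dC R U Uo.

Lemma d_nuA p : d p nuA = nuA * \tr (gam p).
Proof. exact: (volume_derivative dD dM halfP gA_sym hA_sym hgA nuA_sqr nuAV). Qed.

Lemma CA_low j : CA j *m gA = PA j.
Proof. by rewrite /CA -mulmxA hgA mulmx1. Qed.
Lemma CA_lowE j k l : (CA j *m gA) k l = phiA [tuple j; k; l].
Proof. by rewrite CA_low mxE. Qed.

Lemma reps_phi I : reps (fun x => phi x I) (phiA I). Proof. exact: reps_mk. Qed.
Lemma reps_g i j : reps (fun x => gmet phi x i j) (gA i j).
Proof. by apply: reps_ev => x Ux; rewrite -(evm_gA Ux) mxE. Qed.
Lemma reps_h i j : reps (fun x => invmx (gmet phi x) i j) (hA i j).
Proof. by apply: reps_ev => x Ux; rewrite -(evm_hA Ux) mxE. Qed.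

Lemma reps_christoffel i j k : reps (christoffel (gmet phi) i j k) (gam i j k).
Proof.
rewrite mxE; apply: repsM; first exact: reps_cst.
apply: reps_sum => l; apply: repsM; first exact: reps_h.
apply: repsB; first by apply: repsD; exact/reps_pd/reps_g.
exact/reps_pd/reps_g.
Qed.

Lemma phi_swap x : U x -> forall i j k, phi x [tuple j; i; k] = - phi x [tuple i; j; k].
Proof.
move=> /(g2_frame phi_G2)[u uu [e _ _]] i j k.
rewrite !(phi_tuple_frame e) -(low3_swap12 u ph i j) -mulN1r -low3Z.
by apply: low3_ext => a b c; rewrite phC mulN1r.
Qed.
Lemma phi_swap' x : U x -> forall i j k, phi x [tuple i; k; j] = - phi x [tuple i; j; k].
Proof.
move=> /(g2_frame phi_G2)[u uu [e _ _]] i j k.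
rewrite !(phi_tuple_frame e) -(low3_swap23 u ph i j) -mulN1r -low3Z.
by apply: low3_ext => a b c; rewrite phC' mulN1r.
Qed.

Lemma CA_swap i j k : (CA j *m gA) i k = - (CA i *m gA) j k.
Proof. by rewrite !CA_lowE; apply: ev_eq => x Ux; rewrite rmorphN /= !ev_phiA phi_swap. Qed.
Lemma CA_swap' i j k : (CA i *m gA) k j = - (CA i *m gA) j k.
Proof. by rewrite !CA_lowE; apply: ev_eq => x Ux; rewrite rmorphN /= !ev_phiA phi_swap'. Qed.

Lemma tsubst3 (i j k m : 'I_7) :
  [/\ tsubst [tuple i; j; k] ord0 m = [tuple m; j; k],
      tsubst [tuple i; j; k] (lift ord0 ord0) m = [tuple i; m; k]
    & tsubst [tuple i; j; k] (lift ord0 (lift ord0 ord0)) m = [tuple i; j; m]].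
Proof. by rewrite /tsubst !mktuple3 !(tnth_nth ord0) /=; split. Qed.

Lemma reps_nabla p j k l :
  reps (fun x => nabla (gmet phi) phi p x [tuple j; k; l]) ((nab CA p j *m gA) k l).
Proof.
have e := d_three_form dD dM halfP gA_sym hA_sym hgA CA p j k l.
have -> : (nab CA p j *m gA) k l = d p (phiA [tuple j; k; l])
    - (\sum_m gam p j m * phiA [tuple m; k; l] + (\sum_m gam p k m * phiA [tuple j; m; l]
    + \sum_m gam p l m * phiA [tuple j; k; m])).
  rewrite CA_lowE in e; under eq_bigr do rewrite -CA_lowE.
  under [X in _ - (_ + (X + _))]eq_bigr do rewrite -CA_lowE.
  under [X in _ - (_ + (_ + X))]eq_bigr do rewrite -CA_lowE.
  have h5 (a b c e' f : A) : a = b + c + e' + f -> b = a - (c + (e' + f)) by move=> ->; ring.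
  exact: h5.
apply: repsB; first exact/reps_pd/reps_phi.
apply: (@reps_ext _ _ _ (fun x => \sum_m christoffel (gmet phi) p j m x * phi x [tuple m; k; l]
   + (\sum_m christoffel (gmet phi) p k m x * phi x [tuple j; m; l]
   + \sum_m christoffel (gmet phi) p l m x * phi x [tuple j; k; m]))).
  move=> x _; rewrite sum_ord3 !(tnth_nth ord0) /=; congr (_ + (_ + _));
  by apply: eq_bigr => m _; have [e1 e2 e3] := tsubst3 j k l m; rewrite ?e1 ?e2 ?e3.
have rs i F (B : 'I_7 -> A) : (forall m, reps (F m) (B m)) ->
   reps (fun x => \sum_m christoffel (gmet phi) p i m x * F m x) (\sum_m gam p i m * B m).
  by move=> FB; apply: reps_sum => m; apply: repsM; [exact: reps_christoffel|exact: FB].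
by do 2?apply: repsD; apply: rs => m; exact: reps_phi.
Qed.

Lemma reps_ricci i j : reps (ricci (gmet phi) i j) (\sum_k curv k j i k).
Proof.
apply: reps_sum => k.
rewrite (curv_entry d half hA gA_sym).
apply: repsD; first by apply: repsB; exact/reps_pd/reps_christoffel.
by apply: reps_sum => l; apply: repsB; apply: repsM; exact: reps_christoffel.
Qed.

Let gA_s := gA_sym.
Let hA_s := hA_sym.
Let hg_A := hgA.

Lemma smoothc_raise k (w : E -> cotensor R k) I : (forall I, smoothc U (fun x => w x I)) ->
  smoothc U (fun x => raise (gmet phi x) (w x) I).
Proof.
move=> sw; apply: smoothc_sum => J; apply: Smoothc_mul => //.
by apply: smoothc_prod => l; apply: smoothc_ginv.
Qed.

Lemma smoothc_psi I : smoothc U (fun x => psi phi x I).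
Proof.
apply: smoothc_scale; apply: smoothc_sum => J; apply: Smoothc_mul.
  by apply: smoothc_raise => K; exact: Smoothc_smooth.
apply: Smoothc_mul; last exact: Smoothc_cst.
exact: smoothc_gvol.
Qed.

Lemma smoothc_torsion i j : smoothc U (torsion_mixed phi i j).
Proof.
apply: smoothc_scale; apply: smoothc_sum => I; apply: Smoothc_mul; last first.
  by apply: smoothc_raise => K; exact: smoothc_psi.
have -> : I = [tuple tnth I ord0; tnth I (lift ord0 ord0); tnth I ord_max].
  by rewrite -(mktuple3 (tnth I)); apply: eq_from_tnth => l; rewrite tnth_mktuple.
exact: reps_smoothc (reps_nabla _ _ _ _).
Qed.

Definition tA : 'M[A]_7 := \matrix_(i, j) mk_sfun Uo (smoothc_torsion i j).
Lemma reps_t i j : reps (torsion_mixed phi i j) (tA i j).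
Proof. by rewrite mxE; exact: reps_mk. Qed.
Lemma ev_t x (Ux : U x) i j : evm Ux tA i j = torsion_mixed phi i j x.
Proof. by rewrite mxE; exact: (esym (reps_t i j Ux)). Qed.

Section Point.
Variables (x : E) (Ux : U x) (u F : 'M[R]_7).
Hypothesis uF : u *m F = 1%:M.
Hypothesis phiE : phi x = pullback u (@phi0 R).
Hypothesis gE : gmet phi x = u *m u^T.
Hypothesis nuE : gvol phi x = \det u.
Let Cx j := evm Ux (CA j).

Lemma Cx_low i j k : (Cx i *m (u *m u^T)) j k = phi x [tuple i; j; k].
Proof. by rewrite -gE -(evm_gA Ux) -map_mxM CA_low mxE [PA _ _ _]mxE /= ev_phiA. Qed.

Lemma Cx_frame a : fr F (fun j => cnj u F (Cx j)) a = phm a.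
Proof.
apply/matrixP => b c; rewrite -(low3_low uF) [RHS]mxE -(phi_frame uF phiE).
by apply: low3_ext => i j k; exact: Cx_low.
Qed.

Lemma trace_point j k : \tr (Cx j *m Cx k) = - 6%:R * gmet phi x j k.
Proof. by rewrite gE (frame_trace uF Cx_frame). Qed.
End Point.

Lemma trace_CA j k : \tr (CA j *m CA k) = sfun_cst Uo (- 6%:R) * gA j k.
Proof.
apply: ev_eq => x Ux; have [u uu [e1 e2 e3]] := g2_frame phi_G2 Ux.
have -> : ev Ux (\tr (CA j *m CA k)) = \tr (evm Ux (CA j) *m evm Ux (CA k)).
  by rewrite -map_mxM -trace_map_mx.
rewrite (trace_point Ux (mulmxV uu) e1 e2) rmorphM /= ev_cst; congr (_ * _).
by rewrite -(evm_gA Ux) mxE.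
Qed.

Lemma nab_trace_CA p j k : \tr (nab CA p j *m CA k) + \tr (CA j *m nab CA p k) = 0.
Proof.
apply: (nab_trace dD dM halfP gA_s hA_s hg_A trace_CA) => q.
apply: ev_eq => x Ux; rewrite (ev_d Ux q (reps_cst Uo _)) pd_cst.
by rewrite rmorph0.
Qed.

Lemma nabCA_swap p i j k : (nab CA p j *m gA) i k = - (nab CA p i *m gA) j k.
Proof. exact: (nab_swap dD dM halfP gA_s hA_s hg_A CA_swap). Qed.
Lemma nabCA_swap' p i j k : (nab CA p i *m gA) k j = - (nab CA p i *m gA) j k.
Proof. exact: (nab_swap' dD dM halfP gA_s hA_s hg_A CA_swap'). Qed.

Lemma nab_CA_point x (Ux : U x) (u F : 'M[R]_7) p j : u *m F = 1%:M ->
  phi x = pullback u (@phi0 R) -> gmet phi x = u *m u^T -> gvol phi x = \det u ->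
  evm Ux (nab CA p j) = \sum_n evm Ux tA p n *: psim (u *m u^T) (fun q => evm Ux (CA q)) n j.
Proof.
move=> uF e1 e2 e3.
have low i k l : (evm Ux (nab CA p i) *m (u *m u^T)) k l = ev Ux ((nab CA p i *m gA) k l).
  by rewrite -e2 -(evm_gA Ux) -map_mxM mxE.
rewrite [LHS](@point_torsion _ u F uF _ (Cx_frame Ux uF e1 e2) (fun i => evm Ux (nab CA p i))).
- apply: eq_bigr => n _; congr (_ *: _); rewrite ev_t (torsion_mixed_frame uF e1 e2 e3).
  apply: eq_bigr => m _; congr (_ * _ * _); do 3! apply: eq_bigr => ? _; congr (_ * _).
  by apply: low3_ext => i k l; rewrite low (reps_nabla p i k l Ux).
- move=> i k l; have e := congr1 (ev Ux) (nabCA_swap p i k l).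
  exact: etrans (low k i l) (etrans e (etrans (rmorphN _ _) (esym (congr1 -%R (low i k l))))).
- move=> i k l; have e := congr1 (ev Ux) (nabCA_swap' p i k l).
  exact: etrans (low i l k) (etrans e (etrans (rmorphN _ _) (esym (congr1 -%R (low i k l))))).
- move=> i k; rewrite -!map_mxM !trace_map_mx -rmorphD /= nab_trace_CA.
  exact: rmorph0.
Qed.

Lemma faces4 (i j k l : 'I_7) (I := [tuple i; j; k; l]) :
  [/\ [tuple tnth I (lift ord0 r) | r < 3] = [tuple j; k; l],
      [tuple tnth I (lift (lift ord0 ord0) r) | r < 3] = [tuple i; k; l],
      [tuple tnth I (lift (lift ord0 (lift ord0 ord0)) r) | r < 3] = [tuple i; j; l]
    & [tuple tnth I (lift (lift ord0 (lift ord0 (lift ord0 ord0))) r) | r < 3] = [tuple i; j; k]].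
Proof. by rewrite !mktuple3 /I !(tnth_nth ord0) /=; split. Qed.

Lemma nab_closed i j k l : (nab CA i j *m gA) k l - (nab CA j i *m gA) k l
  + (nab CA k i *m gA) j l - (nab CA l i *m gA) j k = 0.
Proof.
have := ext_three_form dD dM halfP gA_s hA_s hg_A CA_swap CA_swap' i j k l.
move=> <-; rewrite !CA_lowE; apply: ev_eq => x Ux.
rewrite raddfB raddfD raddfB raddf0 /= !(ev_d Ux _ (reps_phi _)).
have := phi_closed Ux [tuple i; j; k; l].
have [e1 e2 e3 e4] := faces4 i j k l.
rewrite /ext_d sum_ord4 e1 e2 e3 e4 !(tnth_nth ord0) /= expr0 !exprS expr0 !mulr1 mulrN1 opprK.
have h4 (a b c e : R) : 1 * a + (- 1 * b + (1 * c + - 1 * 1 * e)) = a - b + c - e by ring.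
by rewrite h4.
Qed.

Section PointNabla.
Variables (x : E) (Ux : U x) (u F : 'M[R]_7).
Hypothesis uF : u *m F = 1%:M.
Hypothesis phiE : phi x = pullback u (@phi0 R).
Hypothesis gE : gmet phi x = u *m u^T.
Hypothesis nuE : gvol phi x = \det u.
Let Cx j := evm Ux (CA j).
Let Nx i j := evm Ux (nab CA i j).

Lemma Nx_tor p j : Nx p j = \sum_n evm Ux tA p n *: psim (u *m u^T) Cx n j.
Proof. exact: (nab_CA_point Ux p j uF phiE gE nuE). Qed.

Lemma Nx_closed i j k l : (Nx i j *m (u *m u^T)) k l - (Nx j i *m (u *m u^T)) k l
  + (Nx k i *m (u *m u^T)) j l - (Nx l i *m (u *m u^T)) j k = 0.
Proof.
have low a b c e : (Nx a b *m (u *m u^T)) c e = ev Ux ((nab CA a b *m gA) c e).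
  by rewrite -gE -(evm_gA Ux) -map_mxM mxE.
have := congr1 (ev Ux) (nab_closed i j k l); rewrite raddfB raddfD raddfB raddf0 /=.
move=> <-; congr (_ - _ + _ - _); exact: low.
Qed.
End PointNabla.

(** Proved at each point in a frame chosen there; as an equality over the ring of smooth functions
    it no longer mentions frames and can be differentiated in [nab_torsion_comm]. *)
Lemma nab_torsion p j : nab CA p j = \sum_n tA p n *: psim gA CA n j.
Proof.
apply: evm_eq => x Ux; have [u uu [e1 e2 e3]] := g2_frame phi_G2 Ux.
rewrite (nab_CA_point Ux p j (mulmxV uu) e1 e2 e3) map_lincomb.
apply: eq_bigr => n _; rewrite map_psim evm_gA e2; congr (_ *: _).
by rewrite mxE.
Qed.

Lemma tA_skew : (tA *m gA)^T = - (tA *m gA).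
Proof.
apply: evm_eq => x Ux; have [u uu [e1 e2 e3]] := g2_frame phi_G2 Ux; have uF := mulmxV uu.
rewrite -map_trmx map_mxN map_mxM evm_gA e2.
exact: (point_closed_skew uF (Cx_frame Ux uF e1 e2) (Nx_tor Ux uF e1 e2 e3) (Nx_closed Ux e2)).
Qed.

Lemma tA_trace k : \tr (tA *m CA k) = 0.
Proof.
apply: ev_eq => x Ux; have [u uu [e1 e2 e3]] := g2_frame phi_G2 Ux; have uF := mulmxV uu.
rewrite -[LHS]trace_map_mx map_mxM raddf0.
exact: (point_closed_trace uF (Cx_frame Ux uF e1 e2) (Nx_tor Ux uF e1 e2 e3) (Nx_closed Ux e2)).
Qed.

Lemma tA_divergence : \sum_p \sum_q hA p q *: nab CA p q = 2%:R *: tA.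
Proof.
apply: evm_eq => x Ux; have [u uu [e1 e2 e3]] := g2_frame phi_G2 Ux; have uF := mulmxV uu.
rewrite map_mxZ rmorph_nat.
rewrite -(point_closed_divergence uF (Cx_frame Ux uF e1 e2) (Nx_tor Ux uF e1 e2 e3) (Nx_closed Ux e2)).
rewrite map_mx_sum; apply: eq_bigr => p _; rewrite map_lincomb; apply: eq_bigr => q _.
by congr (_ *: _); rewrite -(ginv_frame uF e2) -(evm_hA Ux) [RHS]mxE.
Qed.
End Chart.

(** * The soliton equation in a chart *)

Section ChartSoliton.
Variables (R : realType) (U : set 'rV[R]_7) (Uo : open U).
Local Notation E := 'rV[R]_7.
Local Notation A := (smooth_fun Uo).
Local Notation d := (@sfun_d R U Uo).
Variable phi : E -> cotensor R 3.
Hypothesis phi_smooth : forall I, smooth_on U (fun x => phi x I).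
Hypothesis phi_G2 : forall x, U x -> exists2 u : 'M[R]_7, u \in unitmx & phi x = pullback u (@phi0 R).
Hypothesis phi_closed : forall x, U x -> forall I, ext_d phi x I = 0.
Hypothesis phi_alt : forall x, U x -> alternating (phi x).
Local Notation evm Ux := (map_mx (ev Ux)).
Local Notation half := (@half R U Uo).
Local Notation gA := (gA Uo phi_smooth phi_G2).
Local Notation hA := (hA Uo phi_smooth phi_G2).
Local Notation nuA := (nuA Uo phi_smooth phi_G2).
Local Notation CA := (CA Uo phi_smooth phi_G2).
Local Notation tA := (tA Uo phi_smooth phi_G2).
Local Notation phiA := (phiA Uo phi_smooth).
Local Notation nab := (@nab A d half gA hA).
Local Notation del := (@del A d half gA hA).
Local Notation curv := (@curv A d half gA hA).
Let dD := @sfun_dD R U Uo.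
Let dM := @sfun_dM R U Uo.
Let dC := @sfun_dC R U Uo.
Let halfP := @halfP R U Uo.
Let gA_s := gA_sym Uo phi_smooth phi_G2.
Let hA_s := hA_sym Uo phi_smooth phi_G2.
Let hg_A := hgA Uo phi_smooth phi_G2.
Let d_nu := d_nuA Uo phi_smooth phi_G2.

Lemma sum_conj (B K : 'M[R]_7) j k :
  \sum_a \sum_b B j a * (B k b * K a b) = (B *m K *m B^T) j k.
Proof.
rewrite exchange_big mxE; apply: eq_bigr => b _; rewrite [B^T _ _]mxE mxE mulr_suml.
by apply: eq_bigr => a _; rewrite mulrCA [RHS]mulrC.
Qed.

(** phi with all three indices raised, the tensor whose density [divergence_three_form]
    differentiates. *)
Let W p := \sum_q hA p q *: (hA *m CA q).

Lemma W_entry p a b : W p a b =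
  \sum_i \sum_j \sum_k hA p i * (hA a j * (hA b k * phiA [tuple i; j; k])).
Proof.
rewrite /W summxE; apply: eq_bigr => i _; rewrite mxzE.
rewrite /CA mulmxA mulmxE3 mulr_sumr exchange_big; apply: eq_bigr => k _ /=.
rewrite mulmxE3 mulr_suml mulr_sumr; apply: eq_bigr => j _.
rewrite [PA _ _ _ _ _]mxE (hE hA_s b k).
have h4 (x y z w : A) : x * (y * z * w) = x * (y * (w * z)) by ring.
exact: h4.
Qed.

Lemma reps_raise_phi p a b : reps (fun y => raise (gmet phi y) (phi y) [tuple p; a; b]) (W p a b).
Proof.
rewrite W_entry.
apply: (@reps_ext _ _ _ (fun y => \sum_i \sum_j \sum_k invmx (gmet phi y) p i *
  (invmx (gmet phi y) a j * (invmx (gmet phi y) b k * phi y [tuple i; j; k])))).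
  by move=> y _; rewrite /raise pullback_tuple3.
do 3! apply: reps_sum => ?.
by repeat apply: repsM; try exact: reps_h; exact: reps_phi.
Qed.

Lemma raise_phi_low y p a b : raise (gmet phi y) (phi y) [tuple p; a; b] =
  low3 (invmx (gmet phi y)) (fun i j k => phi y [tuple i; j; k]) p a b.
Proof. exact: pullback_tuple3. Qed.

Lemma W_swap p j k : W j p k = - W p j k.
Proof.
apply: ev_eq => x Ux; rewrite rmorphN -[LHS](reps_raise_phi j p k Ux).
rewrite -[RHS](congr1 -%R (reps_raise_phi p j k Ux)) !raise_phi_low.
rewrite -(low3_swap12 _ _ p j) -mulN1r -low3Z; apply: low3_ext => a b c.
by rewrite (phi_swap phi_G2 Ux) mulN1r.
Qed.

Lemma W_swap' p j k : W p k j = - W p j k.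
Proof.
apply: ev_eq => x Ux; rewrite rmorphN -[LHS](reps_raise_phi p k j Ux).
rewrite -[RHS](congr1 -%R (reps_raise_phi p j k Ux)) !raise_phi_low.
rewrite -(low3_swap23 _ _ p j) -mulN1r -low3Z; apply: low3_ext => a b c.
by rewrite (phi_swap' phi_G2 Ux) mulN1r.
Qed.

Lemma div_W j k : \sum_p d p (nuA * W p j k) = nuA * (2%:R *: (hA *m tA)) j k.
Proof.
rewrite (divergence_three_form dD dM halfP gA_s hA_s hg_A d_nu W_swap W_swap').
congr (_ * fun_of_matrix _ j k).
rewrite scalemxAr -(tA_divergence Uo phi_smooth phi_G2 phi_closed) mulmx_sumr.
apply: eq_bigr => p _; rewrite mulmx_sumr; apply: eq_bigr => q _.
by rewrite scalemxAr.
Qed.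

Lemma codiff_tensor k (w : E -> cotensor R k.+1) x J : (k <= 6)%N ->
  (forall I, smoothc U (fun y => w y I)) -> (forall y, U y -> alternating (w y)) -> U x ->
  codiff (gmet phi) (gvol phi) w x J = - ((gvol phi x)^-1 *
    pullback (gmet phi x) (fun J' => \sum_p
      pd p (fun y => gvol phi y * raise (gmet phi y) (w y) (tcons p J')) x) J).
Proof.
move=> k6 sw aw Ux; apply: (codiffE Uo _ _ _ _ k6) => //.
- exact: gmet_sym.
- exact: det_gmet.
- exact: gvol_neq0.
- move=> I; apply: Smoothc_mul; first exact: smoothc_gvol.
  exact: smoothc_raise.
- by move=> y Uy; apply: pullback_alternating; exact: aw.
Qed.

(** The divergence of the raised phi is 2 T with its first index raised ([div_W]); lowering both
    indices leaves T g, and the minus sign is that of [codiffE]. *)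
Lemma reps_codiff_phi j k :
  reps (fun x => codiff (gmet phi) (gvol phi) phi x [tuple j; k]) (- (2%:R * (tA *m gA) j k)).
Proof.
move=> x Ux; rewrite codiff_tensor //; last by move=> I; exact: Smoothc_smooth.
rewrite pullback_tuple2.
have E1 a b : \sum_p pd p (fun y => gvol phi y * raise (gmet phi y) (phi y) (tcons p [tuple a; b])) x
   = gvol phi x * (2%:R *: (invmx (gmet phi x) *m evm Ux tA)) a b.
  transitivity (ev Ux (\sum_p d p (nuA * W p a b))).
    rewrite raddf_sum; apply: eq_bigr => p _ /=; symmetry; apply: ev_d.
    apply: repsM; first exact: reps_mk.
    by rewrite -tuple3E; exact: reps_raise_phi.
  rewrite div_W rmorphM /= ev_nuA; congr (_ * _).
  rewrite -(evm_hA Uo phi_smooth phi_G2 Ux) -map_mxM 2!mxzE rmorphM rmorph_nat.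
  by rewrite [X in _ = _ * X]mxE.
have h4 (a b c e : R) : a * (b * (c * e)) = c * (a * (b * e)) by ring.
under eq_bigr => a _ do under eq_bigr => b _ do rewrite E1 h4.
under eq_bigr => a _ do rewrite -mulr_sumr.
rewrite -mulr_sumr mulrA mulVf ?(gvol_neq0 phi_G2) // mul1r sum_conj.
rewrite -scalemxAr -scalemxAl mxzE (gmet_sym phi_G2 Ux) mulmxA mulmxV ?(gmet_unit phi_G2) // mul1mx.
rewrite -[RHS]/(ev Ux _) raddfN /= rmorphM rmorph_nat /=; congr (- (_ * _)).
by rewrite -(evm_gA Uo phi_smooth phi_G2 Ux) -map_mxM mxE.
Qed.

(** Vanishing is known on U only, so openness of U is what makes the derivative inside [codiff]
    vanish at x. *)
Lemma codiff_zero k (w : E -> cotensor R k.+1) x I : (forall y, U y -> forall J, w y J = 0) ->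
  U x -> codiff (gmet phi) (gvol phi) w x I = 0.
Proof.
move=> w0 Ux; have star0 n m g nu (z : cotensor R n) J : (forall I, z I = 0) -> star m g nu z J = 0.
  move=> z0; rewrite /star big1 ?mulr0 // => K _.
  by rewrite /raise /pullback big1 ?mul0r // => L _; rewrite z0 mul0r.
rewrite /codiff star0 ?mulr0 // => K; rewrite /ext_d big1 // => r _.
rewrite (pd_eqU Uo (g := fun=> 0) _ Ux) ?pd_cst ?mulr0 // => y Uy.
by apply: star0; exact: w0.
Qed.

Lemma faces3 (i j k : 'I_7) (I := [tuple i; j; k]) :
  [/\ [tuple tnth I (lift ord0 r) | r < 2] = [tuple j; k],
      [tuple tnth I (lift (lift ord0 ord0) r) | r < 2] = [tuple i; k]
    & [tuple tnth I (lift (lift ord0 (lift ord0 ord0)) r) | r < 2] = [tuple i; j]].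
Proof. by rewrite !mktuple2 /I !(tnth_nth ord0) /=; split. Qed.

Lemma reps_laplacian i j k : reps (fun x => laplacian_phi phi x [tuple i; j; k])
  (- 2%:R * ((del i tA *m gA) j k + (del j tA *m gA) k i + (del k tA *m gA) i j)).
Proof.
rewrite -(cyc_d_low dD dM halfP gA_s hA_s hg_A i j k (tA_skew Uo phi_smooth phi_G2 phi_closed)).
(* The cyclic sum has to become the alternating sum over faces of [ext_d], in which the middle face
   is (i, k). *)
have tk : (tA *m gA) k i = - (tA *m gA) i k.
  have := congr1 (fun B : 'M[A]_7 => B i k) (tA_skew Uo phi_smooth phi_G2 phi_closed).
  by rewrite mxE mxnE.
rewrite tk; set w := tA *m gA.
have -> : - 2%:R * (d i (w j k) + d j (- w i k) + d k (w i j)) =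
    d i (- (2%:R * w j k)) - d j (- (2%:R * w i k)) + d k (- (2%:R * w i j)).
  have dz p z : d p (- (2%:R * z)) = - 2%:R * d p z.
    by rewrite (dN dD) -mulr_natl !mulr_natl mulr2n dD mulNr mulr_natl mulr2n.
  rewrite !dz (dN dD).
  have h4 (a b c e : A) : - a * (b + - c + e) = - a * b - - a * c + - a * e by ring.
  exact: h4.
move=> x Ux.
have ev3 (a b c : A) : ev Ux (a - b + c) = ev Ux a - ev Ux b + ev Ux c by rewrite raddfD raddfB.
rewrite -[RHS]/(ev Ux _) ev3 !(ev_d Ux _ (reps_codiff_phi _ _)).
(* Since d phi = 0 on U, only d d^* phi remains. *)
rewrite /laplacian_phi /hodge_laplacian (codiff_zero _ phi_closed Ux) addr0.
have [e1 e2 e3] := faces3 i j k.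
rewrite /ext_d sum_ord3 e1 e2 e3 !(tnth_nth ord0) /= expr0 !exprS expr0 !mulr1 mul1r.
have h5 (a b c : R) : a + (- 1 * b + - 1 * - 1 * c) = a - b + c by ring.
exact: h5.
Qed.

Variable X : E -> E.
Hypothesis X_smooth : forall j, smooth_on U (fun x => X x 0 j).
Definition XA j : A := mk_sfun Uo (Smoothc_smooth (X_smooth j)).
Local Notation nab_vec := (@nab_vec A d half gA hA XA).
Lemma reps_X j : reps (fun x => X x 0 j) (XA j). Proof. exact: reps_mk. Qed.

Lemma reps_lie_phi i j k : reps (fun x => lie_derivative X phi x [tuple i; j; k])
  (\sum_p XA p * (nab CA p i *m gA) j k + (\sum_m nab_vec i m * (CA m *m gA) j k
    + \sum_m nab_vec j m * (CA i *m gA) m k + \sum_m nab_vec k m * (CA i *m gA) j m)).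
Proof.
rewrite -(lie_three_form dD dM halfP gA_s hA_s hg_A CA XA i j k).
have f p q r : reps (fun x => phi x [tuple p; q; r]) ((CA p *m gA) q r).
  by rewrite CA_lowE; exact: reps_phi.
apply: repsD.
  by apply: reps_sum => m; apply: repsM; [exact: reps_X | exact/reps_pd/f].
apply: (@reps_ext _ _ _ (fun x =>
    \sum_m pd i (fun y => X y 0 m) x * phi x [tuple m; j; k]
    + \sum_m pd j (fun y => X y 0 m) x * phi x [tuple i; m; k]
    + \sum_m pd k (fun y => X y 0 m) x * phi x [tuple i; j; m])).
  move=> x _; rewrite sum_ord3 !(tnth_nth ord0) /= addrA; congr (_ + _ + _).
  - by apply: eq_bigr => m _; have [-> _ _] := tsubst3 i j k m.
  - by apply: eq_bigr => m _; have [_ -> _] := tsubst3 i j k m.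
  - by apply: eq_bigr => m _; have [_ _ ->] := tsubst3 i j k m.
by do 2?apply: repsD; apply: reps_sum => m; apply: repsM; (exact: f || exact/reps_pd/reps_X).
Qed.

Lemma tsubst2 (i j m : 'I_7) : tsubst [tuple i; j] ord0 m = [tuple m; j] /\
  tsubst [tuple i; j] (lift ord0 ord0) m = [tuple i; m].
Proof. by rewrite /tsubst !mktuple2 !(tnth_nth ord0) /=; split. Qed.

Lemma reps_lie_metric i j :
  reps (fun x => lie_derivative X (metric_tensor (gmet phi)) x [tuple i; j])
  (\sum_m nab_vec i m * gA m j + \sum_m nab_vec j m * gA i m).
Proof.
rewrite -(lie_metric d halfP gA_s hA_s hg_A XA i j).
apply: repsD.
  by apply: reps_sum => m; apply: repsM; [exact: reps_X | exact/reps_pd/reps_g].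
apply: (@reps_ext _ _ _ (fun x => \sum_m pd i (fun y => X y 0 m) x * gmet phi x m j
    + \sum_m pd j (fun y => X y 0 m) x * gmet phi x i m)).
  move=> x _; rewrite sum_ord2 !(tnth_nth ord0) /=; congr (_ + _).
    by apply: eq_bigr => m _; have [-> _] := tsubst2 i j m.
  by apply: eq_bigr => m _; have [_ ->] := tsubst2 i j m.
by apply: repsD; apply: reps_sum => m; apply: repsM; (exact: reps_g || exact/reps_pd/reps_X).
Qed.

(** The 2-form X _| phi with its second index raised, so that [hA *m B] has both indices raised. *)
Let B := \sum_m XA m *: CA m.

Lemma B_skew : (hA *m B)^T = - (hA *m B).
Proof.
have PT m : (PA Uo phi_smooth m)^T = - PA Uo phi_smooth m.
  apply: evm_eq => x Ux; apply/matrixP => i j.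
  rewrite -map_trmx map_mxN mxE mxnE !mxE /= !ev_phiA.
  exact: (phi_swap' phi_G2 Ux).
have -> : B = (\sum_m XA m *: PA Uo phi_smooth m) *m hA.
  by rewrite mulmx_suml; apply: eq_bigr => m _; rewrite -scalemxAl.
set S := \sum_m _; have ST : S^T = - S.
  rewrite /S linear_sum -sumrN; apply: eq_bigr => m _.
  by rewrite linearZ /= PT scalerN.
by rewrite 2!trmx_mul ST hA_s mulmxN mulNmx mulmxA.
Qed.

Lemma reps_raise_iprod p a :
  reps (fun y => raise (gmet phi y) (iprod (X y) (phi y)) [tuple p; a]) ((hA *m B) p a).
Proof.
have -> : (hA *m B) p a = \sum_i \sum_j hA p i * (hA a j * \sum_m XA m * phiA [tuple m; i; j]).
  rewrite mulmxE3; apply: eq_bigr => i _; rewrite -mulr_sumr; congr (_ * _).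
  under [RHS]eq_bigr do rewrite mulr_sumr.
  rewrite exchange_big /B summxE; apply: eq_bigr => m _ /=.
  rewrite mxzE /CA mulmxE3 mulr_sumr; apply: eq_bigr => j _.
  rewrite [PA _ _ _ _ _]mxE (hE hA_s a j).
  have h4 (x y z : A) : x * (y * z) = z * (x * y) by ring.
  exact: h4.
apply: (@reps_ext _ _ _ (fun y => \sum_i \sum_j invmx (gmet phi y) p i *
  (invmx (gmet phi y) a j * \sum_m X y 0 m * phi y [tuple m; i; j]))).
  move=> y _; rewrite /raise pullback_tuple2; do 2! apply: eq_bigr => ? _.
  by congr (_ * (_ * _)); apply: eq_bigr => m _; rewrite -tuple3E.
do 2! apply: reps_sum => ?; apply: repsM; first exact: reps_h.
apply: repsM; first exact: reps_h.
by apply: reps_sum => m; apply: repsM; [exact: reps_X | exact: reps_phi].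
Qed.

Section SolitonPoint.
Variable lam : R.
Hypothesis hsol : forall x, U x -> forall I : 3.-tuple 'I_7,
  laplacian_phi phi x I = lam * phi x I + lie_derivative X phi x I.
Variables (x : E) (Ux : U x).

Let t := evm Ux tA.
Let Y : 'M[R]_7 := \matrix_(p, q) ev Ux (nab_vec p q).
Let X' q := ev Ux (XA q).
Let Cx j := evm Ux (CA j).
Let Nx p j := evm Ux (nab CA p j).
Let Om p q := evm Ux (curv p q).
Let D p := evm Ux (del p tA).
Let g := gmet phi x.

Lemma low_ev (T : 'M[A]_7) k l : (evm Ux T *m g) k l = ev Ux ((T *m gA) k l).
Proof. by rewrite /g -(evm_gA Uo phi_smooth phi_G2 Ux) -map_mxM mxE. Qed.

Lemma D_skew_point p : (D p *m g)^T = - (D p *m g).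
Proof.
have e := skew_del dD dM halfP gA_s hA_s hg_A p (tA_skew Uo phi_smooth phi_G2 phi_closed).
rewrite /D /g -(evm_gA Uo phi_smooth phi_G2 Ux) -map_mxM map_trmx e.
exact: map_mxN.
Qed.

Lemma D_tr_point p k : \tr (D p *m Cx k) + \tr (t *m Nx p k) = 0.
Proof.
have e := nab_trace_torsion half dD dM gA hA k (tA_trace Uo phi_smooth phi_G2 phi_closed) p.
rewrite -!map_mxM !trace_map_mx -raddfD e.
exact: rmorph0.
Qed.

Lemma tA_skew_point : (t *m g)^T = - (t *m g).
Proof.
have e := tA_skew Uo phi_smooth phi_G2 phi_closed.
rewrite /t /g -(evm_gA Uo phi_smooth phi_G2 Ux) -map_mxM map_trmx e.
exact: map_mxN.
Qed.

Lemma tA_trace_point k : \tr (t *m Cx k) = 0.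
Proof.
have e := tA_trace Uo phi_smooth phi_G2 phi_closed k.
by rewrite -map_mxM trace_map_mx e; exact: rmorph0.
Qed.

Lemma Om_skew1_point p q : Om q p = - Om p q.
Proof. by rewrite /Om (curv_skew1 d half gA hA p q); exact: map_mxN. Qed.

Lemma Om_metric_point p q : Om p q *m g + g *m (Om p q)^T = 0.
Proof.
have e := curv_metric dD dM dC halfP gA_s hA_s hg_A p q.
rewrite /Om /g -(evm_gA Uo phi_smooth phi_G2 Ux) map_trmx -!map_mxM -map_mxD e.
exact: map_mx0.
Qed.

Lemma Om_bianchi_point p q r k : Om p q r k + Om q r p k + Om r p q k = 0.
Proof.
have e := congr1 (ev Ux) (curv_bianchi d half hA gA_s p q r k).
rewrite rmorph0 2!rmorphD in e.
have oE a b i : Om a b i k = ev Ux (curv a b i k) by rewrite /Om [LHS]mxE.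
exact: etrans (congr2 +%R (congr2 +%R (oE p q r) (oE q r p)) (oE r p q)) e.
Qed.

Lemma Om_comm_point p q j :
  - (\sum_m Om p q j m *: Cx m) - Om p q *m Cx j + Cx j *m Om p q =
  \sum_n (D p q n - D q p n) *: psim g Cx n j
  + \sum_n (t q n *: dpsim Cx Nx p n j - t p n *: dpsim Cx Nx q n j).
Proof.
have e := nab_torsion_comm dD dM dC halfP gA_s hA_s hg_A p q j
  (nab_torsion Uo phi_smooth phi_G2).
have np a n : evm Ux (nab_psim d half gA hA CA a n j) = dpsim Cx Nx a n j.
  exact: map_product_rule.
exact: (map_rotation_comm (evm_gA Uo phi_smooth phi_G2 Ux) (np p) (np q) e).
Qed.

Lemma soliton_point i j k :
  - 2%:R * ((D i *m g) j k + (D j *m g) k i + (D k *m g) i j) =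
  lam * (Cx i *m g) j k + \sum_p X' p * (Nx p i *m g) j k
  + (\sum_m Y i m * (Cx m *m g) j k + \sum_m Y j m * (Cx i *m g) m k
     + \sum_m Y k m * (Cx i *m g) j m).
Proof.
have evS (a b : 'I_7 -> A) : ev Ux (\sum_m a m * b m) = \sum_m ev Ux (a m) * ev Ux (b m).
  by rewrite raddf_sum; apply: eq_bigr => m _; rewrite /= rmorphM.
have ev2 (a b c : A) : ev Ux (- 2%:R * (a + b + c)) = - 2%:R * (ev Ux a + ev Ux b + ev Ux c).
  by rewrite rmorphM rmorphN rmorph_nat !raddfD.
have ev4 (a b c e : A) : ev Ux (a + (b + c + e)) = ev Ux a + (ev Ux b + ev Ux c + ev Ux e).
  by rewrite !raddfD.
have eL := etrans (reps_laplacian i j k Ux) (ev2 _ _ _).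
have eR := etrans (reps_lie_phi i j k Ux) (ev4 _ _ _ _).
have lX (T : 'I_7 -> 'M[A]_7) a b :
    \sum_p X' p * (evm Ux (T p) *m g) a b = ev Ux (\sum_p XA p * (T p *m gA) a b).
  by rewrite evS; apply: eq_bigr => m _; rewrite (low_ev (T m) a b).
have lY q (T : 'I_7 -> 'M[A]_7) (a b : 'I_7 -> 'I_7) :
    \sum_m Y q m * (evm Ux (T m) *m g) (a m) (b m) =
    ev Ux (\sum_m nab_vec q m * (T m *m gA) (a m) (b m)).
  rewrite evS; apply: eq_bigr => m _.
  by rewrite [Y _ _]mxE; rewrite (low_ev (T m) (a m) (b m)).
have lC : lam * (Cx i *m g) j k = lam * phi x [tuple i; j; k].
  congr (_ * _); apply: etrans (low_ev _ j k) _; rewrite CA_lowE; exact: ev_phiA.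
have eqL := congr1 ( *%R (- 2%:R)) (congr2 +%R (congr2 +%R (low_ev (del i tA) j k)
  (low_ev (del j tA) k i)) (low_ev (del k tA) i j)).
apply: etrans eqL (etrans (esym eL) (etrans (hsol Ux _) _)).
rewrite eR addrA; apply: esym; apply: (congr2 +%R).
  by apply: (congr2 +%R) => //; exact: (lX (fun p => nab CA p i)).
apply: (congr2 +%R); first apply: (congr2 +%R).
- exact: (lY i (fun m => CA m) (fun=> j) (fun=> k)).
- exact: (lY j (fun m => CA i) (fun m => m) (fun=> k)).
- exact: (lY k (fun m => CA i) (fun=> j) (fun m => m)).
Qed.

Lemma ricci_point i j : ricci (gmet phi) i j x = \sum_k Om k j i k.
Proof.
apply: etrans (reps_ricci Uo phi_smooth phi_G2 i j Ux) _.
apply: etrans (raddf_sum (ev Ux) _ _ _) _; apply: eq_bigr => k _.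
by rewrite /Om [RHS]mxE.
Qed.

Lemma torsion_point i k : torsion phi i k x = (t *m g) i k.
Proof. by rewrite mulmxE3; apply: eq_bigr => m _; rewrite /t ev_t. Qed.

Lemma lie_metric_point i j : lie_derivative X (metric_tensor (gmet phi)) x [tuple i; j] =
  (Y *m g) i j + (Y *m g) j i.
Proof.
apply: etrans (reps_lie_metric i j Ux) _; apply: etrans (raddfD (ev Ux) _ _) _.
have gE a b : ev Ux (gA a b) = g a b by rewrite /g -(evm_gA Uo phi_smooth phi_G2 Ux) [RHS]mxE.
have gs a b : gmet phi x a b = gmet phi x b a by rewrite -[in LHS](gmet_sym phi_G2 Ux) mxE.
rewrite !mulmxE3; congr (_ + _); apply: etrans (raddf_sum (ev Ux) _ _ _) _;
  apply: eq_bigr => m _ /=; rewrite rmorphM /= gE [Y _ _]mxE //.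
by rewrite /g gs.
Qed.

Lemma chart_metric_equation i j :
  - ricci (gmet phi) i j x - 3%:R^-1 * torsion_norm2 phi x * gmet phi x i j
  - 2%:R * \sum_(k < 7) torsion_mixed phi i k x * torsion phi k j x
  = 3%:R^-1 * lam * gmet phi x i j
    + 2%:R^-1 * lie_derivative X (metric_tensor (gmet phi)) x [tuple i; j].
Proof.
have [u uu [e1 e2 e3]] := g2_frame phi_G2 Ux; have uF := mulmxV uu.
rewrite ricci_point lie_metric_point /torsion_norm2.
have -> : \sum_k torsion_mixed phi i k x * torsion phi k j x = \sum_k t i k * (t *m g) k j.
  by apply: eq_bigr => k _; rewrite torsion_point /t ev_t.
have -> : \sum_i \sum_j \sum_k \sum_l torsion phi i k x * torsion phi j l x *
    invmx (gmet phi x) i j * invmx (gmet phi x) k l =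
  \sum_i \sum_j \sum_k \sum_l (t *m g) i k * (t *m g) j l *
    ((invmx u)^T *m invmx u) i j * ((invmx u)^T *m invmx u) k l.
  do 4! apply: eq_bigr => ? _.
  by rewrite !torsion_point (ginv_frame uF e2).
have H1 := tA_skew_point; have H2 := D_skew_point; have H3 := Om_metric_point.
have H4 := Om_comm_point; have H5 := soliton_point.
(* The pointwise theorem is stated for a metric of the form u u^T, so the frame enters only here,
   after all differentiation. *)
rewrite /g e2 in H1 H2 H3 H4 H5 *.
exact: (point_metric_equation uF (Cx_frame Uo phi_smooth phi_G2 Ux uF e1 e2)
  (Nx_tor Uo phi_smooth phi_G2 Ux uF e1 e2 e3) H1 tA_trace_point H2 D_tr_point
  Om_skew1_point H3 Om_bianchi_point H4 H5).
Qed.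

Lemma chart_divergence (I : 1.-tuple 'I_7) :
  codiff (gmet phi) (gvol phi) (fun y => iprod (X y) (phi y)) x I = 0.
Proof.
have [u uu [e1 e2 e3]] := g2_frame phi_G2 Ux; have uF := mulmxV uu.
rewrite codiff_tensor //; last by move=> y Uy; apply: iprod_alternating; exact: phi_alt.
  have -> : I = [tuple tnth I ord0] by apply: eq_from_tnth => r; rewrite ord1 [RHS](tnth_nth ord0).
  rewrite pullback_tuple1 big1 ?mulr0 ?oppr0 // => a _.
  rewrite [X in _ * X](_ : _ = 0) ?mulr0 //.
  transitivity (ev Ux (\sum_p d p (nuA * (hA *m B) p a))).
    rewrite raddf_sum; apply: eq_bigr => p _ /=; symmetry; apply: ev_d.
    apply: repsM; first exact: reps_mk.
    by rewrite -tuple2E; exact: reps_raise_iprod.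
  rewrite (divergence_two_form dD dM halfP gA_s hA_s hg_A d_nu B_skew a) rmorphM /=.
  rewrite [X in _ * X](_ : _ = 0) ?mulr0 //.
  have H1 := tA_skew_point; have H2 := D_skew_point; have H3 := Om_metric_point.
  have H4 := Om_comm_point; have H5 := soliton_point.
  rewrite /g e2 in H1 H2 H3 H4 H5 *.
  have e := point_divergence uF (Cx_frame Uo phi_smooth phi_G2 Ux uF e1 e2)
    (Nx_tor Uo phi_smooth phi_G2 Ux uF e1 e2 e3) H1 tA_trace_point H2 D_tr_point
    Om_skew1_point H3 Om_bianchi_point H4 H5 a.
  apply: etrans (raddf_sum (ev Ux) _ _ _) (etrans _ e); apply: eq_bigr => p _ /=.
  rewrite -(ginv_frame uF e2) -(evm_hA Uo phi_smooth phi_G2 Ux).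
  have e0 : evm Ux (\sum_q (nab_vec p q *: CA q + XA q *: nab CA p q)) =
      \sum_q (Y p q *: Cx q + X' q *: Nx p q).
    apply: etrans (map_lincomb2 (ev Ux) _ _ _ _) _; apply: eq_bigr => q _.
    by rewrite [Y _ _]mxE.
  apply: etrans (congr1 (fun K : 'M[R]_7 => (evm Ux hA *m K) p a) e0).
  by rewrite -map_mxM [RHS]mxE.
move=> J; apply: smoothc_sum => m; apply: Smoothc_mul; exact: Smoothc_smooth.
Qed.
End SolitonPoint.
End ChartSoliton.
Local Open Scope classical_set_scope.
Local Open Scope ring_scope.

Theorem proposition9p4 (R : realType) (M : manifold7 R)
    (phi : cotensor_field M 3) (X : vector_family M) (lambda : R)
    (hsol : is_laplacian_soliton phi X lambda)
    (a : mindex M) (x : 'rV[R]_7) (hx : cimg (mchart a) x) :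
  (forall i j : 'I_7,
     - ricci (gmet (phi a)) i j x
     - 3%:R^-1 * torsion_norm2 (phi a) x * gmet (phi a) x i j
     - 2%:R * \sum_(k < 7)
         torsion_mixed (phi a) i k x * torsion (phi a) k j x
     = 3%:R^-1 * lambda * gmet (phi a) x i j
       + 2%:R^-1 *
         lie_derivative (X a) (metric_tensor (gmet (phi a))) x [tuple i; j])
  /\
  (forall I : 1.-tuple 'I_7,
     codiff (gmet (phi a)) (gvol (phi a))
       (fun y => iprod (X a y) (phi a y)) x I = 0).
Proof.
have [[[phi_smooth phi_alt _] phi_G2] phi_closed [X_smooth _] soliton] := hsol.
have Uo : open (cimg (mchart a)) by exact: cimg_open.
split=> [i j | I].
  exact: (chart_metric_equation Uo (phi_smooth a) (phi_G2 a) (phi_closed a) (phi_alt a)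
    (X_smooth a) (soliton a) hx).
exact: (chart_divergence Uo (phi_smooth a) (phi_G2 a) (phi_closed a) (phi_alt a)
  (X_smooth a) (soliton a) hx).
Qed.
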